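(* Let $\nu$ be a symmetric Lévy measure on $\mathbb{R}^d$ with $\nu(\mathbb{R}^d)=\infty$. Assume that there is $M_0>0$ with $$\int_{\mathbb{R}^d}e^{-t\Phi(\xi)}|\xi|\,d\xi\le M_0\,h(t)^{-d-1}\qquad\text{for all } t\in(0,\infty),$$ that $\operatorname{supp}(\nu)\subset B(0,r_0)$ for some $r_0>0$, and that there exist a constant $\gamma\in[0,d]$, a nonincreasing function $f:[0,\infty)\to[0,\infty]$ and constants $M_3,M_4>0$ such that $$\nu(A)\le M_3\,f(\delta(A))\,[\operatorname{diam}(A)]^\gamma\qquad\text{for all Borel } A\subset\mathbb{R}^d,$$ and $$\int_{|y|>r}f\left(s\vee|y|-\frac{|y|}{2}\right)\nu(dy)\le M_4\,f(s)\,\Psi\left(\frac1r\right)\qquad\text{for all } s>0,\ r>0.$$ Let $m_0=\int|y|^2\,\nu(dy)$ and $C^*=\frac{2em_0}{r_0}$. Then there exist positive constants $\theta=\theta(d,M_0)$, $c_1=c_1(d,M_0,M_3,M_4)$, $c_2=c_2(d,M_0)$, $c_3=c_3(d,M_0)$ such that for all $t>0$ $$p_t(x)\le c_1\begin{cases}h(t)^{-d}&\text{for } |x|\le\theta h(t),\\ t\,h(t)^{\gamma-d}f(|x|/4)+h(t)^{-d}e^{-c_2\frac{|x|}{h(t)}\log\left(1+\frac{c_3|x|}{h(t)}\right)}&\text{for } |x|\ge\theta h(t),\\ h(t)^{-d}\exp\left\{-\frac{|x|^2}{4em_0t}\right\}&\text{for } |x|\le C^*t,\\ h(t)^{-d}\exp\left\{-\frac{|x|}{4r_0}\log\left(\frac{r_0|x|}{2m_0t}\right)\right\}&\text{for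 } |x|\ge C^*t,\end{cases}$$ where each of the four bounds holds on the whole range indicated (the ranges overlap).
   Context: $d\in\{1,2,\dots\}$; $B(x,r)$ is the ball with center $x$ and radius $r$; $a\vee b=\max\{a,b\}$; $\delta(A)=\inf\{|y|:y\in A\}$; $\operatorname{diam}(A)=\sup\{|y-x|:x,y\in A\}$. A symmetric Lévy measure on $\mathbb{R}^d$ is a Borel measure $\nu$ with $\nu(\{0\})=0$, $\int(1\wedge|y|^2)\,\nu(dy)<\infty$ and $\nu(-D)=\nu(D)$ for all Borel $D$. Put $\Phi(\xi)=\int_{\mathbb{R}^d}(1-\cos(\xi\cdot y))\,\nu(dy)$. $\{P_t\}_{t\ge0}$ is the convolution semigroup of probability measures with $\int e^{i\xi\cdot y}P_t(dy)=e^{-t\Phi(\xi)}$. Put $\Psi(r)=\sup_{|\xi|\le r}\Phi(\xi)$ for $r>0$ (continuous, nondecreasing, unbounded), $\Psi^{-1}(s)=\sup\{r>0:\Psi(r)=s\}$ for $s>0$ and $h(t)=1/\Psi^{-1}(1/t)$ for $t>0$. Under the integral assumption in the claim each $P_t$, $t>0$, has a continuous density, denoted $p_t$. *)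

(* Defs.v *)
From HB Require Import structures.
From mathcomp Require Import all_boot all_order all_algebra.
From mathcomp Require Import all_classical all_reals all_analysis.
From mathcomp Require Import measurable_realfun.

Set Implicit Arguments.
Unset Strict Implicit.
Unset Printing Implicit Defensive.

Import Order.TTheory GRing.Theory Num.Theory.
Import numFieldNormedType.Exports.

Local Open Scope classical_set_scope.
Local Open Scope ring_scope.

Definition borel_display : measure_display.
Proof. exact. Qed.

Section borel_rV.
Context {R : realType} {d : nat}.

Let borel_set0 : <<s @open 'rV[R]_d >> set0.
Proof. exact: sigma_algebra0. Qed.

Let borel_setC A : <<s @open 'rV[R]_d >> A -> <<s @open 'rV[R]_d >> (~` A).
Proof. exact: sigma_algebraC. Qed.

Let borel_bigcup (F : (set 'rV[R]_d)^nat) :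
  (forall i, <<s @open 'rV[R]_d >> (F i)) ->
  <<s @open 'rV[R]_d >> (\bigcup_i (F i)).
Proof. exact: sigma_algebra_bigcup. Qed.

HB.instance Definition _ := @isMeasurable.Build borel_display 'rV[R]_d
  <<s @open 'rV[R]_d >> borel_set0 borel_setC borel_bigcup.

End borel_rV.

Section lebesgue_measure_rV.
Context {R : realType}.

Definition cons_rV d (z : measurableTypeR R * 'rV[R]_d) : 'rV[R]_d.+1 :=
  row_mx (const_mx z.1 : 'rV[R]_1) z.2.

Definition uncons_rV d (v : 'rV[R]_d.+1) : measurableTypeR R * 'rV[R]_d :=
  (v 0 0, \row_j v 0 (lift 0 j)).

Lemma cons_rVK d : cancel (@cons_rV d) (@uncons_rV d).
Proof.
move=> [x v]; rewrite /uncons_rV /cons_rV; congr pair => /=.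
  by rewrite mxE; case: splitP => [k _|k //]; rewrite mxE.
apply/rowP => j; rewrite !mxE; case: splitP => [k|k /= [jk]].
  by rewrite ord1.
by congr (v _ _); apply/val_inj.
Qed.

Lemma open_prod_measurable d (V : set (R * 'rV[R]_d)) : open V ->
  measurable (V : set (measurableTypeR R * 'rV[R]_d)).
Proof.
move=> oV.
pose e (k : nat) : R := k.+1%:R^-1.
have e0 k : 0 < e k by rewrite invr_gt0.
pose B (i : rat * 'rV[rat]_d * nat) : set (measurableTypeR R * 'rV[R]_d) :=
  ball (ratr i.1.1 : R) (e i.2) `*` ball (map_mx ratr i.1.2 : 'rV[R]_d) (e i.2).
pose F i := if `[< B i `<=` V >] then B i else set0.
have -> : V = \bigcup_i F i.
  apply/seteqP; split; last first.
    by move=> z [i _]; rewrite /F; case: asboolP => // BV /BV.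
  move=> z Vz.
  have /nbhs_ballP[r /= r0 rV] : nbhs z V.
    by move: oV; rewrite openE; apply.
  have [k kr] : exists k, e k + e k < r.
    have /ltr_add_invr[k] : 0 < r / 2 by rewrite divr_gt0.
    rewrite add0r => k_r; exists k.
    by rewrite [ltRHS](splitr r) ltrD.
  have ratP x : exists q : rat, `|x - ratr q| < e k.
    have /rat_in_itvoo[q] : x - e k < x + e k by rewrite ltrD2l gtrN.
    by rewrite in_itv/= => qx; exists q; rewrite distrC ltr_distl.
  have [c cP] := choice ratP.
  have Bz : B (c z.1, \row_j c (z.2 0 j), k) z.
    split; first by rewrite /ball/= /ball_ distrC.
    split=> // i j; rewrite !mxE /ball/= /ball_ distrC ord1; exact: cP.
  exists (c z.1, \row_j c (z.2 0 j), k) => //.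
  rewrite /F; case: asboolP => // nBV; exfalso; apply: nBV => w Bw; apply: rV.
  by split; apply: (le_ball (ltW kr)); apply: ball_triangle;
    [apply: ball_sym; exact: Bz.1|exact: Bw.1
    |apply: ball_sym; exact: Bz.2|exact: Bw.2].
apply: countable_bigcupT_measurable => // i; rewrite /F.
case: asboolP => // _; apply: measurableX.
  by apply: open_measurable; exact: ball_open.
by apply: sub_sigma_algebra; exact: ball_open.
Qed.

Lemma measurable_cons_rV d : measurable_fun [set: _] (@cons_rV d).
Proof.
apply: (@measurability _ _ _ _ _ _ (@open 'rV[R]_d.+1)) => // _ [U oU <-].
rewrite setTI; apply: open_prod_measurable.
rewrite openE => z Uz.
have /nbhs_ballP[r /= r0 rU] : nbhs (cons_rV z) U.
  by move: oU; rewrite openE; apply.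
apply/nbhs_ballP; exists r => //= w [zw1 zw2]; apply: rU; split=> // i j.
by rewrite !mxE; case: splitP => k _; [rewrite !mxE|exact: zw2.2].
Qed.

Lemma measurable_coord_rV d (i : 'I_d) :
  measurable_fun [set: 'rV[R]_d] (fun v => v 0 i : measurableTypeR R).
Proof.
apply: (measurability _ (RGenOpens.measurableE R)) => _ [_ [a [b ->] <-]].
rewrite setTI; apply: sub_sigma_algebra.
apply: open_comp => [v _|]; last exact: interval_open.
exact: coord_continuous.
Qed.

Lemma measurable_uncons_rV d : measurable_fun [set: _] (@uncons_rV d).
Proof.
apply: measurable_fun_pair; first exact: measurable_coord_rV.
apply: (@measurability _ _ _ _ _ _ (@open 'rV[R]_d)) => // _ [U oU <-].
rewrite setTI; apply: sub_sigma_algebra.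
rewrite openE => v Uv.
have /nbhs_ballP[r /= r0 rU] : nbhs (uncons_rV v).2 U.
  by move: oU; rewrite openE; apply.
apply/nbhs_ballP; exists r => //= w [_ vw]; apply: rU; split=> // i j.
by rewrite !mxE; exact: vw.
Qed.

Section succ.
Context {d : nat} (m : {sigma_finite_measure set 'rV[R]_d -> \bar R}).

Definition lebesgue_rV_succ : set 'rV[R]_d.+1 -> \bar R :=
  pushforward (lebesgue_measure \x m)%E (@cons_rV d).

Let succ0 : lebesgue_rV_succ set0 = 0%E.
Proof. by rewrite /lebesgue_rV_succ /pushforward preimage_set0 measure0. Qed.

Let succ_ge0 A : (0 <= lebesgue_rV_succ A)%E.
Proof. by rewrite /lebesgue_rV_succ /pushforward measure_ge0. Qed.

Let succ_sigma_additive : semi_sigma_additive lebesgue_rV_succ.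
Proof.
exact: (@measure_semi_sigma_additive _ _ _
  (measure_function_pushforward__canonical__measure_function_Measure
    (lebesgue_measure \x m)%E (@measurable_cons_rV d))).
Qed.

HB.instance Definition _ := isMeasure.Build _ _ _
  lebesgue_rV_succ succ0 succ_ge0 succ_sigma_additive.

Let succ_sigma_finite : sigma_finite setT lebesgue_rV_succ.
Proof.
have /sigma_finiteP[F [TF ndF Foo]] := sigma_finiteT (@lebesgue_measure R).
have /sigma_finiteP[G [TG ndG Goo]] := sigma_finiteT m.
exists (fun n => @uncons_rV d @^-1` (F n `*` G n)).
  apply/esym; rewrite -subTset => v _ /=.
  have [n _ Fn] : (\bigcup_n F n) (uncons_rV v).1 by rewrite -TF.
  have [k _ Gk] : (\bigcup_n G n) (uncons_rV v).2 by rewrite -TG.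
  exists (maxn n k) => //; split.
    by move: Fn; exact/subsetPset/ndF/leq_maxl.
  by move: Gk; exact/subsetPset/ndG/leq_maxr.
move=> n; have [? ?] := Foo n; have [? ?] := Goo n; split.
  rewrite -[X in measurable X]setTI; apply: measurable_uncons_rV => //.
  exact: measurableX.
rewrite /lebesgue_rV_succ /pushforward -comp_preimage.
have -> : @uncons_rV d \o @cons_rV d = id by apply/funext; exact: cons_rVK.
by rewrite preimage_id product_measure1E// lte_mul_pinfty// ge0_fin_numE.
Qed.

HB.instance Definition _ := Measure_isSigmaFinite.Build _ _ _
  lebesgue_rV_succ succ_sigma_finite.

End succ.

(* Lebesgue measure on R^d: the image of the d-fold product measure. *)
Fixpoint lebesgue_rV (d : nat) : {sigma_finite_measure set 'rV[R]_d -> \bar R} :=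
  match d with
  | 0 => \d_(0 : 'rV[R]_0)
  | d'.+1 => lebesgue_rV_succ (lebesgue_rV d')
  end.

Lemma lebesgue_rV_box d (a b : 'rV[R]_d) : (forall i, a 0 i <= b 0 i) ->
  lebesgue_rV d [set v | forall i, a 0 i <= v 0 i <= b 0 i] =
  (\prod_(i < d) (b 0 i - a 0 i))%:E.
Proof.
elim: d a b => [|d IHd] a b ab.
  by rewrite big_ord0 /= diracE mem_set//; case.
pose tl (v : 'rV[R]_d.+1) : 'rV[R]_d := (uncons_rV v).2.
have c0 (z : measurableTypeR R * 'rV[R]_d) : cons_rV z 0 0 = z.1.
  by have /(congr1 fst) := cons_rVK z.
have cS (z : measurableTypeR R * 'rV[R]_d) i : cons_rV z 0 (lift 0 i) = z.2 0 i.
  by have /(congr1 snd)/rowP/(_ i) := cons_rVK z; rewrite mxE.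
rewrite big_ord_recl /= /lebesgue_rV_succ /pushforward.
have -> : @cons_rV d @^-1` [set v | forall i, a 0 i <= v 0 i <= b 0 i] =
    `[a 0 0, b 0 0]%classic `*`
    [set v : 'rV[R]_d | forall i, tl a 0 i <= v 0 i <= tl b 0 i].
  apply/seteqP; split=> [z /= zab|z /= [z1 z2] i].
    split=> [|i]; first by have := zab 0; rewrite c0 in_itv.
    by have := zab (lift 0 i); rewrite cS !mxE.
  case: (unliftP 0 i) => [j ->|->]; last by rewrite c0; move: z1; rewrite in_itv.
  by have := z2 j; rewrite cS !mxE.
have mbox : measurable [set v : 'rV[R]_d | forall i, tl a 0 i <= v 0 i <= tl b 0 i].
  rewrite (_ : [set _ | _] = \bigcap_(i in [set: 'I_d])
     ((fun v : 'rV[R]_d => v 0 i) @^-1` `[tl a 0 i, tl b 0 i])).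
    apply: fin_bigcap_measurable => // i _.
    rewrite -[X in measurable X]setTI; apply: measurable_coord_rV => //.
  apply/seteqP; split=> [v /= vab i _|v /= vab i].
    by rewrite /= in_itv /= vab.
  by have := vab i I; rewrite /= in_itv.
rewrite product_measure1E// [X in (_ * X)%E]IHd; last by move=> i; rewrite !mxE.
have /= -> := @lebesgue_measure_itv R `[a 0 0, b 0 0].
rewrite lte_fin; case: ltP => [_|ba].
  by rewrite -EFinB -EFinM; congr (_ * _)%:E; apply: eq_bigr => i _; rewrite !mxE.
by have /eqP -> : a 0 0 == b 0 0; rewrite ?eq_le ?ab// subrr mul0r mul0e.
Qed.

End lebesgue_measure_rV.

Section levy_process.
Context {R : realType} {d : nat}.
Implicit Types (x y xi : 'rV[R]_d) (A B U : set 'rV[R]_d) (r s t : R).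

Definition dotv x y : R := \sum_(i < d) x 0 i * y 0 i.

(* The library norm `|x| on 'rV[R]_d is the sup norm, hence this definition. *)
Definition enorm x : R := Num.sqrt (dotv x x).

Definition eball x r : set 'rV[R]_d := [set y | enorm (y - x) < r].

(* On the empty set this is 0, since inf set0 = 0 in the library. *)
Definition delta A : R := inf [set enorm y | y in A].

Definition diam A : \bar R :=
  ereal_sup [set (enorm (y - x))%:E | x in A & y in A].

Definition measure_support (mu : set 'rV[R]_d -> \bar R) : set 'rV[R]_d :=
  [set x | forall U, open U -> U x -> (0 < mu U)%E].

Definition symmetric_levy_measure (nu : {measure set 'rV[R]_d -> \bar R}) :=
  [/\ nu [set 0] = 0%E,
      (\int[nu]_y (Num.min 1 (enorm y ^+ 2))%:E < +oo)%E
    & forall D : set ('rV[R]_d), measurable D -> nu [set - y | y in D] = nu D].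

Section symbol.
Variable nu : {measure set 'rV[R]_d -> \bar R}.

Definition Phi xi : R := \int[nu]_y (1 - cos (dotv xi y)).

Definition Psi r : R := sup [set Phi xi | xi in [set xi | enorm xi <= r]].

Definition Psi_inv s : R := sup [set r | 0 < r /\ Psi r = s].

Definition hscale t : R := (Psi_inv t^-1)^-1.

End symbol.

Definition convolution_semigroup (P : R -> probability 'rV[R]_d R) :=
  (forall A, measurable A -> P 0 A = \d_(0 : 'rV[R]_d) A) /\
  (forall s t A, 0 <= s -> 0 <= t -> measurable A ->
    P (s + t) A = (\int[P s]_x P t [set y | A (x + y)%R])%E).

(* The Fourier transform of mu at xi is the real number a: real and imaginary
   parts of \int e^{i xi.y} mu(dy) = a. *)
Definition fourier_transform_at (mu : probability 'rV[R]_d R) xi (a : R) :=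
  \int[mu]_y cos (dotv xi y) = a /\ \int[mu]_y sin (dotv xi y) = 0.

Definition continuous_density (mu : probability 'rV[R]_d R)
    (q : 'rV[R]_d -> R) :=
  [/\ continuous q, forall x, 0 <= q x
    & forall A, measurable A ->
        mu A = (\int[lebesgue_rV d]_(x in A) (q x)%:E)%E].

End levy_process.

(* Main.v *)
From HB Require Import structures.
Require Import Defs.
From mathcomp Require Import all_boot all_order all_algebra.
From mathcomp Require Import all_classical all_reals all_analysis.
From mathcomp Require Import measurable_realfun ring lra.

(* Everything is done on the Fourier side with Gaussian smoothing.  The density
   at x is at most the eps -> 0 limit of T(x) = int g(xi) e^(-t Phi(xi)) cos(xi.x) dxi,
   g(xi) = e^(-eps^2 |xi|^2 / 2): smoothing by the normal law of covariance eps^2 is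
   bounded below by a constant on a cube of side 2 eps, and no Fourier inversion
   is needed.  The integral hypothesis gives int e^(-t Phi) <= (2^d + M0) h(t)^-d,
   hence the first bound.  For jumps bounded by rho an Esscher tilt by lam gives
     T(x) <= e^(- lam.x + eps^2 |lam|^2 / 2 + t |lam|^2 e^(|lam| rho) m / 2) int g e^(-t Phi),
   m being the second moment of the jumps; rho = r0 and optimising lam in the
   direction of x give the last two bounds.
   For the second bound jumps are cut at h = h(t).  Small jumps have the profile
   h^-d exp(-(s/4) log(1 + kap s)), s = |x| / h, by the tilt with rho = h.  Large
   jumps form a compound Poisson law, approximated by N steps of the random walk
   that jumps according to (t/N) nu restricted to |y| > h.  By induction on the
   number of steps the walk charges a set A at distance at least 2s from the
   origin by at most C t f(s) diam(A)^gamma; summing the profile over the shells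
   k h <= |x + y| < (k+1) h yields the term t h^(gamma-d) f(|x|/4). *)

(** The constants are fixed before [nu], [gamma], [r0] and [f]. In the second bound the sizes of the
    small and large parts of the measure are therefore controlled through t Psi(1/h) <= 4 alone:
    comparing |y|^2 and the indicator of |y| > h with 1 - cos along the coordinate axes bounds both
    t nu(|y| > h) and t h^-2 times the second moment of the small jumps by B = 64 d^2, and kap = 1 /
    (1 + B). Neither the law of the large jumps nor a complex tilt is constructed. Everything passes
    through one operator on functions, g |-> k g + int om(y) g(. + y) nu(dy), seen in three ways. On
    trigonometric integrals it is multiplication by k + int om(y) e^(i xi.y) nu(dy). Conjugated with
    e^(-lam.x) it is the same operator with weight om(y) e^(-lam.y), which replaces a shift of the
    contour to xi + i lam. For k >= 0 and om >= 0 of total mass 1 - k it preserves order and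
    constants, and this carries the small-jump profile through the walk. *)

Set Implicit Arguments.
Unset Strict Implicit.
Unset Printing Implicit Defensive.

Import Order.TTheory GRing.Theory Num.Theory.
Import numFieldNormedType.Exports.

Local Open Scope classical_set_scope.
Local Open Scope ring_scope.

(** * Real-valued integrals *)

Section integral_kit.
Context {R : realType} {dT : measure_display} {T : measurableType dT}.
Variable mu : {measure set T -> \bar R}.
Implicit Types f g : T -> R.

Definition rintegrable f := mu.-integrable setT (EFin \o f).

Lemma rintegrable_measurable f : rintegrable f -> measurable_fun setT f.
Proof. by move=> /integrableP[/measurable_EFinP]. Qed.

Lemma rintegrable_le f g : measurable_fun setT f -> (forall x, `|f x| <= g x) ->
  rintegrable g -> rintegrable f.
Proof.
move=> mf fg; apply: le_integrable => //; first exact/measurable_EFinP.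
by move=> x _ /=; rewrite lee_fin (le_trans (fg x))// ler_norm.
Qed.

Lemma rintegrableD f g : rintegrable f -> rintegrable g ->
  rintegrable (fun x => f x + g x).
Proof. by move=> fi gi; exact: (integrableD _ fi gi). Qed.

Lemma rintegrableN f : rintegrable f -> rintegrable (fun x => - f x).
Proof. by move=> fi; exact: (integrableN fi). Qed.

Lemma rintegrableB f g : rintegrable f -> rintegrable g ->
  rintegrable (fun x => f x - g x).
Proof. by move=> fi gi; apply: rintegrableD => //; exact: rintegrableN. Qed.

Lemma rintegrableZ k f : rintegrable f -> rintegrable (fun x => k * f x).
Proof. by move=> fi; exact: (integrableZl _ k fi). Qed.

Lemma rintegrable_norm f : rintegrable f -> rintegrable (fun x => `|f x|).
Proof. by move=> fi; exact: (integrable_norm fi). Qed.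

Lemma rintegrableM f g M : measurable_fun setT g -> (forall x, `|g x| <= M) ->
  rintegrable f -> rintegrable (fun x => f x * g x).
Proof.
move=> mg gM fi; apply: (@rintegrable_le _ (fun x => M * `|f x|)).
- by apply: measurable_funM => //; exact: rintegrable_measurable.
- by move=> x; rewrite normrM mulrC ler_wpM2r.
- exact/rintegrableZ/rintegrable_norm.
Qed.

Lemma ge0_rintegrable f : measurable_fun setT f -> (forall x, 0 <= f x) ->
  (\int[mu]_x (f x)%:E < +oo)%E -> rintegrable f.
Proof.
move=> mf f0 foo; apply/integrableP; split; first exact/measurable_EFinP.
by under eq_integral do rewrite /= ger0_norm//.
Qed.

Lemma RintegralE f : rintegrable f ->
  ((\int[mu]_x f x)%:E = \int[mu]_x (f x)%:E)%E.
Proof. by move=> fi; rewrite fineK//; exact: (integrable_fin_num _ fi). Qed.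

Lemma ler_Rint f g : rintegrable f -> rintegrable g ->
  (forall x, f x <= g x) -> \int[mu]_x f x <= \int[mu]_x g x.
Proof. by move=> fi gi fg; apply: le_Rintegral. Qed.

Lemma Rint_ge0 f : (forall x, 0 <= f x) -> 0 <= \int[mu]_x f x.
Proof. by move=> f0; apply: Rintegral_ge0. Qed.

Lemma RintD f g : rintegrable f -> rintegrable g ->
  \int[mu]_x (f x + g x) = \int[mu]_x f x + \int[mu]_x g x.
Proof. exact: RintegralD. Qed.

Lemma RintB f g : rintegrable f -> rintegrable g ->
  \int[mu]_x (f x - g x) = \int[mu]_x f x - \int[mu]_x g x.
Proof. exact: RintegralB. Qed.

Lemma RintZ k f : rintegrable f ->
  \int[mu]_x (k * f x) = k * \int[mu]_x f x.
Proof. exact: RintegralZl. Qed.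

Lemma RintN f : rintegrable f -> \int[mu]_x (- f x) = - \int[mu]_x f x.
Proof.
move=> fi; under eq_Rintegral do rewrite -mulN1r.
by rewrite RintZ// mulN1r.
Qed.

Lemma norm_Rint_le f g : rintegrable f -> rintegrable g ->
  (forall x, `|f x| <= g x) -> `|\int[mu]_x f x| <= \int[mu]_x g x.
Proof.
move=> fi gi fg; apply: (le_trans (le_normr_Rintegral _ fi)) => //.
by apply: ler_Rint => //; exact: rintegrable_norm.
Qed.

Lemma Rint_dominated (f_ : nat -> T -> R) f g :
  (forall n, measurable_fun setT (f_ n)) -> measurable_fun setT f ->
  (forall x, f_ n x @[n --> \oo] --> f x) ->
  rintegrable g -> (forall n x, `|f_ n x| <= g x) ->
  rintegrable f /\ \int[mu]_x f_ n x @[n --> \oo] --> \int[mu]_x f x.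
Proof.
move=> mf_ mf f_f gi fg.
have f_i n : rintegrable (f_ n) by apply: rintegrable_le gi.
have [] := @dominated_convergence _ _ _ mu setT measurableT
  (fun n x => (f_ n x)%:E) (EFin \o f) (EFin \o g).
- by move=> n; exact/measurable_EFinP.
- exact/measurable_EFinP.
- apply: aeW => x _; apply/fine_cvgP; split; first exact: nearW.
  exact: f_f.
- exact: gi.
- by apply: aeW => x n _; rewrite /= lee_fin.
move=> fi _ cv; split=> //.
apply: fine_cvg; rewrite RintegralE//; exact: cv.
Qed.

End integral_kit.

Section fubini_kit.
Context {R : realType} {d1 d2 : measure_display} {T1 : measurableType d1}
  {T2 : measurableType d2}.
Variables (m1 : {sigma_finite_measure set T1 -> \bar R})
  (m2 : {sigma_finite_measure set T2 -> \bar R}).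

(** A product of one-variable majorants is the form of domination met in all interchanges below:
    integrable weights, Gaussians, and the indicator of [0, 1]. *)
Lemma rintegrable_prod (F : T1 -> T2 -> R) (f : T1 -> R) (g : T2 -> R) :
  measurable_fun setT (fun z : T1 * T2 => F z.1 z.2) ->
  (forall x y, `|F x y| <= f x * g y) ->
  rintegrable m1 f -> rintegrable m2 g ->
  (m1 \x m2)%E.-integrable setT (fun z => (F z.1 z.2)%:E).
Proof.
move=> mF Ffg fi gi.
apply/integrable12ltyP; first exact/measurable_EFinP.
apply: (@le_lt_trans _ _ (\int[m1]_x \int[m2]_y (`|f x| * `|g y|)%:E)%E).
  apply: ge0_le_integral => //.
  - by move=> x _; apply: integral_ge0 => y _.
  - apply: (@measurable_fun_fubini_tonelli_F _ _ _ _ _ m2 (fun z => `|(F z.1 z.2)%:E|)%E) => //=.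
    exact/measurable_EFinP/measurableT_comp.
  - apply: (@measurable_fun_fubini_tonelli_F _ _ _ _ _ m2 (fun z => (`|f z.1| * `|g z.2|)%:E)%E) => //=.
    apply/measurable_EFinP/measurable_funM; apply: measurableT_comp => //; apply: measurableT_comp => //.
      exact: rintegrable_measurable fi.
    exact: rintegrable_measurable gi.
  move=> x _; apply: ge0_le_integral => //=.
  - apply/measurable_EFinP/measurableT_comp => //.
    exact: (measurableT_comp mF (pair1_measurable x)).
  - apply/measurable_EFinP/measurable_funM => //; apply: measurableT_comp => //.
    exact: rintegrable_measurable gi.
  - move=> y _; rewrite lee_fin (le_trans (Ffg x y))// -normrM; exact: ler_norm.
have ag := rintegrable_norm gi; have af := rintegrable_norm fi.
rewrite (eq_integral (fun x => (\int[m2]_y `|g y| * `|f x|)%:E)); last first.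
  move=> x _; rewrite mulrC EFinM RintegralE// -ge0_integralZl//.
  by apply/measurable_EFinP; exact: rintegrable_measurable ag.
rewrite /= -RintegralE; first exact: ltry.
exact: rintegrableZ.
Qed.

Lemma Rint_fubini (F : T1 -> T2 -> R) (f : T1 -> R) (g : T2 -> R) :
  measurable_fun setT (fun z : T1 * T2 => F z.1 z.2) ->
  (forall x y, `|F x y| <= f x * g y) ->
  rintegrable m1 f -> rintegrable m2 g ->
  \int[m1]_x (\int[m2]_y F x y) = \int[m2]_y (\int[m1]_x F x y).
Proof.
move=> mF Ffg fi gi; have iF := rintegrable_prod mF Ffg fi gi.
have := Fubini iF; rewrite /= => E.
rewrite /Rintegral; congr fine.
have i1 x : rintegrable m2 (F x).
  apply: (@rintegrable_le _ _ _ _ _ (fun y => f x * g y)) => //.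
    exact: (measurableT_comp mF (pair1_measurable x)).
  exact: rintegrableZ.
have i2 y : rintegrable m1 (F ^~ y).
  apply: (@rintegrable_le _ _ _ _ _ (fun x => g y * f x)) => //.
  - exact: (measurableT_comp mF (pair2_measurable y)).
  - by move=> x; rewrite mulrC.
  - exact: rintegrableZ.
transitivity (\int[m1]_x \int[m2]_y (F x y)%:E)%E.
  by apply: eq_integral => x _; rewrite -RintegralE//.
by rewrite E; apply: eq_integral => x _; rewrite -RintegralE//.
Qed.

Lemma measurable_Rint_param (F : T1 -> T2 -> R) (g : T2 -> R) :
  measurable_fun setT (fun z : T1 * T2 => F z.1 z.2) ->
  (forall x y, `|F x y| <= g y) -> rintegrable m2 g ->
  measurable_fun setT (fun x => \int[m2]_y F x y).
Proof.
move=> mF Fg gi.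
have mFx x : measurable_fun setT (F x).
  exact: (measurableT_comp mF (pair1_measurable x)).
have i1 x : rintegrable m2 (F x) by apply: rintegrable_le gi.
(* Adding the majorant [g] makes the integrand nonnegative, so that Tonelli's measurability
   statement applies to it. *)
have -> : (fun x => \int[m2]_y F x y) =
    (fun x => fine (\int[m2]_y (F x y + g y)%:E) - \int[m2]_y g y).
  apply/funext => x; rewrite -[fine _]/(\int[m2]_y (F x y + g y)).
  by rewrite RintD// addrK.
apply: measurable_funB => //.
apply: (measurableT_comp (fine_measurable measurableT)).
apply: (@measurable_fun_fubini_tonelli_F _ _ _ _ _ m2 (fun z => (F z.1 z.2 + g z.2)%:E)%E).
  apply/measurable_EFinP/measurable_funD => //; apply: measurableT_comp => //.
  exact: rintegrable_measurable gi.
move=> z; rewrite lee_fin -lerBlDr sub0r.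
by move: (Fg z.1 z.2); rewrite ler_norml => /andP[].
Qed.

End fubini_kit.

(** * Euclidean norm *)

Section euclidean.
Context {R : realType} {d : nat}.
Implicit Types x y z : 'rV[R]_d.

Lemma dotvC x y : dotv x y = dotv y x.
Proof. by apply: eq_bigr => i _; rewrite mulrC. Qed.

Lemma dotvDl x y z : dotv (x + y) z = dotv x z + dotv y z.
Proof. by rewrite -big_split; apply: eq_bigr => i _; rewrite mxE mulrDl. Qed.

Lemma dotvDr x y z : dotv z (x + y) = dotv z x + dotv z y.
Proof. by rewrite dotvC dotvDl !(dotvC z). Qed.

Lemma dotvZl k x y : dotv (k *: x) y = k * dotv x y.
Proof. by rewrite /dotv mulr_sumr; apply: eq_bigr => i _; rewrite mxE mulrA. Qed.

Lemma dotvZr k x y : dotv y (k *: x) = k * dotv y x.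
Proof. by rewrite dotvC dotvZl (dotvC y). Qed.

Lemma dotvNl x y : dotv (- x) y = - dotv x y.
Proof. by rewrite -scaleN1r dotvZl mulN1r. Qed.

Lemma dotvNr x y : dotv y (- x) = - dotv y x.
Proof. by rewrite dotvC dotvNl (dotvC y). Qed.

Lemma dotv0r x : dotv x 0 = 0.
Proof. by rewrite /dotv big1// => i _; rewrite mxE mulr0. Qed.

Lemma dotv_ge0 x : 0 <= dotv x x.
Proof. by apply: sumr_ge0 => i _; rewrite -expr2 sqr_ge0. Qed.

Lemma enorm_ge0 x : 0 <= enorm x. Proof. exact: sqrtr_ge0. Qed.

Lemma sqr_enorm x : enorm x ^+ 2 = dotv x x.
Proof. by rewrite sqr_sqrtr// dotv_ge0. Qed.

Lemma enormN x : enorm (- x) = enorm x.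
Proof. by rewrite /enorm dotvNl dotvNr opprK. Qed.

Lemma enorm0 : enorm (0 : 'rV[R]_d) = 0.
Proof. by rewrite /enorm dotv0r sqrtr0. Qed.

Lemma enormZ k x : enorm (k *: x) = `|k| * enorm x.
Proof.
by rewrite /enorm dotvZl dotvZr mulrA -expr2 sqrtrM ?sqr_ge0// sqrtr_sqr.
Qed.

Lemma ler_coord_enorm x i : `|x 0 i| <= enorm x.
Proof.
rewrite -sqrtr_sqr ler_wsqrtr// /dotv (bigD1 i)//= -expr2 lerDl.
by apply: sumr_ge0 => j _; rewrite -expr2 sqr_ge0.
Qed.

Lemma enorm_eq0 x : enorm x = 0 -> x = 0.
Proof.
move=> x0; apply/rowP => i; rewrite mxE; apply/eqP.
by rewrite -normr_eq0 eq_le normr_ge0 andbT -x0 ler_coord_enorm.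
Qed.

Lemma dotv_le_enorm x y : `|dotv x y| <= enorm x * enorm y.
Proof.
have [y0|y0] := eqVneq (enorm y) 0.
  by rewrite (enorm_eq0 y0) dotv0r enorm0 mulr0 normr0.
have yy : 0 < dotv y y by rewrite -sqr_enorm exprn_gt0// lt_def y0 enorm_ge0.
rewrite -ler_sqr ?nnegrE ?mulr_ge0 ?enorm_ge0//.
rewrite exprMn !sqr_enorm real_normK ?num_real//.
(* Cauchy-Schwarz: up to the factor |y|^2 this vector is the component of x orthogonal to y. *)
have := dotv_ge0 (dotv y y *: x - dotv x y *: y).
rewrite dotvDl !dotvDr !dotvNl !dotvNr !dotvZl !dotvZr (dotvC y x).
set a := dotv y y; set b := dotv x y; set c := dotv x x => h.
have : 0 <= a * (c * a - b ^+ 2) by apply: le_trans h _; rewrite le_eqVlt; apply/orP; left; apply/eqP; ring.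
by rewrite pmulr_rge0// subr_ge0.
Qed.

Lemma ler_enormD x y : enorm (x + y) <= enorm x + enorm y.
Proof.
rewrite -ler_sqr ?nnegrE ?addr_ge0 ?enorm_ge0// sqr_enorm dotvDl !dotvDr.
have := dotv_le_enorm x y; rewrite ler_norml => /andP[_].
rewrite sqrrD !sqr_enorm (dotvC y x); lra.
Qed.

Lemma sqr_enormE x : enorm x ^+ 2 = \sum_(i < d) x 0 i ^+ 2.
Proof. by rewrite sqr_enorm; apply: eq_bigr => i _; rewrite expr2. Qed.

End euclidean.

(** * Measurability of vector-valued maps *)

Section measurable_rV.
Context {R : realType}.
Context {dT : measure_display} {T : measurableType dT}.

(** The sigma-algebra is generated by the open sets, not by the coordinates; since [cons_rV] is
    measurable from the product, coordinates can be added one at a time. *)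
Lemma measurable_fun_rV n (f : T -> 'rV[R]_n) :
  (forall i, measurable_fun setT (fun t => f t 0 i)) -> measurable_fun setT f.
Proof.
elim: n f => [|n IH] f mf.
  have -> : f = cst 0 by apply/funext => t; apply/rowP => -[].
  exact: measurable_cst.
have -> : f = @cons_rV R n \o (fun t => (f t 0 0, \row_j f t 0 (lift 0 j))).
  apply/funext => t; apply/rowP => i; rewrite /cons_rV /= !mxE.
  case: splitP => j ij; rewrite mxE.
    by congr (f t 0 _); apply/val_inj; rewrite /= ij ord1.
  by congr (f t 0 _); apply/val_inj.
apply: measurableT_comp; first exact: measurable_cons_rV.
apply: measurable_fun_pair; first exact: mf.
apply: IH => i.
under eq_fun do rewrite mxE; exact: mf.
Qed.

Context {n : nat}.
Implicit Types f g : T -> 'rV[R]_n.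

Lemma measurable_coord f i : measurable_fun setT f ->
  measurable_fun setT (fun t => f t 0 i).
Proof. exact: (measurableT_comp (measurable_coord_rV i)). Qed.

Lemma measurable_rVD f g : measurable_fun setT f -> measurable_fun setT g ->
  measurable_fun setT (fun t => f t + g t).
Proof.
move=> mf mg; apply: measurable_fun_rV => i.
under eq_fun do rewrite mxE.
by apply: measurable_funD; exact: measurable_coord.
Qed.

Lemma measurable_rVN f : measurable_fun setT f ->
  measurable_fun setT (fun t => - f t).
Proof.
move=> mf; apply: measurable_fun_rV => i; under eq_fun do rewrite mxE.
by apply: measurableT_comp => //; exact: measurable_coord.
Qed.

Lemma measurable_dotv f g : measurable_fun setT f -> measurable_fun setT g ->
  measurable_fun setT (fun t => dotv (f t) (g t)).
Proof.
move=> mf mg; apply: measurable_sum => i.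
by apply: measurable_funM; exact: measurable_coord.
Qed.

Lemma measurable_enorm f : measurable_fun setT f ->
  measurable_fun setT (fun t => enorm (f t)).
Proof.
move=> mf; apply: (@measurableT_comp _ _ _ _ _ _ (@Num.sqrt R) _ (fun t => dotv (f t) (f t))).
  by apply: continuous_measurable_fun; exact: sqrt_continuous.
exact: measurable_dotv.
Qed.

End measurable_rV.

(** * Fourier transform of the Gaussian *)

Section line_integrals.
Context {R : realType}.
Notation mu := (@lebesgue_measure R).
Implicit Types f F : R -> R.

Lemma Rint_itv_derive f F (a b : R) : a < b -> continuous f ->
  (forall x : R, is_derive x 1 F (f x)) -> \int[mu]_(x in `[a, b]) f x = F b - F a.
Proof.
move=> ab cf dF.
have cF x : F @ x --> F x.
  by apply: differentiable_continuous; apply/derivable1_diffP; case: (dF x).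
rewrite /Rintegral (@continuous_FTC2 _ f F)//.
- exact: continuous_subspaceT.
- split.
  + by move=> x _; case: (dF x).
  + by apply: cvg_at_right_filter; exact: cF.
  + by apply: cvg_at_left_filter; exact: cF.
- by move=> x _; rewrite derive1E; case: (dF x).
Qed.

Lemma Rint_line_derive f F : continuous f -> rintegrable mu f ->
  (forall x : R, is_derive x 1 F (f x)) ->
  F n%:R @[n --> \oo] --> (0 : R) -> F (- n%:R) @[n --> \oo] --> (0 : R) ->
  \int[mu]_x f x = 0.
Proof.
move=> cf fi dF F1 F2.
(* The half-width is [n.+1] because [Rint_itv_derive] asks for a nondegenerate interval. *)
pose fn (n : nat) := f \_ `[- n.+1%:R, n.+1%:R].
have [] := @Rint_dominated _ _ _ mu fn f (fun x => `|f x|).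
- move=> n; apply/(measurable_restrictT _ _).1; first exact: measurable_itv.
  apply: measurable_funTS; exact: continuous_measurable_fun.
- exact: continuous_measurable_fun.
- move=> x; apply: cvg_near_cst; near=> n.
  rewrite /fn patchE mem_set//= in_itv/= -ler_norml.
  rewrite (le_trans (ltW (archi_boundP (normr_ge0 x))))//.
  rewrite ler_nat ltnW// ltnS; near: n; exact: nbhs_infty_ge.
- exact: rintegrable_norm.
- move=> n x; rewrite /fn patchE; case: ifP => //; by rewrite normr0.
move=> _ cv.
have c0 : (\int[mu]_x fn n x) @[n --> \oo] --> (0 : R).
  have -> : (fun n => \int[mu]_x fn n x) = (fun n => F n.+1%:R - F (- n.+1%:R)).
    apply/funext => n; rewrite /fn -Rintegral_mkcond (@Rint_itv_derive f F)//.
    by rewrite (@lt_trans _ _ 0)// oppr_lt0.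
  rewrite -[X in _ --> X](subr0 0); apply: cvgB.
    by move: F1; rewrite -cvg_shiftS.
  by move: F2; rewrite -cvg_shiftS.
exact: (cvg_unique _ cv c0).
Unshelve. all: by end_near. Qed.

End line_integrals.

Section gaussian_line.
Context {R : realType}.
Notation mu := (@lebesgue_measure R).
Implicit Types c x u th : R.

Definition gauss1 c x : R := expR (- (c * x ^+ 2)).

Lemma gauss1_gt0 c x : 0 < gauss1 c x. Proof. exact: expR_gt0. Qed.

Lemma continuous_gauss1 c : continuous (gauss1 c).
Proof.
move=> x; apply: (@continuous_comp _ _ _ (fun x => - (c * x ^+ 2)) expR); last exact: continuous_expR.
apply: cvgN; apply: cvgM; first exact: cvg_cst.
exact: exprn_continuous.
Qed.

Lemma measurable_gauss1 c : measurable_fun setT (gauss1 c).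
Proof. by apply: continuous_measurable_fun; exact: continuous_gauss1. Qed.

Lemma rintegrable_gauss1 c : 0 < c -> rintegrable mu (gauss1 c).
Proof.
(* The normal density of variance 1/(2c) is a constant multiple of [gauss1 c]. *)
move=> c0; pose s := Num.sqrt (c *+ 2)^-1.
have s0 : 0 < s by rewrite sqrtr_gt0 invr_gt0 mulrn_wgt0.
have [sn0 pk0] : s != 0 /\ normal_peak s != 0.
  by rewrite gt_eqF//; split=> //; rewrite gt_eqF// normal_peak_gt0// gt_eqF.
have := @rintegrableZ _ _ _ mu (normal_peak s)^-1 _ (integrable_normal_pdf 0 s).
congr rintegrable; apply/funext => x.
rewrite normal_pdfE// mulKf// /normal_fun subr0 sqr_sqrtr; last first.
  by rewrite invr_ge0 mulrn_wge0// ltW.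
by rewrite /gauss1; congr expR; field; rewrite gt_eqF.
Qed.

(** Half of the Gaussian absorbs the factor |x|, by u <= 1 + u^2 <= e^(u^2) with u = sqrt(c/2)
    |x|. *)
Lemma ler_mul_gauss1 c x : 0 < c ->
  `|x| * gauss1 c x <= (Num.sqrt (c / 2))^-1 * gauss1 (c / 2) x.
Proof.
move=> c0; set s := Num.sqrt _.
have s0 : 0 < s by rewrite sqrtr_gt0 divr_gt0.
have ss : s ^+ 2 = c / 2 by rewrite sqr_sqrtr// divr_ge0// ltW.
have -> : gauss1 c x = gauss1 (c / 2) x * expR (- (c / 2 * x ^+ 2)).
  by rewrite /gauss1 -expRD; congr expR; field.
rewrite [leRHS]mulrC mulrCA ler_pM2l ?gauss1_gt0//.
rewrite expRN ler_pdivrMr ?expR_gt0// ler_pdivlMl// (le_trans _ (expR_ge1Dx _))//.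
rewrite -ss -exprMn -(real_normK (num_real (s * x))) normrM (gtr0_norm s0).
have := sqr_ge0 (s * `|x| - 1); set a := s * _; rewrite sqrrB expr1n mulr1 => h.
have : 0 <= a ^+ 2 by apply: sqr_ge0.
have : 0 <= a by rewrite mulr_ge0// ltW.
rewrite mulr2n in h; lra.
Qed.

Lemma rintegrable_id_gauss1 c : 0 < c -> rintegrable mu (fun x => `|x| * gauss1 c x).
Proof.
move=> c0; have c2 : 0 < c / 2 by rewrite divr_gt0.
apply: rintegrable_le (rintegrableZ (Num.sqrt (c / 2))^-1 (rintegrable_gauss1 c2)).
- by apply: measurable_funM; [exact: normr_measurable|exact: measurable_gauss1].
- by move=> x; rewrite normrM normr_id (gtr0_norm (gauss1_gt0 _ _)); exact: ler_mul_gauss1.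
Qed.

Definition gauss_int c : R := \int[mu]_x gauss1 c x.

Lemma is_derive_gauss1 c x :
  is_derive (x : R) (1 : R) (gauss1 c) (- (2 * c * x) * gauss1 c x).
Proof.
rewrite /gauss1; apply: is_derive_eq.
rewrite /GRing.scale /=; ring.
Qed.

Lemma is_derive_gauss1_sin c u th x :
  is_derive (x : R) (1 : R) (fun x => gauss1 c x * sin (x * u + th))
   (gauss1 c x * cos (x * u + th) * u - 2 * c * x * gauss1 c x * sin (x * u + th)).
Proof.
have h := is_derive_gauss1 c x.
apply: is_derive_eq.
rewrite /GRing.scale /=; ring.
Qed.

Lemma is_derive_gauss1_cos c x th u :
  is_derive (u : R) (1 : R) (fun u => gauss1 c x * cos (x * u + th))
   (- x * gauss1 c x * sin (x * u + th)).
Proof.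
apply: is_derive_eq.
rewrite /GRing.scale /=; ring.
Qed.

Lemma continuous_cos_line u th : continuous (fun x : R => cos (x * u + th)).
Proof.
by move=> x; apply: differentiable_continuous; apply/derivable1_diffP; apply: ex_derive.
Qed.

Lemma continuous_sin_line u th : continuous (fun x : R => sin (x * u + th)).
Proof.
by move=> x; apply: differentiable_continuous; apply/derivable1_diffP; apply: ex_derive.
Qed.

Lemma measurable_cos_line u th : measurable_fun setT (fun x : R => cos (x * u + th)).
Proof.
by apply: continuous_measurable_fun; exact: continuous_cos_line.
Qed.

Lemma measurable_sin_line u th : measurable_fun setT (fun x : R => sin (x * u + th)).
Proof.
by apply: continuous_measurable_fun; exact: continuous_sin_line.
Qed.

Lemma rintegrable_gauss1_cos c u th : 0 < c ->
  rintegrable mu (fun x => gauss1 c x * cos (x * u + th)).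
Proof.
move=> c0; apply: (@rintegrableM _ _ _ _ _ _ 1) (rintegrable_gauss1 c0).
  exact: measurable_cos_line.
by move=> x; rewrite ler_norml cos_geN1 cos_le1.
Qed.

Lemma rintegrable_id_gauss1_sin c u th : 0 < c ->
  rintegrable mu (fun x => x * gauss1 c x * sin (x * u + th)).
Proof.
move=> c0; apply: rintegrable_le (rintegrable_id_gauss1 c0).
  apply: measurable_funM; last exact: measurable_sin_line.
  by apply: measurable_funM => //; exact: measurable_gauss1.
move=> x; rewrite !normrM (gtr0_norm (gauss1_gt0 _ _)) ler_piMr//.
  by rewrite mulr_ge0// ltW// gauss1_gt0.
by rewrite ler_norml sin_geN1 sin_le1.
Qed.

Lemma cvg_gauss1_nat c : 0 < c -> gauss1 c n%:R @[n --> \oo] --> (0 : R).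
Proof.
move=> c0; apply: (@squeeze_cvgr _ _ _ _ (fun=> 0) (fun n => (c * n%:R)^-1)).
- near=> n; rewrite ltW ?gauss1_gt0//= /gauss1 expRN.
  have n0 : 0 < n%:R :> R by rewrite ltr0n; near: n; exact: nbhs_infty_gt.
  rewrite lef_pV2 ?posrE ?expR_gt0 ?mulr_gt0//.
  have n1 : 1 <= n%:R :> R by rewrite ler1n -(ltr0n R).
  apply: le_trans (expR_ge1Dx _).
  have : 0 <= c * n%:R * (n%:R - 1) by rewrite !mulr_ge0// ?subr_ge0// ltW.
  lra.
- exact: cvg_cst.
- under eq_fun do rewrite invfM; rewrite -(mulr0 c^-1).
  apply: cvgM; first exact: cvg_cst.
  by rewrite -cvg_shiftS; exact: cvg_harmonic.
Unshelve. all: by end_near. Qed.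

Lemma is_derive_Rint_gauss1_cos c th u : 0 < c ->
  is_derive (u : R) (1 : R) (fun u => \int[mu]_x (gauss1 c x * cos (x * u + th)))
    (\int[mu]_x (- x * gauss1 c x * sin (x * u + th))).
Proof.
move=> c0; pose f u x := gauss1 c x * cos (x * u + th).
have d1 v x : partial1of2 f v x = - x * gauss1 c x * sin (x * v + th).
  rewrite partial1of2E; have [_ ->] // := is_derive_gauss1_cos c x th v.
have Iu : [set` `]u - 1, u + 1[%R] u by rewrite /= in_itv /= ltrBlDr !ltrDl ltr01.
have h1 v : [set` `]u - 1, u + 1[%R] v -> mu.-integrable setT (EFin \o f v).
  by move=> _; exact: rintegrable_gauss1_cos.
have h2 v x : [set` `]u - 1, u + 1[%R] v -> setT x -> derivable (f ^~ x) v 1.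
  by move=> _ _; case: (is_derive_gauss1_cos c x th v).
have h3 x : 0 <= `|x| * gauss1 c x by rewrite mulr_ge0// ltW// gauss1_gt0.
have h4 v x : [set` `]u - 1, u + 1[%R] v -> setT x -> `|partial1of2 f v x| <= `|x| * gauss1 c x.
  move=> _ _; rewrite d1 !normrM normrN (gtr0_norm (gauss1_gt0 _ _)) ler_piMr//.
  by rewrite ler_norml sin_geN1 sin_le1.
split.
  by apply: (derivable_under_integral measurableT Iu h1 h2 h3 _ h4); exact: rintegrable_id_gauss1.
rewrite -derive1E (differentiation_under_integral measurableT Iu h1 h2 h3 _ h4); last exact: rintegrable_id_gauss1.
by apply: eq_Rintegral => x _; exact: d1.
Qed.

(** The derivative of [gauss1 c x * sin (x * u + th)] integrates to 0 over the line, the Gaussian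
    killing both boundary terms. *)
Lemma Rint_gauss1_sin_byparts c th u : 0 < c ->
  \int[mu]_x (x * gauss1 c x * sin (x * u + th)) =
  u / (2 * c) * \int[mu]_x (gauss1 c x * cos (x * u + th)).
Proof.
move=> c0.
have ic := rintegrable_gauss1_cos u th c0.
have isn := rintegrable_id_gauss1_sin u th c0.
pose f x := u * (gauss1 c x * cos (x * u + th)) - 2 * c * (x * gauss1 c x * sin (x * u + th)).
have fi : rintegrable mu f by apply: rintegrableB; exact: rintegrableZ.
have F0 (s : nat -> R) : (forall n, gauss1 c (s n) = gauss1 c n%:R) ->
    (gauss1 c (s n) * sin (s n * u + th)) @[n --> \oo] --> (0 : R).
  move=> sn; apply: (@squeeze_cvgr _ _ _ _ (fun n => - gauss1 c n%:R) (fun n => gauss1 c n%:R)).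
  - apply: nearW => n; rewrite -ler_norml normrM sn (gtr0_norm (gauss1_gt0 _ _)).
    by rewrite ler_piMr ?(ltW (gauss1_gt0 _ _))// ler_norml sin_geN1 sin_le1.
  - by rewrite -oppr0; apply: cvgN; exact: cvg_gauss1_nat.
  - exact: cvg_gauss1_nat.
have : \int[mu]_x f x = 0.
  apply: (@Rint_line_derive _ f (fun x => gauss1 c x * sin (x * u + th))) => //.
  - move=> x; apply: cvgB; apply: cvgM; try exact: cvg_cst; apply: cvgM.
    + exact: continuous_gauss1.
    + exact: continuous_cos_line.
    + by apply: cvgM => //; exact: continuous_gauss1.
    + exact: continuous_sin_line.
  - move=> x; apply: is_derive_eq (is_derive_gauss1_sin c u th x) _.
    by rewrite /f; ring.
  - exact: F0.
  - by apply: (F0 (fun n => - n%:R)) => n; rewrite /gauss1 sqrrN.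
rewrite RintB ?RintZ//; try exact: rintegrableZ.
move=> /eqP; rewrite subr_eq0 => /eqP E.
have c20 : 2 * c != 0 by rewrite gt_eqF// mulr_gt0.
by apply: (mulfI c20); rewrite -E; field; rewrite gt_eqF.
Qed.

(** As a function of u the integral solves F' = -u/(2c) F, so F(u) e^(u^2/(4c)) is constant. The
    value of [gauss_int c] is left open; a lower bound for it is enough later. *)
Theorem Rint_gauss1_cos c u th : 0 < c ->
  \int[mu]_x (gauss1 c x * cos (x * u + th)) =
  gauss_int c * expR (- (u ^+ 2 / (4 * c))) * cos th.
Proof.
move=> c0; pose F v := \int[mu]_x (gauss1 c x * cos (x * v + th)).
pose E v := expR (v ^+ 2 / (4 * c)).
have dF v : is_derive (v : R) (1 : R) F (- (v / (2 * c)) * F v).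
  apply: is_derive_eq (is_derive_Rint_gauss1_cos th v c0) _.
  rewrite /F mulNr -Rint_gauss1_sin_byparts// -RintN; last exact: rintegrable_id_gauss1_sin.
  by apply: eq_Rintegral => x _; rewrite !mulNr.
have dFE (v : R) : is_derive (v : R) (1 : R) (fun v => F v * E v) 0.
  apply: is_derive_eq; rewrite /GRing.scale /=.
  by rewrite /E; field; rewrite gt_eqF.
have := is_derive_0_is_cst u 0 dFE.
rewrite /E expr0n /= mul0r expR0 mulr1 => FE.
have F0 : F 0 = gauss_int c * cos th.
  rewrite /F /gauss_int -RintegralZr//; last exact: rintegrable_gauss1.
  by apply: eq_Rintegral => x _; rewrite mulr0 add0r.
rewrite mulrAC -F0 -FE -mulrA -expRD addrN expR0 mulr1//.
Qed.

(** On the interval |x| <= 1/sqrt(2c) the integrand is at least e^(-1/2). *)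
Lemma gauss_int_gt c : 0 < c -> 2 * expR (- 2^-1) / Num.sqrt (2 * c) <= gauss_int c.
Proof.
move=> c0; set s := Num.sqrt _.
have s0 : 0 < s by rewrite sqrtr_gt0 mulr_gt0.
have ss : s ^+ 2 = 2 * c by rewrite sqr_sqrtr// mulr_ge0// ltW.
have -> : 2 * expR (- 2^-1) / s = expR (- 2^-1) * (s^-1 - - s^-1) by ring.
have iI := @integrable_indic_itv R (- s^-1) s^-1 true false.
have -> : s^-1 - - s^-1 = \int[mu]_x (\1_`[- s^-1, s^-1] x).
  rewrite /Rintegral integral_indic ?setIT//.
  have /= -> := @lebesgue_measure_itv R `[- s^-1, s^-1].
  by rewrite lte_fin -subr_gt0 opprK addr_gt0 ?invr_gt0.
rewrite -RintZ//; apply: ler_Rint; [exact: rintegrableZ|exact: rintegrable_gauss1|].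
move=> x; rewrite indicE; case: (boolP (x \in _)) => [|_]; last by rewrite mulr0 ltW// gauss1_gt0.
rewrite inE /= in_itv /= -ler_norml mulr1 /gauss1 ler_expR lerN2 => xs.
have : (s * `|x|) ^+ 2 <= 1.
  by rewrite expr_le1 ?mulr_ge0// ?(ltW s0)// mulrC -ler_pdivlMr// mul1r.
rewrite exprMn ss real_normK ?num_real//; lra.
Qed.

End gaussian_line.

(** * Gaussian integrals in R^n, by induction on the dimension *)

Section integral_succ.
Context {R : realType} {d : nat}.
Variable m : {sigma_finite_measure set 'rV[R]_d -> \bar R}.
Notation mu := (@lebesgue_measure R).
Implicit Type f : 'rV[R]_d.+1 -> R.

Lemma rintegrable_succ f : measurable_fun setT f ->
  (mu \x m)%E.-integrable setT (fun z => (f (cons_rV z))%:E) ->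
  rintegrable (lebesgue_rV_succ m) f.
Proof.
move=> mf fi.
have mf' : measurable_fun setT (EFin \o f) by exact/measurable_EFinP.
by apply: (integrable_pushforward (@measurable_cons_rV R d) mf').
Qed.

Lemma Rint_succ f : measurable_fun setT f ->
  (mu \x m)%E.-integrable setT (fun z => (f (cons_rV z))%:E) ->
  \int[lebesgue_rV_succ m]_x f x = fine (\int[mu \x m]_z (f (cons_rV z))%:E)%E.
Proof.
move=> mf fi; rewrite /Rintegral; congr fine.
apply: (integral_pushforward (@measurable_cons_rV R d) (D := setT)
  (f := EFin \o f)) => //.
exact/measurable_EFinP.
Qed.

End integral_succ.

Section gaussian_rV.
Context {R : realType}.

Definition gauss n c (x : 'rV[R]_n) : R := expR (- (c * dotv x x)).

Lemma gauss_gt0 n c (x : 'rV[R]_n) : 0 < gauss c x. Proof. exact: expR_gt0. Qed.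

Lemma measurable_gauss n c : measurable_fun setT (@gauss n c).
Proof.
apply: measurableT_comp => //; apply: measurableT_comp => //.
by apply: measurable_funM => //; exact: measurable_dotv.
Qed.

Lemma measurable_cos_dotv n (u : 'rV[R]_n) th :
  measurable_fun setT (fun x : 'rV[R]_n => cos (dotv x u + th)).
Proof.
apply: (@measurableT_comp _ _ _ _ _ _ cos) => /=.
  by apply: continuous_measurable_fun; exact: continuous_cos.
by apply: measurable_funD => //; exact: measurable_dotv.
Qed.

Lemma measurable_sin_dotv n (u : 'rV[R]_n) th :
  measurable_fun setT (fun x : 'rV[R]_n => sin (dotv x u + th)).
Proof.
apply: (@measurableT_comp _ _ _ _ _ _ sin) => /=.
  by apply: continuous_measurable_fun; exact: continuous_sin.
by apply: measurable_funD => //; exact: measurable_dotv.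
Qed.

Lemma cons_rV0 n (z : measurableTypeR R * 'rV[R]_n) : cons_rV z 0 0 = z.1.
Proof. by have /(congr1 fst) := cons_rVK z. Qed.

Lemma cons_rVS n (z : measurableTypeR R * 'rV[R]_n) i :
  cons_rV z 0 (lift 0 i) = z.2 0 i.
Proof. by have /(congr1 snd)/rowP/(_ i) := cons_rVK z; rewrite mxE. Qed.

Lemma dotv_cons n (z w : measurableTypeR R * 'rV[R]_n) :
  dotv (cons_rV z) (cons_rV w) = z.1 * w.1 + dotv z.2 w.2.
Proof.
rewrite /dotv big_ord_recl !cons_rV0; congr (_ + _).
by apply: eq_bigr => i _; rewrite !cons_rVS.
Qed.

Lemma uncons_rVK n (v : 'rV[R]_n.+1) : cons_rV (uncons_rV v) = v.
Proof.
apply/rowP => i; case: (unliftP 0 i) => [j ->|->]; last exact: cons_rV0.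
by rewrite cons_rVS mxE.
Qed.

Lemma gauss_cons n c (z : measurableTypeR R * 'rV[R]_n) :
  gauss c (cons_rV z) = gauss1 c z.1 * gauss c z.2.
Proof. by rewrite /gauss dotv_cons /gauss1 -expRD; congr expR; ring. Qed.

Lemma rintegrable_gauss n c : 0 < c -> rintegrable (lebesgue_rV n) (@gauss n c).
Proof.
move=> c0; elim: n => [|n IH].
  apply: ge0_rintegrable.
  - exact: measurable_gauss.
  - by move=> x; rewrite ltW// gauss_gt0.
  - rewrite integral_dirac//; last by apply/measurable_EFinP; exact: measurable_gauss.
    by rewrite diracT mul1e ltry.
apply: rintegrable_succ; first exact: measurable_gauss.
apply: (rintegrable_prod (F := fun x y => gauss c (cons_rV (x, y))) _ _
  (rintegrable_gauss1 c0) IH).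
- apply: (measurableT_comp (measurable_gauss _)).
  by under eq_fun do rewrite -surjective_pairing; exact: measurable_cons_rV.
- by move=> x y; rewrite gauss_cons (gtr0_norm (mulr_gt0 (gauss1_gt0 _ _) (gauss_gt0 _ _))).
Qed.

(* The phase th makes the induction on the dimension close without sine terms. *)
Theorem Rint_gauss_cos n c (u : 'rV[R]_n) th : 0 < c ->
  \int[lebesgue_rV n]_x (gauss c x * cos (dotv x u + th)) =
  gauss_int c ^+ n * expR (- (dotv u u / (4 * c))) * cos th.
Proof.
move=> c0; elim: n u th => [|n IH] u th.
  rewrite /Rintegral integral_dirac//; last first.
    apply/measurable_EFinP/measurable_funM; first exact: measurable_gauss.
    exact: measurable_cos_dotv.
  rewrite diracT mul1e /= /gauss /dotv !big_ord0 mulr0 mul0r oppr0 expR0 add0r.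
  by rewrite expr0 mulr1.
set f := fun x : 'rV[R]_n.+1 => _.
have mf : measurable_fun setT f.
  by apply: measurable_funM; [exact: measurable_gauss|exact: measurable_cos_dotv].
pose w := uncons_rV u.
pose F (x : R) (y : 'rV[R]_n) := f (cons_rV (x, y)).
have FE x y : F x y = gauss1 c x * (gauss c y * cos (dotv y w.2 + (x * w.1 + th))).
  rewrite /F /f gauss_cons -(uncons_rVK u) dotv_cons /= -mulrA; congr (_ * (_ * cos _)).
  by rewrite addrCA addrA.
have mF : measurable_fun setT (fun z : measurableTypeR R * 'rV[R]_n => F z.1 z.2).
  apply: (measurableT_comp mf).
  by under eq_fun do rewrite -surjective_pairing; exact: measurable_cons_rV.
have Fb x y : `|F x y| <= gauss1 c x * gauss c y.
  rewrite FE normrM (gtr0_norm (gauss1_gt0 _ _)) ler_pM2l ?gauss1_gt0//.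
  rewrite normrM (gtr0_norm (gauss_gt0 _ _)) ler_piMr ?(ltW (gauss_gt0 _ _))//.
  by rewrite ler_norml cos_geN1 cos_le1.
have iF := rintegrable_prod mF Fb (rintegrable_gauss1 c0) (rintegrable_gauss n c0).
have iF' : (lebesgue_measure \x lebesgue_rV n)%E.-integrable setT (fun z => (f (cons_rV z))%:E).
  by apply: eq_integrable iF => // -[].
rewrite (Rint_succ mf iF').
have -> : (fun z => (f (cons_rV z))%:E) = (fun z => (F z.1 z.2)%:E).
  by apply/funext => -[].
rewrite -integral12_prod_meas1//= /fubini_F.
have Fi x : rintegrable (lebesgue_rV n) (F x).
  apply: rintegrable_le (rintegrableZ (gauss1 c x) (rintegrable_gauss n c0)) => //.
  exact: (measurableT_comp mF (pair1_measurable x)).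
transitivity (\int[lebesgue_measure]_x (\int[lebesgue_rV n]_y F x y)).
  by rewrite /Rintegral; congr fine; apply: eq_integral => x _; rewrite RintegralE//.
pose K := gauss_int c ^+ n * expR (- (dotv w.2 w.2 / (4 * c))).
transitivity (\int[lebesgue_measure]_x (K * (gauss1 c x * cos (x * w.1 + th)))).
  apply: eq_Rintegral => x _; under eq_Rintegral do rewrite FE.
  rewrite RintZ ?IH; first by rewrite /K; ring.
  apply: (rintegrableM (M := 1) _ _ (rintegrable_gauss n c0)).
    exact: measurable_cos_dotv.
  by move=> y; rewrite ler_norml cos_geN1 cos_le1.
rewrite RintZ; last exact: rintegrable_gauss1_cos.
rewrite Rint_gauss1_cos// /K -[in RHS](uncons_rVK u) dotv_cons -/w.
rewrite -expr2 [in RHS]mulrDl opprD expRD (exprSr (gauss_int c) n); ring.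
Qed.

End gaussian_rV.

(** * Elementary inequalities *)

Section elementary.
Context {R : realType}.
Implicit Types x y u v : R.

Lemma MVT_line (f f' : R -> R) a b : a < b ->
  (forall x : R, is_derive x (1 : R) f (f' x)) ->
  exists2 c, a < c < b & f b - f a = f' c * (b - a).
Proof.
move=> ab df.
have d1 x : x \in `]a, b[ -> is_derive x (1 : R) f (f' x) by move=> _; exact: df.
have d2 : {within `[a, b], continuous f}.
  apply: continuous_subspaceT => x.
  by apply: differentiable_continuous; apply/derivable1_diffP; case: (df x).
by have [c] := MVT ab d1 d2; rewrite in_itv; exists c.
Qed.

Lemma sin_le x : 0 <= x -> sin x <= x.
Proof.
rewrite le_eqVlt => /predU1P[<-|x0]; first by rewrite sin0.
have dF (y : R) : is_derive y (1 : R) (fun x => x - sin x) (1 - cos y) by apply: is_derive_eq.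
have [c _] := MVT_line x0 dF.
rewrite sin0 !subr0 => E.
by rewrite -subr_ge0 E; apply: mulr_ge0; [rewrite subr_ge0 cos_le1|exact: ltW].
Qed.

Lemma sqr_sin_le x : sin x ^+ 2 <= x ^+ 2.
Proof.
wlog x0 : x / 0 <= x => [h|].
  have [/h//|/ltW] := leP 0 x.
  by rewrite -oppr_ge0 => /h; rewrite sinN !sqrrN.
have x2 : 0 <= x ^+ 2 by exact: sqr_ge0.
have [x1|x1] := leP x 1.
  have s0 : 0 <= sin x.
    by apply: sin_ge0_pi; rewrite x0/=; have := @pi_ge2 R; lra.
  by rewrite ler_sqr ?nnegrE// sin_le.
have := sqr_ge0 (cos x); have := cos2Dsin2 x; nra.
Qed.

Lemma one_sub_cosE x : 1 - cos x = 2 * sin (x / 2) ^+ 2.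
Proof.
have {1}-> : x = (x / 2) *+ 2 by rewrite mulr2n -splitr.
by rewrite cos_mulr2n sin2cos2; ring.
Qed.

Lemma one_sub_cos_ge0 x : 0 <= 1 - cos x.
Proof. by rewrite subr_ge0 cos_le1. Qed.

Lemma one_sub_cos_le2 x : 1 - cos x <= 2.
Proof. by have := cos_geN1 x; lra. Qed.

Lemma one_sub_cos_le x : 1 - cos x <= x ^+ 2 / 2.
Proof. by rewrite one_sub_cosE; have := sqr_sin_le (x / 2); lra. Qed.

Lemma one_sub_cos_ge x : `|x| <= 2 -> x ^+ 2 / 8 <= 1 - cos x.
Proof.
wlog x0 : x / 0 <= x => [h|].
  have [/h//|/ltW] := leP 0 x.
  by rewrite -oppr_ge0 => /h; rewrite normrN sqrrN cosN.
rewrite ger0_norm// => x2; rewrite one_sub_cosE.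
set v := x / 2; have v0 : 0 <= v by rewrite divr_ge0.
have v1 : v <= 1 by rewrite /v; lra.
(* On [0, 1] one has cos c >= 1 - c^2/2 >= 1/2, so sin v - v/2 is nondecreasing there. *)
suff vs : v / 2 <= sin v.
  have xE : x = v * 2 by rewrite /v; lra.
  have : (v / 2) ^+ 2 <= sin v ^+ 2.
    by rewrite ler_sqr ?nnegrE// ?divr_ge0//; apply: le_trans vs; rewrite divr_ge0.
  rewrite xE; lra.
move: v0; rewrite le_eqVlt => /predU1P[<-|v0]; first by rewrite sin0; lra.
have dF (y : R) : is_derive y (1 : R) (fun x => sin x - x / 2) (cos y - 2^-1).
  by apply: is_derive_eq; rewrite /GRing.scale /=; ring.
have [c /andP[c0 cv]] := MVT_line v0 dF.
rewrite sin0 mul0r !subr0 => E.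
rewrite -subr_ge0 E; apply: mulr_ge0; last exact: ltW.
have := one_sub_cos_le c; nra.
Qed.

(** The source of the doubling property Psi(2r) <= 4 Psi(r), which stands in for continuity of Psi
    at the scale h. *)
Lemma one_sub_cos_mul2 x : 1 - cos (2 * x) <= 4 * (1 - cos x).
Proof.
have -> : 2 * x = x *+ 2 by rewrite mulr_natl.
rewrite cos_mulr2n; have := cos_geN1 x; have := cos_le1 x; nra.
Qed.

Lemma expR_symm_ge2 u : 2 <= expR u + expR (- u).
Proof.
have -> : expR u = expR (u / 2) ^+ 2 by rewrite -expRM_natr; congr expR; lra.
have -> : expR (- u) = expR (- (u / 2)) ^+ 2 by rewrite -expRM_natr; congr expR; lra.
have : expR (u / 2) * expR (- (u / 2)) = 1 by rewrite -expRD subrr expR0.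
have := sqr_ge0 (expR (u / 2) - expR (- (u / 2))); nra.
Qed.

(** The left side is (e^(u/2) - e^(-u/2))^2, and for u >= 0 the inequality 1 - e^(-u) <= u gives
    e^(u/2) - e^(-u/2) <= u e^(u/2). *)
Lemma expR_symm_le u : expR u + expR (- u) - 2 <= u ^+ 2 * expR `|u|.
Proof.
wlog u0 : u / 0 <= u => [h|].
  have [/h//|/ltW] := leP 0 u.
  by rewrite -oppr_ge0 => /h; rewrite normrN sqrrN opprK [expR (- u) + _]addrC.
rewrite ger0_norm//.
set a := expR (u / 2); set b := expR (- (u / 2)).
have -> : expR u = a ^+ 2 by rewrite -expRM_natr; congr expR; lra.
have -> : expR (- u) = b ^+ 2 by rewrite -expRM_natr; congr expR; lra.
have ab : a * b = 1 by rewrite -expRD subrr expR0.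
have a0 : 0 < a by exact: expR_gt0.
have b0 : 0 < b by exact: expR_gt0.
have ba : b <= a by rewrite ler_expR; lra.
have h : a - b <= u * a.
  have : 1 - u <= b ^+ 2 by rewrite -expRM_natr; apply: le_trans (expR_ge1Dx _) _; rewrite ler_expR; lra.
  have -> : b ^+ 2 = b / a by rewrite expr2 -[a]invrK -(mulr1_eq ab); field; rewrite gt_eqF.
  rewrite ler_pdivlMr//; lra.
have -> : a ^+ 2 + b ^+ 2 - 2 = (a - b) ^+ 2 by rewrite sqrrB ab; ring.
by rewrite -exprMn ler_sqr ?nnegrE ?subr_ge0 ?mulr_ge0// ltW.
Qed.

Lemma onem_expR_ge u : 0 <= u < 1 -> expR (- (u / (1 - u))) <= 1 - u.
Proof.
move=> /andP[u0 u1]; have v0 : 0 < 1 - u by rewrite subr_gt0.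
rewrite expRN -[leRHS]invrK lef_pV2 ?posrE ?expR_gt0 ?invr_gt0//.
apply: le_trans (expR_ge1Dx _).
have -> // : 1 + u / (1 - u) = (1 - u)^-1 by field; rewrite gt_eqF.
Qed.

(** With v = u/N, the power (1 - v)^N lies between e^(-u/(1 - v)) and e^(-u). [N] is a sequence of
    its own because the number of walk steps must also exceed t times the total mass of the
    jumps. *)
Lemma euler_limit (N : nat -> nat) (u : nat -> R) l :
  (forall n, n < N n)%N -> (forall n, 0 <= u n) -> u n @[n --> \oo] --> l ->
  (1 - u n / (N n)%:R) ^+ N n @[n --> \oo] --> expR (- l).
Proof.
move=> nN u0 ul.
have N0 n : 0 < (N n)%:R :> R by rewrite ltr0n (leq_ltn_trans _ (nN n)).
have uN0 : (u n / (N n)%:R) @[n --> \oo] --> (0 : R).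
  rewrite -(mulr0 l); apply: cvgM => //.
  apply: (@squeeze_cvgr _ _ _ _ (fun=> 0) (@harmonic R)).
  - apply: nearW => n; rewrite invr_ge0 ltW//= /harmonic lef_pV2 ?posrE//.
    by rewrite ler_nat.
  - exact: cvg_cst.
  - exact: cvg_harmonic.
have cE (v : nat -> R) k : v n @[n --> \oo] --> k -> expR (- v n) @[n --> \oo] --> expR (- k).
  by move=> vk; apply: (cvg_comp _ expR (cvgN vk)); exact: continuous_expR.
apply: (@squeeze_cvgr _ _ _ _ (fun n => expR (- (u n / (1 - u n / (N n)%:R)))) (fun n => expR (- u n))).
- have lt1 : \forall n \near \oo, u n / (N n)%:R < 1 by apply: (cvgr_lt 0 uN0).
  near=> n; have v1 : u n / (N n)%:R < 1 by near: n.
  have v0 : 0 <= u n / (N n)%:R by rewrite divr_ge0// ltW.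
  have w0 : 0 <= 1 - u n / (N n)%:R by rewrite subr_ge0 ltW.
  set v := u n / _ in v1 v0 w0 *.
  have uE : u n = v * (N n)%:R by rewrite /v divfK// gt_eqF.
  apply/andP; split.
    have -> : - (u n / (1 - v)) = - (v / (1 - v)) * (N n)%:R by rewrite uE; ring.
    rewrite expRM_natr lerXn2r ?nnegrE ?expR_ge0//.
    by apply: onem_expR_ge; rewrite v0.
  have -> : - u n = - v * (N n)%:R by rewrite uE mulNr.
  rewrite expRM_natr lerXn2r ?nnegrE ?expR_ge0//.
  exact: expR_ge1Dx.
- apply: cE; rewrite -[X in _ --> X]divr1 -[X in _ / X]subr0.
  apply: cvgM => //; apply: cvgV; first by rewrite subr0.
  by apply: cvgB => //; exact: cvg_cst.
- exact: cE.
Unshelve. all: by end_near. Qed.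

End elementary.

(** * Step operators on trigonometric integrals *)

Section trigonometric_integrals.
Context {R : realType} {n : nat}.
Notation V := 'rV[R]_n.
Notation leb := (@lebesgue_rV R n).
Implicit Types (a b : V -> R) (w lam : V).

(** Real part of the Fourier integral with coefficient a - i b. The sine term is needed because a
    tilted weight is no longer symmetric. *)
Definition trig_int a b w : R :=
  \int[leb]_xi (a xi * cos (dotv xi w) + b xi * sin (dotv xi w)).

Definition gauss_dominated c a :=
  measurable_fun setT a /\ exists M, forall xi, `|a xi| <= M * gauss c xi.

Variables (c : R) (c0 : 0 < c).
Notation gd := (gauss_dominated c).

Lemma gd_integrable a : gd a -> rintegrable leb a.
Proof.
move=> [ma [M aM]]; apply: rintegrable_le aM _ => //.
exact/rintegrableZ/rintegrable_gauss.
Qed.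

Lemma gdM a (f : V -> R) M : gd a -> measurable_fun setT f -> (forall xi, `|f xi| <= M) ->
  gd (fun xi => a xi * f xi).
Proof.
move=> [ma [K aK]] mf fM; split; first exact: measurable_funM.
exists (K * M) => xi; rewrite normrM mulrAC.
by apply: ler_pM.
Qed.

Lemma gdD a b : gd a -> gd b -> gd (fun xi => a xi + b xi).
Proof.
move=> [ma [M aM]] [mb [K bK]]; split; first exact: measurable_funD.
by exists (M + K) => xi; rewrite mulrDl (le_trans (ler_normD _ _))// lerD.
Qed.

Lemma gdN a : gd a -> gd (fun xi => - a xi).
Proof.
move=> [ma [M aM]]; split; first exact: measurableT_comp.
by exists M => xi; rewrite normrN.
Qed.

Lemma gdB a b : gd a -> gd b -> gd (fun xi => a xi - b xi).
Proof. by move=> ga gb; apply: gdD => //; exact: gdN. Qed.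

Lemma gd_gauss : gd (@gauss R n c).
Proof.
split; first exact: measurable_gauss.
by exists 1 => xi; rewrite mul1r gtr0_norm// gauss_gt0.
Qed.

Lemma measurable_cos_dotv0 w : measurable_fun setT (fun xi : V => cos (dotv xi w)).
Proof. by have := measurable_cos_dotv w 0; under eq_fun do rewrite addr0. Qed.

Lemma measurable_sin_dotv0 w : measurable_fun setT (fun xi : V => sin (dotv xi w)).
Proof. by have := measurable_sin_dotv w 0; under eq_fun do rewrite addr0. Qed.

Lemma gd_trig a b w : gd a -> gd b ->
  gd (fun xi => a xi * cos (dotv xi w) + b xi * sin (dotv xi w)).
Proof.
move=> ga gb; apply: gdD.
  by apply: (gdM ga (measurable_cos_dotv0 w)) => xi; exact: cos_max.
by apply: (gdM gb (measurable_sin_dotv0 w)) => xi; exact: sin_max.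
Qed.

(** Forgets the phase of a - i b and keeps a majorant of its modulus. The hypothesis compares
    squares because the squared modulus is what [iter_step_op_trig] computes. *)
Lemma trig_int_le_sqr a b w (D : V -> R) : gd a -> gd b -> gd D ->
  (forall xi, 0 <= D xi) -> (forall xi, a xi ^+ 2 + b xi ^+ 2 <= D xi ^+ 2) ->
  `|trig_int a b w| <= \int[leb]_xi D xi.
Proof.
move=> ga gb gD D0 abD; apply: norm_Rint_le.
- exact/gd_integrable/gd_trig.
- exact: gd_integrable.
move=> xi; rewrite -ler_sqr ?nnegrE// real_normK ?num_real//.
apply: le_trans (abD xi).
have := cos2Dsin2 (dotv xi w); set C := cos _; set S := sin _ => CS.
rewrite -[leRHS]mulr1 -CS -subr_ge0.
have -> : (a xi ^+ 2 + b xi ^+ 2) * (C ^+ 2 + S ^+ 2) - (a xi * C + b xi * S) ^+ 2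
  = (a xi * S - b xi * C) ^+ 2 by ring.
exact: sqr_ge0.
Qed.

Lemma measurable_cos_dotv2 {dT : measure_display} (T : measurableType dT) (f g : T -> V) :
  measurable_fun setT f -> measurable_fun setT g ->
  measurable_fun setT (fun t => cos (dotv (f t) (g t))).
Proof.
move=> mf mg; apply: (@measurableT_comp _ _ _ _ _ _ cos) => /=.
  by apply: continuous_measurable_fun; exact: continuous_cos.
exact: measurable_dotv.
Qed.

Lemma measurable_sin_dotv2 {dT : measure_display} (T : measurableType dT) (f g : T -> V) :
  measurable_fun setT f -> measurable_fun setT g ->
  measurable_fun setT (fun t => sin (dotv (f t) (g t))).
Proof.
move=> mf mg; apply: (@measurableT_comp _ _ _ _ _ _ sin) => /=.
  by apply: continuous_measurable_fun; exact: continuous_sin.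
exact: measurable_dotv.
Qed.

Lemma measurable_trig_int_joint {dT : measure_display} (T : measurableType dT) a b (f : T -> V) :
  gd a -> gd b -> measurable_fun setT f ->
  measurable_fun setT (fun z : T * V =>
    a z.2 * cos (dotv z.2 (f z.1)) + b z.2 * sin (dotv z.2 (f z.1))).
Proof.
move=> [ma _] [mb _] mf.
have mf1 : measurable_fun setT (fun z : T * V => f z.1) by exact: measurableT_comp.
by apply: measurable_funD; apply: measurable_funM;
  [exact: measurableT_comp|exact: measurable_cos_dotv2
  |exact: measurableT_comp|exact: measurable_sin_dotv2].
Qed.

Lemma trig_bounded a b : gd a -> gd b ->
  exists2 M, 0 <= M & forall xi w,
    `|a xi * cos (dotv xi w) + b xi * sin (dotv xi w)| <= M * gauss c xi.
Proof.
move=> [ma [M aM]] [mb [K bK]].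
have h (e : V -> R) (N : R) (xi : V) : (forall xi, `|e xi| <= N * gauss c xi) -> 0 <= N * gauss c xi.
  by move=> eN; exact: (le_trans (normr_ge0 (e xi)) (eN xi)).
exists (M + K) => [|xi w].
  have := h _ _ 0 aM; have := h _ _ 0 bK.
  by rewrite !pmulr_lge0 ?gauss_gt0// => ? ?; rewrite addr_ge0.
rewrite mulrDl (le_trans (ler_normD _ _))// !normrM lerD//.
  by rewrite -[leRHS]mulr1 ler_pM// cos_max.
by rewrite -[leRHS]mulr1 ler_pM// sin_max.
Qed.

Lemma trig_int_bounded a b : gd a -> gd b ->
  exists M, forall w, `|trig_int a b w| <= M.
Proof.
move=> ga gb; have [M M0 aM] := trig_bounded ga gb.
exists (\int[leb]_xi (M * gauss c xi)) => w; apply: norm_Rint_le => //.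
- exact/gd_integrable/gd_trig.
- exact/rintegrableZ/rintegrable_gauss.
Qed.

Lemma measurable_trig_int a b : gd a -> gd b ->
  measurable_fun setT (trig_int a b).
Proof.
move=> ga gb; have [M M0 aM] := trig_bounded ga gb.
apply: (measurable_Rint_param (m2 := leb) (g := fun xi => M * gauss c xi)
  (F := fun w xi => a xi * cos (dotv xi w) + b xi * sin (dotv xi w))).
- exact: (measurable_trig_int_joint ga gb (measurable_id (D := setT))).
- by move=> w xi; exact: aM.
- exact/rintegrableZ/rintegrable_gauss.
Qed.

End trigonometric_integrals.

Section step_operator.
Context {R : realType} {n : nat}.
Notation V := 'rV[R]_n.
Notation leb := (@lebesgue_rV R n).
Variable nu : {sigma_finite_measure set V -> \bar R}.
Implicit Types (a b om g : V -> R) (w x lam : V).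

(** For om = q s and k = 1 - q int s dnu this is one Euler step of length q for the compound Poisson
    generator with jump measure s nu. *)
Definition step_op k om g x : R := k * g x + \int[nu]_y (om y * g (x + y)).

(** With [step_sin], the real and imaginary parts C and S of the Fourier multiplier of [step_op]. *)
Definition step_cos k om xi : R := k + \int[nu]_y (om y * cos (dotv xi y)).
Definition step_sin om xi : R := \int[nu]_y (om y * sin (dotv xi y)).

Variables (c : R) (c0 : 0 < c).
Notation gd := (gauss_dominated c).

Lemma measurable_transl x : measurable_fun setT (fun y : V => x + y).
Proof. by apply: measurable_rVD => //; exact: measurable_cst. Qed.

Section fixed_weight.
Variables (k : R) (om : V -> R).
Hypothesis iom : rintegrable nu om.

Let mom := rintegrable_measurable iom.

Lemma rintegrable_weight_cos xi : rintegrable nu (fun y => om y * cos (dotv xi y)).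
Proof.
apply: (rintegrableM (M := 1)) => //; last by move=> y; exact: cos_max.
by apply: measurable_cos_dotv2 => //; exact: measurable_cst.
Qed.

Lemma rintegrable_weight_sin xi : rintegrable nu (fun y => om y * sin (dotv xi y)).
Proof.
apply: (rintegrableM (M := 1)) => //; last by move=> y; exact: sin_max.
by apply: measurable_sin_dotv2 => //; exact: measurable_cst.
Qed.

Lemma step_cos_bounded xi : `|step_cos k om xi| <= `|k| + \int[nu]_y `|om y|.
Proof.
rewrite (le_trans (ler_normD _ _))// lerD2l; apply: norm_Rint_le.
- exact: rintegrable_weight_cos.
- exact: rintegrable_norm.
- by move=> y; rewrite normrM ler_piMr// cos_max.
Qed.

Lemma step_sin_bounded xi : `|step_sin om xi| <= \int[nu]_y `|om y|.
Proof.
apply: norm_Rint_le.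
- exact: rintegrable_weight_sin.
- exact: rintegrable_norm.
- by move=> y; rewrite normrM ler_piMr// sin_max.
Qed.

Lemma measurable_step_cos : measurable_fun setT (step_cos k om).
Proof.
apply: measurable_funD => //.
apply: (measurable_Rint_param (m2 := nu) (T1 := V) (g := fun y => `|om y|)
  (F := fun xi y => om y * cos (dotv xi y))).
- apply: measurable_funM; first exact: measurableT_comp.
  exact: measurable_cos_dotv2.
- by move=> xi y; rewrite normrM ler_piMr// cos_max.
- exact: rintegrable_norm.
Qed.

Lemma measurable_step_sin : measurable_fun setT (step_sin om).
Proof.
apply: (measurable_Rint_param (m2 := nu) (T1 := V) (g := fun y => `|om y|)
  (F := fun xi y => om y * sin (dotv xi y))).
- apply: measurable_funM; first exact: measurableT_comp.
  exact: measurable_sin_dotv2.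
- by move=> xi y; rewrite normrM ler_piMr// sin_max.
- exact: rintegrable_norm.
Qed.

Let C := step_cos k om.
Let S := step_sin om.

Lemma gd_step_cos a : gd a -> gd (fun xi => a xi * C xi).
Proof. by move=> ga; apply: (gdM ga measurable_step_cos) step_cos_bounded. Qed.

Lemma gd_step_sin a : gd a -> gd (fun xi => a xi * S xi).
Proof. by move=> ga; apply: (gdM ga measurable_step_sin) step_sin_bounded. Qed.

(** In complex terms a - i b is multiplied by C + i S, after Fubini and the addition formulas. *)
Lemma step_op_trig a b : gd a -> gd b ->
  step_op k om (trig_int a b) =
  trig_int (fun xi => a xi * C xi + b xi * S xi)
           (fun xi => b xi * C xi - a xi * S xi).
Proof.
move=> ga gb; apply/funext => w; rewrite /step_op.
have [M M0 aM] := trig_bounded ga gb.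
pose F (y xi : V) := om y * (a xi * cos (dotv xi (w + y)) + b xi * sin (dotv xi (w + y))).
have it y := gd_integrable c0 (gd_trig (w + y) ga gb).
transitivity (k * trig_int a b w + \int[nu]_y (\int[leb]_xi F y xi)).
  by congr (_ + _); apply: eq_Rintegral => y _; rewrite /F RintZ.
rewrite (Rint_fubini (f := fun y => `|om y|) (g := fun xi => M * gauss c xi)); last 4 first.
- apply: measurable_funM; first exact: measurableT_comp.
  exact: (measurable_trig_int_joint ga gb (measurable_transl w)).
- by move=> y xi; rewrite normrM ler_wpM2l.
- exact: rintegrable_norm.
- exact/rintegrableZ/rintegrable_gauss.
pose A xi := a xi * cos (dotv xi w) + b xi * sin (dotv xi w).
pose B xi := b xi * cos (dotv xi w) - a xi * sin (dotv xi w).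
have gA : gd A by exact: gd_trig.
have gB : gd B.
  apply: gdB.
    by apply: (gdM gb (measurable_cos_dotv0 w)) => xi; exact: cos_max.
  by apply: (gdM ga (measurable_sin_dotv0 w)) => xi; exact: sin_max.
have FE xi : \int[nu]_y F y xi = A xi * (C xi - k) + B xi * S xi.
  rewrite /C /S /step_cos /step_sin addrAC subrr add0r -!RintZ; last 2 first.
  - exact: rintegrable_weight_sin.
  - exact: rintegrable_weight_cos.
  rewrite -RintD; last 2 first.
  - exact/rintegrableZ/rintegrable_weight_cos.
  - exact/rintegrableZ/rintegrable_weight_sin.
  apply: eq_Rintegral => y _; rewrite /F /A /B dotvDr cosD sinD; ring.
under [X in _ + X]eq_Rintegral do rewrite FE.
rewrite -[trig_int a b w]/(\int[leb]_xi A xi) -(RintZ k (gd_integrable c0 gA)) -RintD; last 2 first.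
- exact: (rintegrableZ k (gd_integrable c0 gA)).
- apply: (gd_integrable c0); apply: gdD; last exact: gd_step_sin.
  under eq_fun do rewrite mulrBr; apply: gdB; first exact: gd_step_cos.
  by apply: (gdM (M := `|k|) gA).
by apply: eq_Rintegral => xi _; rewrite /A /B; ring.
Qed.

(** Only the squared modulus of the new coefficient is recorded: each step multiplies it by C^2 +
    S^2, and the phase is irrelevant for an upper bound. *)
Lemma iter_step_op_trig a b N : gd a -> gd b ->
  exists a' b', [/\ gd a', gd b',
    forall xi, a' xi ^+ 2 + b' xi ^+ 2 =
      (a xi ^+ 2 + b xi ^+ 2) * (C xi ^+ 2 + S xi ^+ 2) ^+ N &
    iter N (step_op k om) (trig_int a b) = trig_int a' b'].
Proof.
move=> ga gb; elim: N => [|N [a' [b' [ga' gb' E EN]]]].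
  by exists a, b; split => // xi; rewrite expr0 mulr1.
exists (fun xi => a' xi * C xi + b' xi * S xi), (fun xi => b' xi * C xi - a' xi * S xi).
split.
- by apply: gdD; [exact: gd_step_cos|exact: gd_step_sin].
- by apply: gdB; [exact: gd_step_cos|exact: gd_step_sin].
- by move=> xi; rewrite (exprSr (C xi ^+ 2 + S xi ^+ 2) N) mulrA -E; ring.
- by rewrite iterS EN step_op_trig.
Qed.

(** A real multiplier creates no sine term, so here the iterates are known exactly. *)
Lemma iter_step_op_trig_sym a N : gd a -> (forall xi, S xi = 0) ->
  iter N (step_op k om) (trig_int a (fun=> 0)) =
  trig_int (fun xi => a xi * C xi ^+ N) (fun=> 0).
Proof.
move=> ga S0; have g0 : gd (fun=> 0).
  by split => //; exists 0 => xi; rewrite normr0 mul0r.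
have gN j : gd (fun xi => a xi * C xi ^+ j).
  elim: j => [|j IH]; first by under eq_fun do rewrite expr0 mulr1.
  by under eq_fun do rewrite exprSr mulrA; exact: gd_step_cos.
elim: N => [|N IH]; first by under [in RHS]eq_fun do rewrite expr0 mulr1.
rewrite iterS IH step_op_trig//; congr trig_int; apply/funext => xi.
  by rewrite S0 mulr0 addr0 exprSr mulrA.
by rewrite S0 mulr0 mul0r subr0.
Qed.

End fixed_weight.

(** The translation x + y turns e^(-lam.x) into e^(-lam.x) e^(-lam.y), and the second factor joins
    the weight. *)
Lemma iter_step_op_tilt k om lam a b N :
  rintegrable nu (fun y => om y * expR (- dotv lam y)) -> gd a -> gd b ->
  iter N (step_op k om) (fun x => expR (- dotv lam x) * trig_int a b x) =
  (fun x => expR (- dotv lam x) *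
    iter N (step_op k (fun y => om y * expR (- dotv lam y))) (trig_int a b) x).
Proof.
move=> iol ga gb; elim: N => // N IH; rewrite !iterS IH; apply/funext => x.
have [a' [b' [ga' gb' _ ->]]] := iter_step_op_trig k iol N ga gb.
have [M aM] := trig_int_bounded c0 ga' gb'.
rewrite /step_op mulrDr; congr (_ + _); first by rewrite mulrCA.
rewrite -RintZ; last first.
  apply: (rintegrableM (M := M)) => //.
  exact: (measurableT_comp (measurable_trig_int c0 ga' gb') (measurable_transl x)).
by apply: eq_Rintegral => y _; rewrite dotvDr opprD expRD; ring.
Qed.

End step_operator.

(** * Esscher tilt *)

Section levy_weights.
Context {R : realType} {n : nat}.
Notation V := 'rV[R]_n.
Notation leb := (@lebesgue_rV R n).

Definition symmetric_measure (nu : set V -> \bar R) :=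
  forall D : set V, measurable D -> nu [set - y | y in D] = nu D.

Section opp.
Variable nu : {measure set V -> \bar R}.
Hypothesis nuN : symmetric_measure nu.

Let mopp : measurable_fun setT (fun y : V => - y).
Proof. by apply: measurable_rVN; exact: measurable_id. Qed.

Lemma pushforward_opp A : measurable A -> pushforward nu (fun y : V => - y) A = nu A.
Proof.
move=> mA; rewrite /pushforward -[RHS]nuN//; congr (nu _); apply/seteqP; split.
  by move=> y /= Ay; exists (- y) => //; rewrite opprK.
by move=> _ [y Ay <-] /=; rewrite opprK.
Qed.

Lemma rintegrable_opp (f : V -> R) : rintegrable nu f ->
  rintegrable nu (fun y => f (- y)).
Proof.
move=> fi; have mf := rintegrable_measurable fi.
apply/integrableP; split; first by apply/measurable_EFinP; exact: measurableT_comp.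
move/integrableP: fi => [_]; apply: le_lt_trans.
have := @ge0_integral_pushforward _ _ _ _ _ _ mopp nu setT (fun y => `|(f y)%:E|)%E measurableT.
rewrite preimage_setT => <-//; last first.
  by apply: measurableT_comp => //; exact/measurable_EFinP.
rewrite le_eqVlt; apply/orP; left; apply/eqP.
by apply: eq_measure_integral => A mA _; exact: pushforward_opp.
Qed.

Lemma Rint_opp (f : V -> R) : rintegrable nu f ->
  \int[nu]_y f (- y) = \int[nu]_y f y.
Proof.
move=> fi; have mf : measurable_fun setT (EFin \o f).
  by apply/measurable_EFinP; exact: rintegrable_measurable fi.
rewrite /Rintegral; congr fine.
rewrite -[RHS](eq_measure_integral nu (m1 := pushforward nu (fun y : V => - y))); last first.
  by move=> A mA _; exact: pushforward_opp.
rewrite (integral_pushforward mopp mf)//; exact: rintegrable_opp.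
Qed.

End opp.

Variable nu : {sigma_finite_measure set V -> \bar R}.
Hypothesis nuN : symmetric_measure nu.

(** Characteristic exponent of the Lévy measure s nu; small jumps, large jumps and truncations
    differ only in the weight [s]. *)
Definition wPhi (s : V -> R) (xi : V) : R :=
  \int[nu]_y (s y * (1 - cos (dotv xi y))).

Section finite_weight.
Variables (s : V -> R) (rho : R).
Hypotheses (si : rintegrable nu s) (s0 : forall y, 0 <= s y)
  (sN : forall y, s (- y) = s y) (srho : forall y, rho < enorm y -> s y = 0).

Let Q := \int[nu]_y s y.

Lemma rintegrable_weight_onem xi : rintegrable nu (fun y => s y * (1 - cos (dotv xi y))).
Proof.
under eq_fun do rewrite mulrBr mulr1.
by apply: rintegrableB => //; exact: rintegrable_weight_cos.
Qed.

Lemma wPhi_ge0 xi : 0 <= wPhi s xi.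
Proof. by apply: Rint_ge0 => y; rewrite mulr_ge0// one_sub_cos_ge0. Qed.

Lemma wPhi_le_mass xi : wPhi s xi <= 2 * Q.
Proof.
rewrite -RintZ//; apply: ler_Rint; [exact: rintegrable_weight_onem|exact: rintegrableZ|].
by move=> y; rewrite mulrC ler_wpM2r// one_sub_cos_le2.
Qed.

Lemma wPhiE xi : wPhi s xi = Q - \int[nu]_y (s y * cos (dotv xi y)).
Proof.
rewrite /wPhi; under eq_Rintegral do rewrite mulrBr mulr1.
by rewrite RintB//; exact: rintegrable_weight_cos.
Qed.

Lemma measurable_wPhi_fin : measurable_fun setT (wPhi s).
Proof.
rewrite (_ : wPhi s = (fun xi => Q - (step_cos nu 0 s xi))); last first.
  by apply/funext => xi; rewrite wPhiE /step_cos add0r.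
by apply: measurable_funB => //; exact: measurable_step_cos.
Qed.

Section tilt.
Variable lam : V.
Let sl y := s y * expR (- dotv lam y).

Lemma tilt_le y : `|sl y| <= expR (enorm lam * rho) * s y.
Proof.
rewrite /sl ger0_norm; last by rewrite mulr_ge0// expR_ge0.
have [/srho ->|yr] := ltP rho (enorm y); first by rewrite mul0r mulr0.
rewrite mulrC ler_wpM2r// ler_expR.
have := dotv_le_enorm lam y; rewrite ler_norml => /andP[+ _].
rewrite lerNl => /le_trans; apply.
by rewrite ler_wpM2l// enorm_ge0.
Qed.

Lemma rintegrable_tilt : rintegrable nu sl.
Proof.
apply: rintegrable_le tilt_le _; last exact: rintegrableZ.
apply: measurable_funM; first exact: rintegrable_measurable si.
apply: measurableT_comp => //; apply: measurableT_comp => //.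
by apply: measurable_dotv => //; exact: measurable_cst.
Qed.

Let m := \int[nu]_y (s y * enorm y ^+ 2).
Let psi := enorm lam ^+ 2 * expR (enorm lam * rho) * m / 2.

Lemma rintegrable_weight_sqr : rintegrable nu (fun y => s y * enorm y ^+ 2).
Proof.
apply: rintegrable_le (rintegrableZ (rho ^+ 2) si).
  apply: measurable_funM; first exact: rintegrable_measurable si.
  by apply: measurable_funX; apply: measurable_enorm; exact: measurable_id.
move=> y; rewrite (ger0_norm (mulr_ge0 (s0 y) (sqr_ge0 _))).
have [/srho ->|yr] := ltP rho (enorm y); first by rewrite mul0r mulr0.
have y0 := enorm_ge0 y; have r0 := le_trans y0 yr.
by rewrite mulrC ler_wpM2r// ler_sqr ?nnegrE.
Qed.

(** Tilting costs at most psi, uniformly in xi. Averaging the integrand with its reflection turns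
    e^(-lam.y) into cosh u, u = lam.y; as cosh u >= 1 and cos <= 1, cosh(u) cos - 1 <= (cosh(u) - 1)
    - (1 - cos), and [expR_symm_le] bounds the first bracket. *)
Lemma tilt_cos_le xi :
  \int[nu]_y (sl y * cos (dotv xi y)) - Q <= psi - wPhi s xi.
Proof.
have isl := rintegrable_weight_cos rintegrable_tilt xi.
have i1 := rintegrableB isl si.
have i1N := rintegrable_opp nuN i1.
have i2 := rintegrableZ (enorm lam ^+ 2 * expR (enorm lam * rho) / 2) rintegrable_weight_sqr.
have i3 := rintegrable_weight_onem xi.
rewrite /psi -mulrA (mulrC m) mulrA -RintZ; last exact: rintegrable_weight_sqr.
rewrite /wPhi -RintB// -RintB//.
have <- : \int[nu]_y (2^-1 * ((sl y * cos (dotv xi y) - s y) +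
     (sl (- y) * cos (dotv xi (- y)) - s (- y)))) =
  \int[nu]_y (sl y * cos (dotv xi y) - s y).
  rewrite RintZ; last exact: rintegrableD.
  by rewrite RintD// (Rint_opp nuN i1); lra.
apply: ler_Rint; [exact/rintegrableZ/rintegrableD|exact: rintegrableB|].
move=> y; rewrite /sl sN !dotvNr opprK cosN.
have [/srho ->|yr] := ltP rho (enorm y); first by rewrite !(mul0r, mulr0, subr0, addr0).
set u := dotv lam y; set C := cos _.
have h1 : expR u + expR (- u) - 2 <= enorm lam ^+ 2 * enorm y ^+ 2 * expR (enorm lam * rho).
  apply: le_trans (expR_symm_le u) _.
  have ul := dotv_le_enorm lam y.
  apply: ler_pM; rewrite ?sqr_ge0 ?expR_ge0//.
    rewrite -exprMn -[u ^+ 2]real_normK ?num_real// ler_sqr ?nnegrE//.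
    by rewrite mulr_ge0 ?enorm_ge0.
  by rewrite ler_expR (le_trans ul)// ler_wpM2l ?enorm_ge0.
have h2 := expR_symm_ge2 u.
have C1 : C <= 1 by exact: cos_le1.
have -> : 2^-1 * (s y * expR (- u) * C - s y + (s y * expR u * C - s y)) =
  s y * (((expR u + expR (- u)) * C - 2) / 2) by field.
have -> : enorm lam ^+ 2 * expR (enorm lam * rho) / 2 * (s y * enorm y ^+ 2) -
  s y * (1 - C) = s y * (enorm lam ^+ 2 * enorm y ^+ 2 * expR (enorm lam * rho) / 2 - (1 - C)) by ring.
apply: ler_wpM2l => //.
have : 0 <= (expR u + expR (- u) - 2) * (1 - C) by rewrite mulr_ge0// subr_ge0.
lra.
Qed.

End tilt.
End finite_weight.
End levy_weights.

(** * The Gaussian kernel under a tilt *)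

Section gaussian_kernel.
Context {R : realType} {n : nat}.
Notation V := 'rV[R]_n.
Notation leb := (@lebesgue_rV R n).
Variables (c : R) (c0 : 0 < c).

Lemma trig_int_gaussE (x : V) :
  trig_int (gauss c) (fun=> 0) x =
  gauss_int c ^+ n * expR (- (dotv x x / (4 * c))).
Proof.
have := Rint_gauss_cos x 0 c0; rewrite cos0 mulr1 => <-.
by apply: eq_Rintegral => xi _; rewrite mul0r addr0 addr0.
Qed.

(** Completing the square: the last factor is E times the Gaussian kernel moved to v, hence a
    trigonometric integral whose coefficient has modulus E [gauss c]. *)
Lemma trig_int_gauss_tilt (lam x : V) (E := expR (c * dotv lam lam))
    (v := (2 * c) *: lam) :
  trig_int (gauss c) (fun=> 0) x = expR (- dotv lam x) *
    trig_int (fun xi => E * (gauss c xi * cos (dotv xi v)))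
             (fun xi => E * (gauss c xi * sin (dotv xi v))) x.
Proof.
have -> : trig_int (fun xi => E * (gauss c xi * cos (dotv xi v)))
   (fun xi => E * (gauss c xi * sin (dotv xi v))) x =
   E * trig_int (gauss c) (fun=> 0) (x - v).
  have gg : gauss_dominated c (@gauss R n c) by exact: gd_gauss.
  have g0 : gauss_dominated c (fun _ : V => 0 : R).
    by split => //; exists 0 => xi; rewrite normr0 mul0r.
  rewrite /trig_int -RintZ; last exact: (gd_integrable c0 (gd_trig _ gg g0)).
  apply: eq_Rintegral => xi _; rewrite dotvDr dotvNr cosB; ring.
rewrite !trig_int_gaussE /E /v dotvDl !dotvDr !dotvNl !dotvNr !dotvZl !dotvZr opprK.
rewrite (dotvC x lam) [RHS]mulrA [RHS]mulrCA; congr (_ * _).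
by rewrite -!expRD; congr expR; field; rewrite gt_eqF.
Qed.

End gaussian_kernel.

Section exponential_bound.
Context {R : realType} {n : nat}.
Notation V := 'rV[R]_n.
Notation leb := (@lebesgue_rV R n).
Variable nu : {sigma_finite_measure set V -> \bar R}.
Hypothesis nuN : symmetric_measure nu.
Variables (c : R) (c0 : 0 < c) (t : R) (t0 : 0 < t).

Lemma gd_gauss_exp (F : V -> R) : measurable_fun setT F -> (forall xi, 0 <= F xi) ->
  gauss_dominated c (fun xi => gauss c xi * expR (- (t * F xi))).
Proof.
move=> mF F0; apply: (gdM (M := 1) (gd_gauss c)).
  by do 2 apply: measurableT_comp => //; exact: measurable_funM.
move=> xi; rewrite ger0_norm ?expR_ge0// -expR0 ler_expR oppr_le0.
by apply: mulr_ge0 => //; exact: ltW.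
Qed.

Section finite_weight.
Variables (s : V -> R) (rho : R).
Hypotheses (si : rintegrable nu s) (s0 : forall y, 0 <= s y)
  (sN : forall y, s (- y) = s y) (srho : forall y, rho < enorm y -> s y = 0).

Let Q := \int[nu]_y s y.
Let Phi := wPhi nu s.

Let Q0 : 0 <= Q. Proof. exact: Rint_ge0. Qed.

(* With Phi replaced by its Euler approximation, T is the N-fold step operator applied
   to a Gaussian, so tilting is a finite computation and needs no complex
   analysis. *)
Lemma trig_int_euler_le (N : nat) (lam w : V)
   (D := (\int[nu]_y (s y * expR (- dotv lam y)) + Q) ^+ 2 +
         (\int[nu]_y (s y * expR (- dotv lam y))) ^+ 2)
   (psi := enorm lam ^+ 2 * expR (enorm lam * rho) *
            (\int[nu]_y (s y * enorm y ^+ 2)) / 2) :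
  (0 < N)%N ->
  trig_int (fun xi => gauss c xi * (1 - t * Phi xi / N%:R) ^+ N) (fun=> 0) w <=
  expR (- dotv lam w + c * dotv lam lam + t * psi + t ^+ 2 * D / 2 / N%:R) *
   \int[leb]_xi (gauss c xi * expR (- (t * Phi xi))).
Proof.
move=> N0; have NR : 0 < N%:R :> R by rewrite ltr0n.
pose q := t / N%:R; have q0 : 0 < q by rewrite divr_gt0.
pose k := 1 - q * Q; pose om y := q * s y.
pose sl y := s y * expR (- dotv lam y).
have iom : rintegrable nu om by exact: rintegrableZ.
have isl : rintegrable nu sl by exact: (rintegrable_tilt si s0 srho).
have ioml : rintegrable nu (fun y => om y * expR (- dotv lam y)).
  by under eq_fun do rewrite -mulrA; exact: rintegrableZ.
have gg : gauss_dominated c (@gauss R n c) by exact: gd_gauss.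
have C0 xi : step_cos nu k om xi = 1 - t * Phi xi / N%:R.
  rewrite /step_cos /om; under eq_Rintegral do rewrite -mulrA.
  rewrite RintZ; last exact: rintegrable_weight_cos.
  by rewrite /Phi wPhiE// /k -/Q /q; ring.
have S0 xi : step_sin nu om xi = 0.
  have i1 := rintegrable_weight_sin iom xi.
  have := Rint_opp nuN i1; rewrite /step_sin.
  under eq_Rintegral do rewrite /om sN dotvNr sinN mulrN.
  by rewrite RintN// /om => ?; lra.
have -> : trig_int (fun xi => gauss c xi * (1 - t * Phi xi / N%:R) ^+ N) (fun=> 0) w =
    iter N (step_op nu k om) (trig_int (gauss c) (fun=> 0)) w.
  rewrite (iter_step_op_trig_sym c0 k iom)//; congr (trig_int _ _ w).
  by apply/funext => xi; rewrite C0.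
pose v := (2 * c) *: lam; pose E := expR (c * dotv lam lam).
pose a xi := E * (gauss c xi * cos (dotv xi v)).
pose b xi := E * (gauss c xi * sin (dotv xi v)).
have gE (f : V -> R) : gauss_dominated c f -> gauss_dominated c (fun xi => E * f xi).
  by move=> gf; under eq_fun do rewrite mulrC; apply: (gdM (M := `|E|) gf).
have ga : gauss_dominated c a.
  by apply: gE; apply: (gdM gg (measurable_cos_dotv0 v)) => xi; exact: cos_max.
have gb : gauss_dominated c b.
  by apply: gE; apply: (gdM gg (measurable_sin_dotv0 v)) => xi; exact: sin_max.
have -> : trig_int (gauss c) (fun=> 0) = (fun x => expR (- dotv lam x) * trig_int a b x).
  by apply/funext => x; exact: trig_int_gauss_tilt.
rewrite (iter_step_op_tilt c0 k N ioml ga gb).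
have [a' [b' [ga' gb' abE ->]]] := iter_step_op_trig c0 k ioml N ga gb.
rewrite -!addrA expRD -[leRHS]mulrA ler_pM2l ?expR_gt0//.
pose K := expR (c * dotv lam lam + (t * psi + t ^+ 2 * D / 2 / N%:R)).
have gD := gd_gauss_exp (measurable_wPhi_fin si) (wPhi_ge0 nu s0).
rewrite -RintZ; last exact: gd_integrable gD.
apply: le_trans (ler_norm _) _; apply: (trig_int_le_sqr c0) => //.
- by under eq_fun do rewrite mulrC; apply: (gdM (M := `|K|) gD).
- by move=> xi; apply: mulr_ge0; rewrite ?expR_ge0// mulr_ge0 ?expR_ge0// ltW// gauss_gt0.
move=> xi; rewrite abE.
have -> : a xi ^+ 2 + b xi ^+ 2 = (E * gauss c xi) ^+ 2.
  rewrite /a /b !exprMn -mulrDr -mulrDr; congr (_ * _).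
  by rewrite cos2Dsin2 mulr1.
set A := step_cos nu _ _ _; set B := step_sin nu _ _.
suff AB : (A ^+ 2 + B ^+ 2) ^+ N <=
    expR (t * psi - t * Phi xi + t ^+ 2 * D / 2 / N%:R) ^+ 2.
  apply: le_trans (ler_wpM2l (sqr_ge0 _) AB) _.
  rewrite -exprMn le_eqVlt; apply/orP; left; apply/eqP; congr (_ ^+ 2).
  rewrite /E /K [LHS]mulrAC [RHS]mulrCA [RHS]mulrC; congr (_ * _).
  by rewrite -!expRD; congr expR; ring.
pose L := \int[nu]_y sl y.
pose C1 := \int[nu]_y (sl y * cos (dotv xi y)).
pose S1 := \int[nu]_y (sl y * sin (dotv xi y)).
have AE : A = 1 + q * (C1 - Q).
  rewrite /A /step_cos (_ : \int[nu]_y _ = q * C1); first by rewrite /k; ring.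
  rewrite -RintZ; last exact: rintegrable_weight_cos.
  by apply: eq_Rintegral => y _; rewrite /om /sl; ring.
have BE : B = q * S1.
  rewrite -RintZ; last exact: rintegrable_weight_sin.
  by apply: eq_Rintegral => y _; rewrite /om /sl; ring.
have L0 : 0 <= L by apply: Rint_ge0 => y; rewrite mulr_ge0// expR_ge0.
have sl0 y : `|sl y| = sl y by rewrite ger0_norm// mulr_ge0// expR_ge0.
have C1L : `|C1| <= L.
  apply: norm_Rint_le => //; first exact: rintegrable_weight_cos.
  by move=> y; rewrite normrM sl0 ler_piMr ?cos_max// -sl0.
have S1L : `|S1| <= L.
  apply: norm_Rint_le => //; first exact: rintegrable_weight_sin.
  by move=> y; rewrite normrM sl0 ler_piMr ?sin_max// -sl0.
have AC := tilt_cos_le nuN si s0 sN srho lam xi.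
rewrite -/Q -/psi -/C1 in AC.
have DE : (C1 - Q) ^+ 2 + S1 ^+ 2 <= D.
  rewrite /D -/L; apply: lerD.
    rewrite -[leLHS]real_normK ?num_real// ler_sqr ?nnegrE ?addr_ge0//.
    by apply: le_trans (ler_normB _ _) _; rewrite (ger0_norm Q0) lerD2r.
  by rewrite -[leLHS]real_normK ?num_real// ler_sqr ?nnegrE.
(* Squared modulus of one tilted step. The first-order part is [tilt_cos_le]; the quadratic part q^2
   D adds up to t^2 D / N over N steps and disappears in the limit. *)
have AB : A ^+ 2 + B ^+ 2 <= expR (2 * q * (psi - Phi xi) + q ^+ 2 * D).
  apply: le_trans (expR_ge1Dx _); rewrite AE BE.
  have : q * (C1 - Q) <= q * (psi - Phi xi) by rewrite ler_pM2l.
  have : q ^+ 2 * ((C1 - Q) ^+ 2 + S1 ^+ 2) <= q ^+ 2 * D.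
    by rewrite ler_wpM2l// sqr_ge0.
  have -> : (1 + q * (C1 - Q)) ^+ 2 + (q * S1) ^+ 2 =
    1 + 2 * (q * (C1 - Q)) + q ^+ 2 * ((C1 - Q) ^+ 2 + S1 ^+ 2) by ring.
  lra.
have AB0 : 0 <= A ^+ 2 + B ^+ 2 by rewrite addr_ge0// sqr_ge0.
apply: (le_trans (y := expR (2 * q * (psi - Phi xi) + q ^+ 2 * D) ^+ N)).
  by rewrite lerXn2r ?nnegrE// expR_ge0.
rewrite -!expRM_natr le_eqVlt; apply/orP; left; apply/eqP; congr expR.
by rewrite /q; field; rewrite gt_eqF.
Qed.

End finite_weight.
End exponential_bound.

(** * Passage to infinitely many steps and to weights of infinite mass *)

Section limits.
Context {R : realType} {n : nat}.
Notation V := 'rV[R]_n.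
Notation leb := (@lebesgue_rV R n).

Lemma cvg_div_nat (N : nat -> nat) (u : nat -> R) (l : R) :
  (forall j, j < N j)%N -> u j @[j --> \oo] --> l ->
  (u j / (N j)%:R) @[j --> \oo] --> (0 : R).
Proof.
move=> jN ul.
have N0 j : 0 < (N j)%:R :> R by rewrite ltr0n (leq_ltn_trans _ (jN j)).
rewrite -(mulr0 l); apply: cvgM => //.
apply: (@squeeze_cvgr _ _ _ _ (fun=> 0) (@harmonic R)).
- apply: nearW => j; rewrite invr_ge0 ltW//= /harmonic lef_pV2 ?posrE//.
  by rewrite ler_nat.
- exact: cvg_cst.
- exact: cvg_harmonic.
Qed.

Lemma cvg_expR_seq (u : nat -> R) (l : R) : u j @[j --> \oo] --> l ->
  expR (u j) @[j --> \oo] --> expR l.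
Proof. by move=> ul; apply: (cvg_comp _ expR ul); exact: continuous_expR. Qed.

Variables (c : R) (c0 : 0 < c).

Lemma cvg_trig_int (a_ : nat -> V -> R) (a : V -> R) w :
  (forall j, measurable_fun setT (a_ j)) -> measurable_fun setT a ->
  (forall j xi, `|a_ j xi| <= gauss c xi) ->
  (forall xi, a_ j xi @[j --> \oo] --> a xi) ->
  trig_int (a_ j) (fun=> 0) w @[j --> \oo] --> trig_int a (fun=> 0) w.
Proof.
move=> ma_ ma ag aa.
have mcos := measurable_cos_dotv0 w.
apply: (proj2 (@Rint_dominated _ _ _ leb
  (fun j xi => a_ j xi * cos (dotv xi w) + 0 * sin (dotv xi w))
  (fun xi => a xi * cos (dotv xi w) + 0 * sin (dotv xi w)) (gauss c) _ _ _ _ _)).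
- by move=> j; under eq_fun do rewrite mul0r addr0; exact: measurable_funM.
- by under eq_fun do rewrite mul0r addr0; exact: measurable_funM.
- by move=> xi; rewrite mul0r addr0; under eq_fun do rewrite addr0; apply: cvgM => //; exact: cvg_cst.
- exact: rintegrable_gauss.
- move=> j xi; rewrite mul0r addr0 normrM (le_trans _ (ag j xi))//.
  by rewrite ler_piMr// cos_max.
Qed.

Lemma trig_int0 (a : V -> R) :
  trig_int a (fun=> 0) 0 = \int[leb]_xi a xi.
Proof.
by apply: eq_Rintegral => xi _; rewrite dotv0r cos0 mulr1 mul0r addr0.
Qed.

Lemma measurable_enorm_gt (r : R) : measurable [set y : V | r < enorm y].
Proof.
have := @measurable_enorm R _ V n id (@measurable_id _ _ setT).
move=> /(_ measurableT `]r, +oo[%classic (measurable_itv _)).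
by rewrite setTI; congr measurable; apply/seteqP; split => y; rewrite /= in_itv /= andbT.
Qed.

End limits.

Section exponential_bound.
Context {R : realType} {n : nat}.
Notation V := 'rV[R]_n.
Notation leb := (@lebesgue_rV R n).
Variable nu : {sigma_finite_measure set V -> \bar R}.
Hypothesis nuN : symmetric_measure nu.
Variables (c : R) (c0 : 0 < c) (t : R) (t0 : 0 < t).

Lemma gauss_exp_le (F : V -> R) xi : 0 <= F xi ->
  `|gauss c xi * expR (- (t * F xi))| <= gauss c xi.
Proof.
move=> F0; rewrite ger0_norm; last by rewrite mulr_ge0// ?expR_ge0// ltW// gauss_gt0.
rewrite ler_piMr// ?(ltW (gauss_gt0 _ _))// -expR0 ler_expR oppr_le0.
by rewrite mulr_ge0// ltW.
Qed.

Lemma measurable_gauss_exp (F : V -> R) : measurable_fun setT F ->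
  measurable_fun setT (fun xi => gauss c xi * expR (- (t * F xi))).
Proof.
move=> mF; apply: measurable_funM; first exact: measurable_gauss.
by do 2 apply: measurableT_comp => //; exact: measurable_funM.
Qed.

Lemma trig_int_exp_le_fin (s : V -> R) (rho : R) (lam w : V) :
  rintegrable nu s -> (forall y, 0 <= s y) ->
  (forall y, s (- y) = s y) -> (forall y, rho < enorm y -> s y = 0) ->
  trig_int (fun xi => gauss c xi * expR (- (t * wPhi nu s xi))) (fun=> 0) w <=
  expR (- dotv lam w + c * dotv lam lam + t * (enorm lam ^+ 2 *
     expR (enorm lam * rho) * (\int[nu]_y (s y * enorm y ^+ 2)) / 2)) *
   \int[leb]_xi (gauss c xi * expR (- (t * wPhi nu s xi))).
Proof.
move=> si s0 sN srho.
pose Q := \int[nu]_y s y.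
have Q0 : 0 <= Q by exact: Rint_ge0.
(* This many extra steps force t Phi / N <= 2, so that |1 - t Phi / N| <= 1 and the Gaussian
   dominates every approximant. *)
pose k0 := Num.bound (t * Q).
pose N j := (j.+1 + k0)%N.
have jN j : (j < N j)%N by rewrite /N addSn ltnS leq_addr.
have Phi0 xi := wPhi_ge0 nu s0 xi.
set I := \int[leb]_xi _; set K := _ + t * _.
pose D := (\int[nu]_y (s y * expR (- dotv lam y)) + Q) ^+ 2 +
         (\int[nu]_y (s y * expR (- dotv lam y))) ^+ 2.
have mPhi := measurable_wPhi_fin si.
pose a_ j xi := gauss c xi * (1 - t * wPhi nu s xi / (N j)%:R) ^+ N j.
pose r_ j := expR (K + t ^+ 2 * D / 2 / (N j)%:R) * I.
have cv1 : trig_int (a_ j) (fun=> 0) w @[j --> \oo] -->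
    trig_int (fun xi => gauss c xi * expR (- (t * wPhi nu s xi))) (fun=> 0) w.
  apply: (cvg_trig_int c0).
  + move=> j; apply: measurable_funM; first exact: measurable_gauss.
    apply: measurable_funX; apply: measurable_funB => //.
    by apply: measurable_funM => //; exact: measurable_funM.
  + exact: measurable_gauss_exp.
  + move=> j xi; have Nj0 : 0 < (N j)%:R :> R by rewrite ltr0n /N addSn.
    rewrite normrM (gtr0_norm (gauss_gt0 _ _)) ler_piMr ?(ltW (gauss_gt0 _ _))//.
    rewrite normrX exprn_ile1// ler_norml.
    have v0 : 0 <= t * wPhi nu s xi / (N j)%:R by rewrite divr_ge0 ?mulr_ge0// ltW.
    have v2 : t * wPhi nu s xi / (N j)%:R <= 2.
      rewrite ler_pdivrMr//; have := wPhi_le_mass si s0 xi; rewrite -/Q => h.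
      apply: (@le_trans _ _ (t * (2 * Q))); first by rewrite ler_pM2l.
      rewrite mulrCA ler_pM2l// (le_trans (ltW (archi_boundP (mulr_ge0 (ltW t0) Q0))))//.
      by rewrite ler_nat /N leq_addl.
    by apply/andP; split; lra.
  + move=> xi; apply: cvgM; first exact: cvg_cst.
    apply: (euler_limit (u := fun=> t * wPhi nu s xi)) => //.
    * by move=> _; rewrite mulr_ge0// ltW.
    * exact: cvg_cst.
have cv2 : r_ j @[j --> \oo] --> expR K * I.
  apply: cvgM; last exact: cvg_cst.
  apply: cvg_expR_seq; rewrite -[X in _ --> X]addr0; apply: cvgD; first exact: cvg_cst.
  exact: (cvg_div_nat jN (cvg_cst _)).
apply: (ler_cvg_to cv1 cv2).
by apply: nearW => j; exact: (trig_int_euler_le nuN c0 t0 si s0 sN srho).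
Qed.

Section infinite_weight.
Variables (s : V -> R) (rho : R).
Hypotheses (ms : measurable_fun setT s) (s0 : forall y, 0 <= s y)
  (sN : forall y, s (- y) = s y) (srho : forall y, rho < enorm y -> s y = 0)
  (s2 : rintegrable nu (fun y => s y * enorm y ^+ 2)).

(** Removing the jumps of length at most 1/(j+1) makes the weight integrable, since 1 <= (j+1)^2
    |y|^2 on the rest; the finite-mass bound then passes to the limit. *)
Let A j := [set y : V | j.+1%:R^-1 < enorm y].
Let s_ j y := s y * \1_(A j) y.

Let s_0 j y : 0 <= s_ j y. Proof. by apply: mulr_ge0 => //; rewrite indicE. Qed.

Let s_le j y : s_ j y <= s y.
Proof. by rewrite /s_ ler_piMr// indicE; case: (_ \in _). Qed.

Let ms_ j : measurable_fun setT (s_ j).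
Proof.
by apply: measurable_funM => //; apply: measurable_indic; exact: measurable_enorm_gt.
Qed.

Let s_i j : rintegrable nu (s_ j).
Proof.
apply: (rintegrable_le (ms_ j) _ (rintegrableZ (j.+1%:R ^+ 2) s2)) => y.
rewrite (ger0_norm (s_0 j y)) /s_ mulrCA ler_wpM2l// indicE.
case: (boolP (y \in _)) => [|_]; last by rewrite mulr_ge0// sqr_ge0.
rewrite inE /A /= -exprMn => h; rewrite expr_ge1 ?mulr_ge0 ?enorm_ge0//.
by rewrite -ler_pdivrMl// mulr1 ltW.
Qed.

Let s_N j y : s_ j (- y) = s_ j y.
Proof.
rewrite /s_ sN !indicE; congr (_ * (_ : bool)%:R).
by apply/idP/idP; rewrite !inE /A /= enormN.
Qed.

Let s_rho j y : rho < enorm y -> s_ j y = 0.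
Proof. by move=> /srho sy; rewrite /s_ sy mul0r. Qed.

Lemma rintegrable_onem_cos xi : rintegrable nu (fun y => s y * (1 - cos (dotv xi y))).
Proof.
apply: rintegrable_le (rintegrableZ (enorm xi ^+ 2 / 2) s2).
  apply: measurable_funM => //; apply: measurable_funB => //.
  by apply: measurable_cos_dotv2 => //; exact: measurable_cst.
move=> y; rewrite ger0_norm; last by rewrite mulr_ge0// one_sub_cos_ge0.
rewrite mulrCA ler_wpM2l//; apply: le_trans (one_sub_cos_le _) _.
rewrite [leRHS]mulrAC ler_pM2r// -exprMn -[leLHS]real_normK ?num_real// ler_sqr ?nnegrE//.
  exact: dotv_le_enorm.
by rewrite mulr_ge0 ?enorm_ge0.
Qed.

Lemma cvg_wPhi xi : wPhi nu (s_ j) xi @[j --> \oo] --> wPhi nu s xi.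
Proof.
apply: (proj2 (@Rint_dominated _ _ _ nu (fun j y => s_ j y * (1 - cos (dotv xi y)))
  (fun y => s y * (1 - cos (dotv xi y))) (fun y => s y * (1 - cos (dotv xi y))) _ _ _ _ _)).
- move=> j; apply: measurable_funM => //; apply: measurable_funB => //.
  by apply: measurable_cos_dotv2 => //; exact: measurable_cst.
- exact: rintegrable_measurable (rintegrable_onem_cos xi).
- move=> y; have [y0|y0] := eqVneq (enorm y) 0.
    rewrite (enorm_eq0 y0) dotv0r cos0 subrr mulr0.
    by under eq_fun do rewrite mulr0; exact: cvg_cst.
  have {}y0 : 0 < enorm y by rewrite lt_def y0 enorm_ge0.
  apply: cvg_near_cst; near=> j.
  rewrite /s_ indicE mem_set ?mulr1// /A /=.
  near: j; exact: (near_infty_natSinv_lt (PosNum y0)).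
- exact: rintegrable_onem_cos.
- move=> j y; rewrite ger0_norm; last by rewrite mulr_ge0// one_sub_cos_ge0.
  by rewrite ler_wpM2r// one_sub_cos_ge0.
Unshelve. all: by end_near. Qed.

Lemma measurable_wPhi : measurable_fun setT (wPhi nu s).
Proof.
apply: (measurable_fun_cvg (h := fun j => wPhi nu (s_ j))) => //.
- by move=> j; exact: measurable_wPhi_fin.
- by move=> xi _; exact: cvg_wPhi.
Qed.

Theorem trig_int_exp_le (lam w : V) :
  trig_int (fun xi => gauss c xi * expR (- (t * wPhi nu s xi))) (fun=> 0) w <=
  expR (- dotv lam w + c * dotv lam lam + t * (enorm lam ^+ 2 *
     expR (enorm lam * rho) * (\int[nu]_y (s y * enorm y ^+ 2)) / 2)) *
   \int[leb]_xi (gauss c xi * expR (- (t * wPhi nu s xi))).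
Proof.
have cv v : trig_int (fun xi => gauss c xi * expR (- (t * wPhi nu (s_ j) xi))) (fun=> 0) v
   @[j --> \oo] --> trig_int (fun xi => gauss c xi * expR (- (t * wPhi nu s xi))) (fun=> 0) v.
  apply: (cvg_trig_int c0).
  - by move=> j; apply: measurable_gauss_exp; exact: measurable_wPhi_fin.
  - by apply: measurable_gauss_exp; exact: measurable_wPhi.
  - by move=> j xi; apply: gauss_exp_le; exact: wPhi_ge0.
  - move=> xi; apply: cvgM; first exact: cvg_cst.
    by apply: cvg_expR_seq; apply: cvgN; apply: cvgM; [exact: cvg_cst|exact: cvg_wPhi].
have cvI := cv 0; rewrite trig_int0 in cvI.
set K := expR _.
apply: (ler_cvg_to (cv w) (g := fun j => K * trig_int (fun xi => gauss c xi * expR (- (t * wPhi nu (s_ j) xi))) (fun=> 0) 0)).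
  by apply: cvgM => //; exact: cvg_cst.
apply: nearW => j; rewrite trig_int0.
apply: le_trans (trig_int_exp_le_fin lam w (s_i j) (s_0 j) (s_N j) (s_rho j)) _.
apply: ler_wpM2r.
  by apply: Rint_ge0 => xi; rewrite mulr_ge0// ?expR_ge0// ltW// gauss_gt0.
rewrite ler_expR lerD2l ler_pM2l// ler_pM2r// ler_wpM2l//.
  by rewrite mulr_ge0// ?sqr_ge0// expR_ge0.
apply: ler_Rint => //; last by move=> y; rewrite ler_wpM2r// sqr_ge0.
apply: rintegrable_le s2.
  apply: measurable_funM => //; apply: measurable_funX.
  by apply: measurable_enorm; exact: measurable_id.
by move=> y; rewrite ger0_norm ?ler_wpM2r ?sqr_ge0// mulr_ge0// sqr_ge0.
Qed.

End infinite_weight.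
End exponential_bound.

(** * Gaussian smoothing of the density *)

Section sigma_finite_copy.
Context {R : realType} {dT : measure_display} {T : measurableType dT}.
Variables (mu : {measure set T -> \bar R}) (sf : sigma_finite setT mu).

(** The theorem speaks of a plain measure, while Fubini asks for the sigma-finite structure. With
    the proof as an argument of this alias, an instance can be attached to it;
    [sigma_finite_measure_pack] gives back an equality of measures that can be substituted. *)
Definition sigma_finite_copy of sigma_finite setT mu : set T -> \bar R := mu.

Let m := sigma_finite_copy sf.

HB.instance Definition _ := isMeasure.Build _ _ _ m
  (measure0 mu) (measure_ge0 mu) (@measure_semi_sigma_additive _ _ _ mu).

HB.instance Definition _ := Measure_isSigmaFinite.Build _ _ _ m sf.

Lemma sigma_finite_measure_pack :
  exists mu' : {sigma_finite_measure set T -> \bar R},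
    (mu' : {measure set T -> \bar R}) = mu.
Proof. by exists m; apply: eq_measure. Qed.

End sigma_finite_copy.

Section density_bound.
Context {R : realType} {n : nat}.
Notation V := 'rV[R]_n.
Notation leb := (@lebesgue_rV R n).
Variables (P : probability V R) (q : V -> R) (phi : V -> R).
Hypotheses (qP : continuous_density P q)
  (phiP : forall xi, fourier_transform_at P xi (phi xi)).

Lemma rintegrable_cst1 : rintegrable P (fun=> 1 : R).
Proof. exact: (finite_measure_integrable_cst P 1 measurableT). Qed.

(** This is [step_op_trig] with P in the role of the jump measure and weight 1: the multiplier is
    then the characteristic function of P. *)
Lemma step_op_probability (c : R) (c0 : 0 < c) (x : V) :
  \int[P]_y trig_int (gauss c) (fun=> 0) (y - x) =
  trig_int (fun xi => gauss c xi * phi xi) (fun=> 0) x.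
Proof.
have gg : gauss_dominated c (@gauss R n c) by exact: gd_gauss.
have g0 : gauss_dominated c (fun _ : V => 0 : R).
  by split => //; exists 0 => xi; rewrite normr0 mul0r.
have := step_op_trig c0 0 rintegrable_cst1 gg g0.
move=> /(congr1 (fun F => F (- x))).
rewrite /step_op mul0r add0r.
have CE xi : step_cos P 0 (fun=> 1) xi = phi xi.
  rewrite /step_cos add0r; under eq_Rintegral do rewrite mul1r.
  by case: (phiP xi).
have SE xi : step_sin P (fun=> 1) xi = 0.
  rewrite /step_sin; under eq_Rintegral do rewrite mul1r.
  by case: (phiP xi).
move=> E; transitivity (\int[P]_y (1 * trig_int (gauss c) (fun=> 0) (- x + y))).
  by apply: eq_Rintegral => y _; rewrite mul1r addrC.
rewrite E; apply: eq_Rintegral => xi _.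
by rewrite CE SE !mul0r dotvNr cosN sinN !mulr0 !addr0 subr0 mul0r addr0.
Qed.

Lemma measurable_box (a b : V) :
  measurable [set v : V | forall i, a 0 i <= v 0 i <= b 0 i].
Proof.
rewrite (_ : [set _ | _] = \bigcap_(i in [set: 'I_n])
     ((fun v : V => v 0 i) @^-1` `[a 0 i, b 0 i])).
  apply: fin_bigcap_measurable => // i _.
  by rewrite -[X in measurable X]setTI; exact: measurable_coord_rV.
apply/seteqP; split=> [v /= vab i _|v /= vab i].
  by rewrite /= in_itv /= vab.
by have := vab i Logic.I; rewrite /= in_itv.
Qed.

Lemma density_le_trig_int (eps eta : R) (x : V) : 0 < eps -> eta <= q x ->
  (forall y : V, (forall i, `|y 0 i - x 0 i| <= eps) -> q x - eta <= q y) ->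
  q x - eta <= trig_int (fun xi => gauss (eps ^+ 2 / 2) xi * phi xi) (fun=> 0) x.
Proof.
move=> e0 etaq near_q; set c := eps ^+ 2 / 2.
have c0 : 0 < c by rewrite divr_gt0// exprn_gt0.
pose a : V := \row_i (x 0 i - eps); pose b : V := \row_i (x 0 i + eps).
pose D := [set v : V | forall i, a 0 i <= v 0 i <= b 0 i].
have mD : measurable D by exact: measurable_box.
have DE y i : D y -> `|y 0 i - x 0 i| <= eps.
  by move=> /(_ i); rewrite !mxE ler_distl.
pose J := gauss_int c ^+ n * expR (- (n%:R / 2)).
have J0 : 0 <= gauss_int c by apply: Rint_ge0 => ?; rewrite ltW// gauss1_gt0.
have kD y : J * \1_D y <= trig_int (gauss c) (fun=> 0) (y - x).
  rewrite trig_int_gaussE// indicE; case: (boolP (y \in D)); last first.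
    by move=> _; rewrite mulr0 mulr_ge0 ?exprn_ge0// expR_ge0.
  rewrite inE mulr1 => Dy; rewrite ler_wpM2l ?exprn_ge0// ler_expR lerN2.
  rewrite -sqr_enorm sqr_enormE ler_pdivrMr ?mulr_gt0//.
  rewrite (_ : n%:R / 2 * (4 * c) = \sum_(i < n) eps ^+ 2); last first.
    by rewrite sumr_const card_ord -mulr_natl /c; field.
  apply: ler_sum => i _; rewrite !mxE -[leLHS]real_normK ?num_real//.
  by rewrite ler_sqr ?nnegrE ?(ltW e0)//; exact: DE.
rewrite -step_op_probability//.
have g0 : gauss_dominated c (fun _ : V => 0 : R).
  by split => //; exists 0 => xi; rewrite normr0 mul0r.
have gg : gauss_dominated c (@gauss R n c) by exact: gd_gauss.
have ikk : rintegrable P (fun y => trig_int (gauss c) (fun=> 0) (y - x)).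
  have [M hM] := trig_int_bounded c0 gg g0.
  apply: (rintegrable_le _ _ (rintegrableZ M rintegrable_cst1)).
    apply: (measurableT_comp (measurable_trig_int c0 gg g0)).
    by apply: measurable_rVD => //; exact: measurable_cst.
  by move=> y; rewrite mulr1.
have iD : rintegrable P (\1_D : V -> R) by exact: integrable_indic.
apply: (@le_trans _ _ (\int[P]_y (J * \1_D y))); last first.
  by apply: ler_Rint => //; exact: rintegrableZ.
rewrite RintZ// /Rintegral integral_indic// setIT.
have [_ q0 PE] := qP; rewrite [X in fine X](PE D mD).
have vol : (lebesgue_rV n D = ((2 * eps) ^+ n)%:E)%E.
  rewrite lebesgue_rV_box; last by move=> i; rewrite !mxE lerD2l (le_trans _ (ltW e0))// oppr_le0 ltW.
  rewrite -[X in (_ ^+ X)]card_ord -prodr_const; congr (_%:E).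
  by apply: eq_bigr => i _; rewrite !mxE; ring.
have mq : measurable_fun setT q.
  case: qP => cq _ _; apply: (measurability _ (RGenOpens.measurableE R)) => _ [_ [u [v ->] <-]].
  rewrite setTI; apply: sub_sigma_algebra.
  by apply: open_comp => [? _|]; [exact: cq|exact: interval_open].
have Pfin : ((\int[lebesgue_rV n]_(x in D) (q x)%:E) < +oo)%E.
  by rewrite -PE// (le_lt_trans (probability_le1 _ mD))// ltry.
have lowE : (((q x - eta) * (2 * eps) ^+ n)%:E <= \int[lebesgue_rV n]_(x in D) (q x)%:E)%E.
  rewrite EFinM -vol -integral_cst//; apply: ge0_le_integral => //.
  - by move=> y _; rewrite lee_fin subr_ge0.
  - by apply/measurable_EFinP; exact: measurable_funTS.
  - by move=> y Dy; rewrite lee_fin near_q// => i; exact: DE.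
have low : (q x - eta) * (2 * eps) ^+ n <= fine (\int[lebesgue_rV n]_(x in D) (q x)%:E).
  rewrite -lee_fin fineK// ge0_fin_numE//; apply: integral_ge0 => y _; exact: q0.
have Jlow : expR (- 2^-1) ^+ n * (2 * expR (- 2^-1) / eps) ^+ n <= J.
  rewrite /J mulrC -expRM_natr; apply: ler_pM; rewrite ?expR_ge0//.
  - by rewrite exprn_ge0// divr_ge0 ?mulr_ge0 ?expR_ge0// ltW.
  - rewrite lerXn2r ?nnegrE ?divr_ge0 ?mulr_ge0 ?expR_ge0 ?(ltW e0)//.
    apply: le_trans (gauss_int_gt c0); rewrite /c mulrCA divff// mulr1 sqrtr_sqr.
    by rewrite gtr0_norm.
  - by rewrite ler_expR; lra.
have e12 : 2^-1 <= expR (- 2^-1) :> R.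
  by apply: le_trans (expR_ge1Dx _); lra.
apply: (@le_trans _ _ (J * ((q x - eta) * (2 * eps) ^+ n))); last first.
  by rewrite ler_wpM2l// mulr_ge0 ?exprn_ge0// expR_ge0.
have qeta : 0 <= q x - eta by rewrite subr_ge0.
rewrite mulrCA -[leLHS]mulr1 ler_wpM2l//.
apply: (@le_trans _ _ (expR (- 2^-1) ^+ n * (2 * expR (- 2^-1) / eps) ^+ n * (2 * eps) ^+ n)); last first.
  by rewrite ler_wpM2r// exprn_ge0// mulr_ge0// ltW.
rewrite -!exprMn exprn_ege1//.
(* Kernel minimum times volume of the cube is at least (4/e)^n >= 1, so the comparison loses no
   factor; e^(-1/2) >= 1/2 is all that is used. *)
have -> : expR (- 2^-1) * (2 * expR (- 2^-1) / eps) * (2 * eps) = 4 * expR (- 2^-1) ^+ 2.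
  by field; rewrite gt_eqF.
nra.
Qed.

(** Only eps <= e0 has to be treated, which lets each application keep the smoothing small compared
    with its own scale: 1/(1 + |lam|) for a tilt by lam, h for the jump bound. *)
Lemma density_le (B e0 : R) (x : V) : 0 < e0 ->
  (forall eps, 0 < eps -> eps <= e0 ->
     trig_int (fun xi => gauss (eps ^+ 2 / 2) xi * phi xi) (fun=> 0) x <= B) ->
  q x <= B.
Proof.
move=> e00 HB; have [cq q0 _] := qP.
(* Needed for eta <= q x below; it is the case eta = q x of [density_le_trig_int]. *)
have B0 : 0 <= B.
  apply: le_trans (HB _ e00 (lexx _)).
  by have := density_le_trig_int e00 (lexx (q x)); rewrite subrr; apply.
rewrite leNgt; apply/negP => Bq.
pose eta := (q x - B) / 2; have eta0 : 0 < eta by rewrite divr_gt0// subr_gt0.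
have etaq : eta <= q x by rewrite /eta; lra.
have /nbhs_ballP[r /= r0 rq] : nbhs x [set y | `|q x - q y| < eta].
  by have /cvgrPdist_lt := cq x; apply.
pose eps := Num.min e0 (r / 2).
have eps0 : 0 < eps by rewrite lt_min e00 divr_gt0.
have := density_le_trig_int eps0 etaq.
have near_q (y : V) : (forall i, `|y 0 i - x 0 i| <= eps) -> q x - eta <= q y.
  move=> xy; have : ball x r y.
    split => // i j; rewrite ord1 /ball /= distrC (le_lt_trans (xy j))//.
    by rewrite gt_min ltr_pdivrMr// mulr2n mulrDr mulr1 ltrDl r0 orbT.
  by move=> /rq /=; rewrite ltr_norml => /andP[_]; lra.
move=> /(_ near_q); rewrite leNgt => /negP; apply.
apply: le_lt_trans (HB _ eps0 _) _; first by rewrite ge_min lexx.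
by rewrite /eta; lra.
Qed.

End density_bound.

(** * Symbol and tail of the Levy measure *)

Section levy_symbol.
Context {R : realType} {n : nat}.
Notation V := 'rV[R]_n.
Variable nu : {measure set V -> \bar R}.

Definition levy_cap (y : V) : R := Num.min 1 (enorm y ^+ 2).

Hypothesis icap : rintegrable nu levy_cap.

Lemma levy_cap_ge0 y : 0 <= levy_cap y.
Proof. by rewrite le_min ler01 sqr_ge0. Qed.

Lemma one_sub_cos_cap (xi y : V) :
  1 - cos (dotv xi y) <= (2 + enorm xi ^+ 2) * levy_cap y.
Proof.
have xi0 := sqr_ge0 (enorm xi).
rewrite /levy_cap; case: (lerP 1 (enorm y ^+ 2)) => y1.
  by rewrite mulr1 (le_trans (one_sub_cos_le2 _))// lerDl.
apply: le_trans (one_sub_cos_le _) _.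
have : dotv xi y ^+ 2 <= enorm xi ^+ 2 * enorm y ^+ 2.
  rewrite -exprMn -[leLHS]real_normK ?num_real// ler_sqr ?nnegrE//.
    exact: dotv_le_enorm.
  by rewrite mulr_ge0 ?enorm_ge0.
have := sqr_ge0 (enorm y); have := sqr_ge0 (dotv xi y); nra.
Qed.

Lemma rintegrable_one_sub_cos xi : rintegrable nu (fun y => 1 - cos (dotv xi y)).
Proof.
apply: rintegrable_le (rintegrableZ (2 + enorm xi ^+ 2) icap).
  apply: measurable_funB => //.
  by apply: measurable_cos_dotv2 => //; exact: measurable_cst.
by move=> y; rewrite ger0_norm ?one_sub_cos_ge0// one_sub_cos_cap.
Qed.

Lemma Phi_ge0 xi : 0 <= Phi nu xi.
Proof. by apply: Rint_ge0 => y; exact: one_sub_cos_ge0. Qed.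

Lemma Phi_le xi : Phi nu xi <= (2 + enorm xi ^+ 2) * \int[nu]_y levy_cap y.
Proof.
rewrite -RintZ//; apply: ler_Rint; [exact: rintegrable_one_sub_cos|exact: rintegrableZ|].
by move=> y; exact: one_sub_cos_cap.
Qed.

Lemma Phi_mul2 xi : Phi nu (2 *: xi) <= 4 * Phi nu xi.
Proof.
rewrite -RintZ; last exact: rintegrable_one_sub_cos.
apply: ler_Rint; [exact: rintegrable_one_sub_cos|exact/rintegrableZ/rintegrable_one_sub_cos|].
by move=> y; rewrite dotvZl one_sub_cos_mul2.
Qed.

Lemma has_sup_Psi r : 0 <= r -> has_sup [set Phi nu xi | xi in [set xi | enorm xi <= r]].
Proof.
move=> r0; split; first by exists (Phi nu 0), 0 => //=; rewrite enorm0.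
exists ((2 + r ^+ 2) * \int[nu]_y levy_cap y) => _ [xi /= xir <-].
apply: le_trans (Phi_le xi) _; rewrite ler_wpM2r//.
  by apply: Rint_ge0 => y; exact: levy_cap_ge0.
by rewrite lerD2l ler_sqr ?nnegrE ?enorm_ge0.
Qed.

Lemma Phi_le_Psi xi r : enorm xi <= r -> Phi nu xi <= Psi nu r.
Proof.
move=> xir; have r0 := le_trans (enorm_ge0 _) xir.
by apply: (sup_upper_bound (has_sup_Psi r0)); exists xi.
Qed.

Lemma Psi_le r B : 0 <= r -> (forall xi, enorm xi <= r -> Phi nu xi <= B) -> Psi nu r <= B.
Proof.
move=> r0 HB; apply: ge_sup; first exact: (has_sup_Psi r0).1.
by move=> _ [xi /= xir <-]; exact: HB.
Qed.

Lemma Psi_mul2 r : 0 <= r -> Psi nu (2 * r) <= 4 * Psi nu r.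
Proof.
move=> r0; apply: Psi_le; first exact: mulr_ge0.
move=> xi xir; have -> : xi = 2 *: (2^-1 *: xi).
  by rewrite scalerA divff// scale1r.
apply: le_trans (Phi_mul2 _) _; rewrite ler_pM2l//; apply: Phi_le_Psi.
by rewrite enormZ ger0_norm// ler_pdivrMl.
Qed.

Lemma ler_Psi r r' : 0 <= r -> r <= r' -> Psi nu r <= Psi nu r'.
Proof.
by move=> r0 rr'; apply: Psi_le => // xi xir; apply: Phi_le_Psi; apply: le_trans rr'.
Qed.

Lemma dotv_delta (i : 'I_n) a (y : V) : dotv (a *: delta_mx 0 i) y = a * y 0 i.
Proof.
rewrite dotvZl; congr (_ * _); rewrite /dotv (bigD1 i)//= mxE !eqxx mul1r.
by rewrite big1 ?addr0// => j ji; rewrite mxE (negbTE ji) andbF mul0r.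
Qed.

Lemma enorm_delta (i : 'I_n) a : enorm (a *: delta_mx 0 i : V) = `|a|.
Proof.
by rewrite /enorm dotv_delta !mxE !eqxx mulr1 -expr2 sqrtr_sqr.
Qed.

Lemma rintegrable_coord (i : 'I_n) a : rintegrable nu (fun y => 1 - cos (a * y 0 i)).
Proof.
have := rintegrable_one_sub_cos (a *: delta_mx 0 i).
by under eq_fun do rewrite dotv_delta.
Qed.

Lemma Rint_coord_le (i : 'I_n) a r : `|a| <= r -> \int[nu]_y (1 - cos (a * y 0 i)) <= Psi nu r.
Proof.
move=> ar; apply: le_trans (Phi_le_Psi (xi := a *: delta_mx 0 i) (r := r) _); last by rewrite enorm_delta.
by rewrite /Phi; under [in leRHS]eq_Rintegral do rewrite dotv_delta.
Qed.

Definition small_jump r : V -> R := \1_[set y | enorm y <= r].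
Definition big_jump r : V -> R := \1_[set y | r < enorm y].

Lemma measurable_big_jump r : measurable_fun setT (big_jump r).
Proof. by apply: measurable_indic; exact: measurable_enorm_gt. Qed.

Lemma measurable_small_jump r : measurable_fun setT (small_jump r).
Proof.
apply: measurable_indic; rewrite (_ : [set _ | _] = ~` [set y : V | r < enorm y]).
  by apply: measurableC; exact: measurable_enorm_gt.
by apply/seteqP; split => y /=; rewrite leNgt => /negP.
Qed.

Lemma big_jumpE r y : big_jump r y = (r < enorm y)%R%:R.
Proof. by rewrite /big_jump indicE; congr (_ : bool)%:R; apply/idP/idP; rewrite inE. Qed.

Lemma small_jumpE r y : small_jump r y = (enorm y <= r)%R%:R.
Proof. by rewrite /small_jump indicE; congr (_ : bool)%:R; apply/idP/idP; rewrite inE. Qed.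

Lemma rintegrable_big_jump r : 0 < r -> rintegrable nu (big_jump r).
Proof.
move=> r0; apply: rintegrable_le (rintegrableZ (1 + r ^- 2) icap).
  exact: measurable_big_jump.
move=> y; rewrite big_jumpE ger0_norm//; case: ltP => [ry|_]; last first.
  by rewrite mulr_ge0 ?levy_cap_ge0// addr_ge0// invr_ge0 exprn_ge0// ltW.
have ry2 : r ^+ 2 <= enorm y ^+ 2 by rewrite ler_sqr ?nnegrE ?enorm_ge0// ltW.
have r20 : 0 < r ^- 2 by rewrite invr_gt0 exprn_gt0.
rewrite /levy_cap; case: (lerP 1 (enorm y ^+ 2)) => y1.
  by rewrite mulr1 lerDl ltW.
rewrite mulrDl mul1r; apply: (@le_trans _ _ (r ^- 2 * enorm y ^+ 2)).
  by rewrite -ler_pdivrMl// mulr1 invrK.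
by rewrite lerDr sqr_ge0.
Qed.

Lemma rintegrable_small_sqr r : 0 <= r ->
  rintegrable nu (fun y => small_jump r y * enorm y ^+ 2).
Proof.
move=> r0; apply: rintegrable_le (rintegrableZ (1 + r ^+ 2) icap).
  apply: measurable_funM; first exact: measurable_small_jump.
  by apply: measurable_funX; apply: measurable_enorm; exact: measurable_id.
move=> y; rewrite small_jumpE ger0_norm; last by rewrite mulr_ge0// sqr_ge0.
have y2 := sqr_ge0 (enorm y); have r2 := sqr_ge0 r.
case: (lerP (enorm y) r) => [ry|_]; last by rewrite mul0r mulr_ge0 ?levy_cap_ge0// addr_ge0.
have ry2 : enorm y ^+ 2 <= r ^+ 2 by rewrite ler_sqr ?nnegrE ?enorm_ge0.
rewrite mul1r /levy_cap; case: (lerP 1 (enorm y ^+ 2)) => y1.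
  by rewrite mulr1 (le_trans ry2)// lerDr.
by rewrite mulrDl mul1r lerDl mulr_ge0.
Qed.

(** For |y| <= r each y_i/r has modulus at most 1, so y_i^2 <= 8 r^2 (1 - cos(y_i/r)), and 1 -
    cos(y_i/r) integrates to Phi at a vector of length 1/r. *)
Lemma Rint_small_sqr_le r : 0 < r ->
  \int[nu]_y (small_jump r y * enorm y ^+ 2) <= 8 * n%:R * r ^+ 2 * Psi nu r^-1.
Proof.
move=> r0.
have icoord i := rintegrable_coord i r^-1.
have isum : rintegrable nu (fun y => \sum_(i < n) (1 - cos (r^-1 * y 0 i))).
  apply: (@eq_integrable _ _ _ nu setT measurableT
    (fun y => \sum_(i < n) (1 - cos (r^-1 * y 0 i))%:E)%E).
    by move=> y _; rewrite sumEFin.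
  by apply: integrable_sum => // i _; exact: icoord.
apply: (@le_trans _ _ (\int[nu]_y (8 * r ^+ 2 * \sum_(i < n) (1 - cos (r^-1 * y 0 i))))).
  apply: ler_Rint; [exact/rintegrable_small_sqr/ltW|exact: rintegrableZ|].
  move=> y; rewrite small_jumpE; case: (lerP (enorm y) r) => [yr|_]; last first.
    rewrite mul0r mulr_ge0//; first by rewrite mulr_ge0// sqr_ge0.
    by apply: sumr_ge0 => i _; exact: one_sub_cos_ge0.
  rewrite mul1r sqr_enormE mulr_sumr; apply: ler_sum => i _.
  have yi : `|r^-1 * y 0 i| <= 2.
    rewrite normrM gtr0_norm ?invr_gt0// ler_pdivrMl//.
    by rewrite (le_trans (ler_coord_enorm y i))// (le_trans yr)// ler_pMr// ler1n.
  have := one_sub_cos_ge yi; rewrite exprMn => h.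
  have -> : y 0 i ^+ 2 = 8 * r ^+ 2 * (r^-1 ^+ 2 * y 0 i ^+ 2 / 8).
    by field; rewrite gt_eqF.
  by rewrite ler_wpM2l// mulr_ge0// sqr_ge0.
rewrite RintZ//.
have -> : 8 * n%:R * r ^+ 2 * Psi nu r^-1 = 8 * r ^+ 2 * (n%:R * Psi nu r^-1) by ring.
rewrite ler_wpM2l//; first by rewrite mulr_ge0// sqr_ge0.
rewrite /Rintegral (eq_integral (fun y : V => \sum_(i < n) (1 - cos (r^-1 * y 0 i))%:E)%E); last first.
  by move=> y _; rewrite sumEFin.
rewrite integral_sum//.
under eq_bigr do rewrite -RintegralE//.
rewrite sumEFin /= mulr_natl -[X in _ *+ X]card_ord -sumr_const.
apply: ler_sum => i _; apply: Rint_coord_le.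
by rewrite gtr0_norm// invr_gt0.
Qed.

End levy_symbol.

(** * Averaged cosines and the mass of large jumps *)

Section cosine_average.
Context {R : realType}.
Notation mu := (@lebesgue_measure R).

Definition unit_itv : R -> R := \1_`[0, 1].

Lemma unit_itvE (u : R) : unit_itv u = (0 <= u <= 1)%R%:R.
Proof.
rewrite /unit_itv indicE; congr (_ : bool)%:R.
by apply/idP/idP; rewrite inE /= in_itv.
Qed.

Lemma rintegrable_unit_itv : rintegrable mu unit_itv.
Proof. exact: (@integrable_indic_itv R 0 1 true false). Qed.

Lemma Rint_unit_itv (f : R -> R) :
  \int[mu]_u (unit_itv u * f u) = \int[mu]_(u in `[0, 1]) f u.
Proof.
rewrite [RHS]Rintegral_mkcond; apply: eq_Rintegral => u _.
rewrite patchE unit_itvE; case: (boolP (0 <= u <= 1)) => [u01|/negP u01].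
  by rewrite mem_set /= ?in_itv//= mul1r.
by rewrite memNset /= ?in_itv//= mul0r.
Qed.

Lemma Rint_unit_itv1 : \int[mu]_u unit_itv u = 1.
Proof.
rewrite /Rintegral integral_indic ?setIT//.
have /= -> := @lebesgue_measure_itv R `[0, 1].
by rewrite lte_fin ltr01 oppr0 adde0.
Qed.

(** The average is 1 - sin(s)/s. Unlike 1 - cos s, it does not vanish at the nonzero multiples of 2
    pi. *)
Lemma cos_average_ge (s : R) : 2 <= `|s| ->
  2^-1 <= \int[mu]_u (unit_itv u * (1 - cos (u * s))).
Proof.
move=> s2; have s0 : s != 0 by rewrite -normr_gt0 (lt_le_trans _ s2).
have dF (u : R) : is_derive u (1 : R) (fun u => u - s^-1 * sin (u * s)) (1 - cos (u * s)).
  apply: is_derive_eq; rewrite /GRing.scale /=; field; exact: s0.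
rewrite Rint_unit_itv (@Rint_itv_derive R _ _ 0 1 ltr01 _ dF); last first.
  by move=> u; apply: differentiable_continuous; apply/derivable1_diffP; apply: ex_derive.
rewrite mul0r sin0 mulr0 subr0 mul1r subr0.
have : `|s^-1 * sin s| <= 2^-1.
  rewrite normrM normfV -[leRHS]mulr1 ler_pM ?invr_ge0// ?sin_max//.
  by rewrite lef_pV2 ?posrE// (lt_le_trans _ s2).
rewrite ler_norml => /andP[_]; lra.
Qed.

End cosine_average.

Section levy_tail.
Context {R : realType} {n : nat}.
Notation V := 'rV[R]_n.
Notation mu := (@lebesgue_measure R).
Variable nu : {sigma_finite_measure set V -> \bar R}.
Hypothesis icap : rintegrable nu levy_cap.

Let F r (i : 'I_n) (y : V) (u : R) := unit_itv u * (1 - cos (u * (r^-1 * y 0 i))).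

Let F_ge0 r i y u : 0 <= F r i y u.
Proof. by rewrite mulr_ge0 ?one_sub_cos_ge0// unit_itvE. Qed.

Let F_le r i y u : 0 < r -> `|F r i y u| <= ((2 + r^-1 ^+ 2) * levy_cap y) * unit_itv u.
Proof.
move=> r0; rewrite ger0_norm// /F [leLHS]mulrC unit_itvE.
case: (boolP (0 <= u <= 1)) => [/andP[u0 u1]|_]; last by rewrite !mulr0.
rewrite !mulr1.
have -> : u * (r^-1 * y 0 i) = dotv ((u * r^-1) *: delta_mx 0 i) y.
  by rewrite dotv_delta mulrA.
apply: le_trans (one_sub_cos_cap _ _) _; rewrite ler_wpM2r ?levy_cap_ge0//.
rewrite enorm_delta lerD2l ler_sqr ?nnegrE ?invr_ge0 ?(ltW r0)//.
rewrite ger0_norm; last by rewrite mulr_ge0// invr_ge0 ltW.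
by rewrite ler_piMl// invr_ge0 ltW.
Qed.

Let mF r i : measurable_fun setT (fun z : V * measurableTypeR R => F r i z.1 z.2).
Proof.
apply: measurable_funM.
  by apply: measurableT_comp => //; exact: measurable_indic.
apply: measurable_funB => //; apply: (@measurableT_comp _ _ _ _ _ _ cos) => /=.
  by apply: continuous_measurable_fun; exact: continuous_cos.
apply: measurable_funM => //; apply: measurable_funM => //.
exact: measurable_coord.
Qed.

Lemma rintegrable_levy_cap2 r : rintegrable nu (fun y => (2 + r^-1 ^+ 2) * levy_cap y).
Proof. exact: rintegrableZ. Qed.

Let A r i y := \int[mu]_u F r i y u.

Let iA r i : 0 < r -> rintegrable nu (A r i).
Proof.
move=> r0; apply: rintegrable_le (rintegrable_levy_cap2 r).
  apply: (measurable_Rint_param (m2 := mu) (g := fun u => (2 + r^-1 ^+ 2) * unit_itv u)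
    (F := F r i)) => //.
  - move=> y u; apply: le_trans (F_le i y u r0) _; rewrite ler_wpM2r// ?unit_itvE//.
    by rewrite ler_piMr ?addr_ge0 ?sqr_ge0// /levy_cap ge_min lexx.
  - by apply: rintegrableZ; exact: rintegrable_unit_itv.
move=> y; apply: (@le_trans _ _ (\int[mu]_u ((2 + r^-1 ^+ 2) * levy_cap y * unit_itv u))).
  apply: norm_Rint_le => [||u]; last exact: F_le.
  - apply: (@rintegrable_le _ _ _ mu _ (fun u => (2 + r^-1 ^+ 2) * levy_cap y * unit_itv u)).
    + exact: (measurableT_comp (mF r i) (pair1_measurable y)).
    + by move=> u; exact: F_le.
    + by apply: rintegrableZ; exact: rintegrable_unit_itv.
  - by apply: rintegrableZ; exact: rintegrable_unit_itv.
rewrite RintZ ?Rint_unit_itv1 ?mulr1//; exact: rintegrable_unit_itv.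
Qed.

(** After Fubini each dilation u in [0, 1] contributes Phi at a vector of length u/r <= 1/r. *)
Let A_le r i : 0 < r -> \int[nu]_y A r i y <= Psi nu r^-1.
Proof.
move=> r0; rewrite (Rint_fubini (mF r i) (fun y u => F_le i y u r0)
  (rintegrable_levy_cap2 r) rintegrable_unit_itv).
have -> : Psi nu r^-1 = \int[mu]_u (Psi nu r^-1 * unit_itv u).
  by rewrite RintZ ?Rint_unit_itv1 ?mulr1//; exact: rintegrable_unit_itv.
have ic u : rintegrable nu (fun y => F r i y u).
  apply: rintegrableZ; have := rintegrable_coord icap i (u * r^-1).
  by under eq_fun do rewrite -mulrA.
have Iu u : \int[nu]_y F r i y u <= Psi nu r^-1 * unit_itv u.
  rewrite RintZ; last first.
    by have := rintegrable_coord icap i (u * r^-1); under eq_fun do rewrite -mulrA.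
  rewrite mulrC unit_itvE; case: (boolP (0 <= u <= 1)) => [/andP[u0 u1]|_]; last by rewrite !mulr0.
  rewrite !mulr1; under eq_Rintegral do rewrite mulrA.
  apply: (Rint_coord_le icap); rewrite ger0_norm; last by rewrite mulr_ge0// invr_ge0 ltW.
  by rewrite ler_piMl// invr_ge0 ltW.
have I0 u : 0 <= \int[nu]_y F r i y u by apply: Rint_ge0 => y; exact: F_ge0.
have ir : rintegrable mu (fun u => Psi nu r^-1 * unit_itv u).
  by apply: rintegrableZ; exact: rintegrable_unit_itv.
apply: ler_Rint => //.
apply: (@rintegrable_le _ _ _ mu _ (fun u => Psi nu r^-1 * unit_itv u)) => //.
  apply: (measurable_Rint_param (m2 := nu) (T1 := measurableTypeR R)
    (g := fun y => (2 + r^-1 ^+ 2) * levy_cap y) (F := fun u y => F r i y u)).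
  - exact: (measurableT_comp (mF r i) (@measurable_swap _ _ _ _)).
  - move=> u y; apply: le_trans (F_le i y u r0) _; rewrite ler_piMr//.
      by rewrite mulr_ge0 ?levy_cap_ge0// addr_ge0// sqr_ge0.
    by rewrite unit_itvE; case: (_ && _).
  - exact: rintegrable_levy_cap2.
by move=> u; rewrite ger0_norm.
Qed.

(* If |y| > r, some coordinate of y/r exceeds 1/sqrt n in modulus, hence either 1 - cos of it or its average
   over dilations u in [0, 1] is bounded below. *)
Theorem Rint_big_jump_le r : 0 < r ->
  \int[nu]_y big_jump r y <= 16 * n%:R ^+ 2 * Psi nu r^-1.
Proof.
move=> r0.
pose G (i : 'I_n) (y : V) := (1 - cos (r^-1 * y 0 i)) + A r i y.
have iG i : rintegrable nu (G i).
  by apply: rintegrableD; [exact: rintegrable_coord|exact: iA].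
have G0 i y : 0 <= G i y.
  by rewrite addr_ge0 ?one_sub_cos_ge0//; apply: Rint_ge0 => u; exact: F_ge0.
have isum : rintegrable nu (fun y => \sum_(i < n) G i y).
  apply: (@eq_integrable _ _ _ nu setT measurableT (fun y => \sum_(i < n) (G i y)%:E)%E).
    by move=> y _; rewrite sumEFin.
  by apply: integrable_sum => // i _; exact: iG.
(* The factor 8n: for the large coordinate, [G] is at least (1/n)/8 by [one_sub_cos_ge] or at least
   1/2 by [cos_average_ge]. Each of the n terms then integrates to at most 2 Psi(1/r). *)
apply: (@le_trans _ _ (\int[nu]_y (8 * n%:R * \sum_(i < n) G i y))).
  apply: ler_Rint; [exact: rintegrable_big_jump|exact: rintegrableZ|].
  move=> y; rewrite big_jumpE; case: (ltP r (enorm y)) => [ry|_]; last first.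
    by rewrite mulr_ge0 ?mulr_ge0// sumr_ge0.
  have [n0|n0] := posnP n.
    suff : enorm y = 0 by have := lt_trans r0 ry => + E; rewrite E ltxx.
    rewrite /enorm /dotv big1 ?sqrtr0// => -[j jn]; exfalso.
    by move: jn; rewrite n0.
  have nR : 0 < n%:R :> R by rewrite ltr0n.
  have [i yi] : exists i, r ^+ 2 <= n%:R * y 0 i ^+ 2.
    apply/not_existsP => h.
    have : enorm y ^+ 2 < r ^+ 2.
      rewrite sqr_enormE -(ltr_pM2l nR) mulr_sumr.
      rewrite [ltRHS](_ : _ = \sum_(i < n) r ^+ 2); last by rewrite sumr_const card_ord mulr_natl.
      apply: ltr_sum; last by move=> i _; rewrite ltNge; apply/negP; exact: h.
      by apply/hasP; exists (Ordinal n0) => //; rewrite mem_index_enum.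
    rewrite ltr_sqr ?nnegrE ?enorm_ge0 ?(ltW r0)// => /lt_trans/(_ ry).
    by rewrite ltxx.
  rewrite (bigD1 i)//= mulrDr.
  suff : 1 <= 8 * n%:R * G i y.
    move=> /le_trans; apply; rewrite lerDl mulr_ge0 ?mulr_ge0// sumr_ge0//.
  have s2 : n%:R^-1 <= (r^-1 * y 0 i) ^+ 2.
    by rewrite exprMn exprVn ler_pdivlMl ?exprn_gt0// ler_pdivrMr// [leRHS]mulrC.
  have n1 : n%:R^-1 <= 1 :> R by rewrite invf_le1// ler1n.
  have A0 : 0 <= A r i y by apply: Rint_ge0 => u; exact: F_ge0.
  have [sl2|/ltW sg2] := leP `|r^-1 * y 0 i| 2.
    have := one_sub_cos_ge sl2 => h.
    rewrite -mulrA -ler_pdivrMl// -ler_pdivrMl// /G; lra.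
  have := cos_average_ge sg2 => h.
  have := one_sub_cos_ge0 (r^-1 * y 0 i) => h0.
  rewrite -mulrA -ler_pdivrMl// -ler_pdivrMl// /G.
  have : 2^-1 <= A r i y by exact: h.
  lra.
rewrite RintZ//.
have -> : 16 * n%:R ^+ 2 * Psi nu r^-1 = 8 * n%:R * (n%:R * (2 * Psi nu r^-1)) by ring.
rewrite ler_wpM2l//.
rewrite /Rintegral (eq_integral (fun y : V => \sum_(i < n) (G i y)%:E)%E); last first.
  by move=> y _; rewrite sumEFin.
rewrite integral_sum//.
under eq_bigr do rewrite -RintegralE//.
rewrite sumEFin /= mulr_natl -[X in _ *+ X]card_ord -sumr_const.
apply: ler_sum => i _; rewrite RintD; [|exact: rintegrable_coord|exact: iA].
have := A_le i r0.
have := @Rint_coord_le _ _ nu icap i r^-1 r^-1.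
rewrite ger0_norm ?invr_ge0 ?(ltW r0)// lexx => /(_ isT); lra.
Qed.

End levy_tail.

(* The function f of the theorem composed with the norm is not assumed measurable,
   so the library comparison lemma does not apply. *)
Lemma ge0_le_integral_nonmeasurable (R : realType) (dT : measure_display)
    (T : measurableType dT) (mu : {measure set T -> \bar R}) (D : set T)
    (f g : T -> \bar R) :
  (forall x, D x -> (0 <= f x)%E) -> (forall x, D x -> (f x <= g x)%E) ->
  (\int[mu]_(x in D) f x <= \int[mu]_(x in D) g x)%E.
Proof.
move=> f0 fg; have g0 x : D x -> (0 <= g x)%E by move=> Dx; exact: le_trans (f0 _ Dx) (fg _ Dx).
rewrite ge0_integralE// ge0_integralE//; apply: ereal_sup_le => _ [h /= hf <-].
exists h => //= x; apply: le_trans (hf x) _; rewrite !patchE.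
by case: ifPn => // xD; apply: fg; rewrite inE in xD.
Qed.

(** * The walk of large jumps *)

Section step_operator_order.
Context {R : realType} {n : nat}.
Notation V := 'rV[R]_n.
Variable nu : {sigma_finite_measure set V -> \bar R}.
Implicit Types (g : V -> R) (x y : V).

Definition bounded_mfun g := measurable_fun setT g /\ exists M, forall x, `|g x| <= M.

Lemma bounded_mfun_shift g y : bounded_mfun g -> bounded_mfun (fun x => g (x + y)).
Proof.
move=> [mg [M gM]]; split; last by exists M.
by apply: (measurableT_comp mg); apply: measurable_rVD => //; exact: measurable_cst.
Qed.

Lemma bounded_mfun_indic (A : set V) : measurable A -> bounded_mfun (\1_A : V -> R).
Proof.
move=> mA; split; first exact: measurable_indic.
by exists 1 => x; rewrite indicE; case: (_ \in _); rewrite ?normr1 ?normr0.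
Qed.

Lemma bounded_mfun_cst (a : R) : bounded_mfun (fun=> a).
Proof. by split; [exact: measurable_cst|exists `|a|]. Qed.

Lemma bounded_mfunD g1 g2 : bounded_mfun g1 -> bounded_mfun g2 ->
  bounded_mfun (fun x => g1 x + g2 x).
Proof.
move=> [m1 [M1 b1]] [m2 [M2 b2]]; split; first exact: measurable_funD.
by exists (M1 + M2) => x; rewrite (le_trans (ler_normD _ _))// lerD.
Qed.

Lemma bounded_mfunZ a g : bounded_mfun g -> bounded_mfun (fun x => a * g x).
Proof.
move=> [mg [M gM]]; split; first exact: measurable_funM.
by exists (`|a| * M) => x; rewrite normrM ler_wpM2l.
Qed.

Lemma rintegrable_weight om g x : rintegrable nu om -> bounded_mfun g ->
  rintegrable nu (fun y => om y * g (x + y)).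
Proof.
move=> iom [mg [M gM]]; apply: (rintegrableM (M := M)) => //.
exact: (measurableT_comp mg (measurable_transl x)).
Qed.

Lemma bounded_mfun_step k om g : rintegrable nu om -> bounded_mfun g ->
  bounded_mfun (step_op nu k om g).
Proof.
move=> iom [mg [M gM]]; split.
  apply: measurable_funD; first exact: measurable_funM.
  apply: (measurable_Rint_param (m2 := nu) (T1 := V) (g := fun y => M * `|om y|)
    (F := fun x y => om y * g (x + y))).
  - apply: measurable_funM.
      by apply: measurableT_comp => //; exact: rintegrable_measurable iom.
    by apply: (measurableT_comp mg); exact: measurable_rVD.
  - by move=> x y; rewrite normrM mulrC ler_wpM2r.
  - by apply: rintegrableZ; exact: rintegrable_norm.
exists (`|k| * M + \int[nu]_y (M * `|om y|)) => x.
rewrite (le_trans (ler_normD _ _))// lerD ?normrM ?ler_wpM2l//.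
apply: norm_Rint_le.
- by apply: rintegrable_weight => //; split => //; exists M.
- by apply: rintegrableZ; exact: rintegrable_norm.
- by move=> y; rewrite normrM mulrC ler_wpM2r.
Qed.

Lemma step_opD k om g1 g2 : rintegrable nu om -> bounded_mfun g1 -> bounded_mfun g2 ->
  step_op nu k om (fun x => g1 x + g2 x) =
  (fun x => step_op nu k om g1 x + step_op nu k om g2 x).
Proof.
move=> iom b1 b2; apply/funext => x; rewrite /step_op.
under eq_Rintegral do rewrite mulrDr.
by rewrite RintD; [ring|exact: rintegrable_weight..].
Qed.

Lemma step_opZ k om a g : rintegrable nu om -> bounded_mfun g ->
  step_op nu k om (fun x => a * g x) = (fun x => a * step_op nu k om g x).
Proof.
move=> iom b; apply/funext => x; rewrite /step_op.
under eq_Rintegral do rewrite mulrCA.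
by rewrite RintZ; [ring|exact: rintegrable_weight].
Qed.

Lemma step_op_shift k om g y :
  step_op nu k om (fun x => g (x + y)) = (fun x => step_op nu k om g (x + y)).
Proof.
apply/funext => x; rewrite /step_op; congr (_ + _).
by apply: eq_Rintegral => z _; rewrite addrAC.
Qed.

Lemma iter_step_op_shift k om g y N :
  iter N (step_op nu k om) (fun x => g (x + y)) =
  (fun x => iter N (step_op nu k om) g (x + y)).
Proof. by elim: N => // N IH; rewrite !iterS IH step_op_shift. Qed.

(** Both operators average over translations, so Fubini suffices. In [walk_le] this moves a long
    first jump to the end of the walk. *)
Lemma step_op_commute k om k' om' g : rintegrable nu om -> rintegrable nu om' ->
  bounded_mfun g ->
  step_op nu k om (step_op nu k' om' g) = step_op nu k' om' (step_op nu k om g).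
Proof.
move=> iom iom' bg; apply/funext => x; rewrite /step_op.
have iw y := rintegrable_weight y iom bg.
have iw' y := rintegrable_weight y iom' bg.
have bU (w : V -> R) : rintegrable nu w ->
    bounded_mfun (fun x => \int[nu]_y (w y * g (x + y))).
  move=> wi; have := bounded_mfun_step 0 wi bg.
  by rewrite /step_op; under eq_fun do rewrite mul0r add0r.
have iU w w' y : rintegrable nu w -> rintegrable nu w' ->
    rintegrable nu (fun z => w z * \int[nu]_z' (w' z' * g (y + z + z'))).
  by move=> wi wi'; exact: (rintegrable_weight y wi (bU w' wi')).
have E w w' j : rintegrable nu w -> rintegrable nu w' ->
   \int[nu]_y (w y * (j * g (x + y) + \int[nu]_z (w' z * g (x + y + z)))) =
   j * \int[nu]_y (w y * g (x + y)) +
   \int[nu]_y (w y * \int[nu]_z (w' z * g (x + y + z))).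
  move=> wi wi'; have i1 := rintegrable_weight x wi bg.
  under eq_Rintegral do rewrite mulrDr mulrCA.
  by rewrite RintD ?RintZ//; [exact: rintegrableZ|exact: iU].
rewrite !E//.
suff -> : \int[nu]_y (om y * \int[nu]_z (om' z * g (x + y + z))) =
          \int[nu]_y (om' y * \int[nu]_z (om z * g (x + y + z))) by ring.
have [mg [M gM]] := bg.
transitivity (\int[nu]_y \int[nu]_z (om y * om' z * g (x + y + z))).
  apply: eq_Rintegral => y _; rewrite -RintZ; last exact: rintegrable_weight.
  by apply: eq_Rintegral => z _; rewrite mulrA.
rewrite (Rint_fubini (f := fun y => M * `|om y|) (g := fun z => `|om' z|)); last 4 first.
- apply: measurable_funM; last first.
    apply: (measurableT_comp mg); apply: measurable_rVD => //.
    by apply: measurable_rVD => //; exact: measurable_cst.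
  by apply: measurable_funM; apply: measurableT_comp => //; [exact: rintegrable_measurable iom|exact: rintegrable_measurable iom'].
- by move=> y z; rewrite !normrM mulrC -mulrA ler_wpM2r// mulr_ge0.
- exact/rintegrableZ/rintegrable_norm.
- exact: rintegrable_norm.
apply: eq_Rintegral => z _; rewrite -RintZ; last exact: rintegrable_weight.
by apply: eq_Rintegral => y _; rewrite addrAC; ring.
Qed.

Lemma iter_step_op_bounded k om g N : rintegrable nu om -> bounded_mfun g ->
  bounded_mfun (iter N (step_op nu k om) g).
Proof. by move=> iom bg; elim: N => // N IH; rewrite iterS; exact: bounded_mfun_step. Qed.

Lemma iter_step_op_commute k om k' om' g N : rintegrable nu om -> rintegrable nu om' ->
  bounded_mfun g ->
  step_op nu k' om' (iter N (step_op nu k om) g) =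
  iter N (step_op nu k om) (step_op nu k' om' g).
Proof.
move=> iom iom' bg; elim: N => // N IH.
by rewrite !iterS -IH step_op_commute//; exact: iter_step_op_bounded.
Qed.

Lemma iter_step_opD k om g1 g2 N : rintegrable nu om -> bounded_mfun g1 -> bounded_mfun g2 ->
  iter N (step_op nu k om) (fun x => g1 x + g2 x) =
  (fun x => iter N (step_op nu k om) g1 x + iter N (step_op nu k om) g2 x).
Proof.
move=> iom b1 b2; elim: N => // N IH.
by rewrite !iterS IH step_opD//; exact: iter_step_op_bounded.
Qed.

Lemma iter_step_opZ k om a g N : rintegrable nu om -> bounded_mfun g ->
  iter N (step_op nu k om) (fun x => a * g x) =
  (fun x => a * iter N (step_op nu k om) g x).
Proof.
move=> iom b; elim: N => // N IH.
by rewrite !iterS IH step_opZ//; exact: iter_step_op_bounded.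
Qed.

Section markov.
Variables (k : R) (om : V -> R).
Hypotheses (k0 : 0 <= k) (om0 : forall y, 0 <= om y) (iom : rintegrable nu om)
  (mass1 : k + \int[nu]_y om y = 1).
Let W := step_op nu k om.

Lemma step_op_le g1 g2 : bounded_mfun g1 -> bounded_mfun g2 ->
  (forall x, g1 x <= g2 x) -> forall x, W g1 x <= W g2 x.
Proof.
move=> b1 b2 g12 x; apply: lerD; first exact: ler_wpM2l.
apply: ler_Rint; [exact: rintegrable_weight..|].
by move=> y; rewrite ler_wpM2l.
Qed.

Lemma iter_step_op_le N g1 g2 : bounded_mfun g1 -> bounded_mfun g2 ->
  (forall x, g1 x <= g2 x) -> forall x, iter N W g1 x <= iter N W g2 x.
Proof.
move=> b1 b2 g12; elim: N => [x|N IH]; first exact: g12.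
by rewrite !iterS; apply: step_op_le => //; exact: iter_step_op_bounded.
Qed.

Lemma step_op_cst a : W (fun=> a) = (fun=> a).
Proof.
apply/funext => x; rewrite /W /step_op RintegralZr// -mulrDl.
by rewrite mass1 mul1r.
Qed.

Lemma iter_step_op_cst N a : iter N W (fun=> a) = (fun=> a).
Proof. by elim: N => // N IH; rewrite iterS IH step_op_cst. Qed.

Lemma bounded_mfun_simple a (b : nat -> R) (A : nat -> set V) K :
  (forall j, measurable (A j)) ->
  bounded_mfun (fun y => a + \sum_(j < K) b j * \1_(A j) y).
Proof.
move=> mA; elim: K => [|K IH].
  by under eq_fun do rewrite big_ord0; exact: bounded_mfun_cst.
under eq_fun do rewrite big_ord_recr /= addrA.
by apply: bounded_mfunD => //; apply: bounded_mfunZ; exact: bounded_mfun_indic.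
Qed.

Lemma iter_step_op_simple N a (b : nat -> R) (A : nat -> set V) K x :
  (forall j, measurable (A j)) ->
  iter N W (fun y => a + \sum_(j < K) b j * \1_(A j) y) x =
  a + \sum_(j < K) b j * iter N W \1_(A j) x.
Proof.
move=> mA; elim: K => [|K IH].
  rewrite big_ord0; under [X in iter _ _ X]eq_fun do rewrite big_ord0.
  by rewrite iter_step_op_cst.
rewrite big_ord_recr /= addrA -IH.
under [X in iter _ _ X]eq_fun do rewrite big_ord_recr /= addrA.
have b1 := bounded_mfun_indic (mA K).
have bs := bounded_mfun_simple a b K mA.
by rewrite (iter_step_opD _ _ iom bs (bounded_mfunZ (b K) b1)) (iter_step_opZ _ _ _ iom b1).
Qed.

Lemma iter_step_op_ge0 N g : bounded_mfun g -> (forall x, 0 <= g x) ->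
  forall x, 0 <= iter N W g x.
Proof.
move=> bg g0 x; have := iter_step_op_le N (bounded_mfun_cst 0) bg g0 x.
by rewrite iter_step_op_cst.
Qed.

End markov.
End step_operator_order.

Section big_jump_walk.
Context {R : realType} {n : nat}.
Notation V := 'rV[R]_n.
Variable nu : {sigma_finite_measure set V -> \bar R}.
Hypothesis icap : rintegrable nu levy_cap.
Variables (f : R -> \bar R) (gamma M3 M4 : R).
Hypotheses (gamma0 : 0 <= gamma) (M30 : 0 < M3) (M40 : 0 < M4).
Hypothesis f_ge0 : forall s, 0 <= s -> (0 <= f s)%E.
Hypothesis f_noninc : forall s s', 0 <= s -> s <= s' -> (f s' <= f s)%E.
Hypothesis nu_le : forall A : set V, measurable A ->
  (nu A <= M3%:E * f (delta A) * (diam A `^ gamma))%E.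
Variable r : R.
Hypothesis r0 : 0 < r.
Hypothesis int_f : forall s, 0 < s ->
  (\int[nu]_(y in [set y | (r < enorm y)%R])
        f (Num.max s (enorm y) - enorm y / 2)%R
      <= M4%:E * f s * (Psi nu r^-1)%:E)%E.
Variables (t : R) (t0 : 0 < t) (tPsi : t * Psi nu r^-1 <= 4).

Definition diam_le (A : set V) (D : R) := forall a b, A a -> A b -> enorm (b - a) <= D.

Lemma nu_diam_le (A : set V) (s D : R) : measurable A -> 0 <= s -> 0 <= D ->
  (forall y, A y -> s <= enorm y) -> diam_le A D ->
  (nu A <= M3%:E * f s * (D `^ gamma)%:E)%E.
Proof.
move=> mA s0 D0 As AD.
have M3f u : 0 <= u -> (0 <= M3%:E * f u)%E.
  by move=> u0; rewrite mule_ge0 ?f_ge0// lee_fin ltW.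
(* The empty set is separate because [delta] is 0 there, so that s <= delta A may fail. *)
have [->|/set0P[a Aa]] := eqVneq A set0.
  by rewrite measure0 mule_ge0 ?M3f// lee_fin powR_ge0.
apply: le_trans (nu_le mA) _.
have sd : s <= delta A.
  apply: lb_le_inf; first by exists (enorm a), a.
  by move=> _ [y Ay <-]; exact: As.
have dD : (diam A <= D%:E)%E.
  by apply: ge_ereal_sup => _ [x Ax [y Ay <-]]; rewrite lee_fin; exact: AD.
have d0 : (0 <= diam A)%E.
  by apply: ereal_sup_ubound; exists a => //; exists a => //; rewrite subrr enorm0.
apply: lee_pmul.
- by apply: M3f; exact: le_trans sd.
- exact: poweR_ge0.
- by apply: lee_wpmul2l; [rewrite lee_fin ltW|exact: f_noninc].
- rewrite -poweR_EFin; apply: gt0_ler_poweR => //.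
  + by rewrite in_itv /= d0 leey.
  + by rewrite in_itv /= lee_fin D0 leey.
Qed.

Variables (N : nat) (N0 : (0 < N)%N).
Let q := t / N%:R.
Let Q := \int[nu]_y big_jump r y.
Hypothesis tQN : t * Q <= N%:R.
Let k := 1 - q * Q.
Let om (y : V) := q * big_jump r y.
Let W := step_op nu k om.

Let q0 : 0 < q. Proof. by rewrite divr_gt0// ltr0n. Qed.

Lemma walk_k_ge0 : 0 <= k.
Proof.
rewrite /k subr_ge0 /q mulrAC ler_pdivrMr ?ltr0n//; by rewrite mul1r.
Qed.

Lemma walk_Q_ge0 : 0 <= Q.
Proof. by apply: Rint_ge0 => y; rewrite big_jumpE. Qed.

Lemma walk_k_le1 : k <= 1.
Proof. by rewrite /k lerBlDr lerDl mulr_ge0 ?(ltW q0)// walk_Q_ge0. Qed.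

Lemma walk_om_ge0 y : 0 <= om y.
Proof. by rewrite /om mulr_ge0 ?(ltW q0)// big_jumpE. Qed.

Lemma walk_om_int : rintegrable nu om.
Proof. by apply: rintegrableZ; exact: rintegrable_big_jump. Qed.

Lemma walk_mass : k + \int[nu]_y om y = 1.
Proof. by rewrite RintZ ?subrK//; exact: rintegrable_big_jump. Qed.

(** Growth per step in the induction of [walk_le]: 4 M4/N comes from a first jump of length at most
    s, by the integral condition and t Psi <= 4, and 1/N from a longer one. After N steps it is at
    most t M3 e^(4 M4 + 1), whatever N. *)
Definition walk_const j := t * M3 * (1 + (4 * M4 + 1) / N%:R) ^+ j.

Let base_ge1 : 1 <= 1 + (4 * M4 + 1) / N%:R.
Proof. by rewrite lerDl divr_ge0// addr_ge0// mulr_ge0// ltW. Qed.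

Lemma walk_const_ge j : t * M3 <= walk_const j.
Proof.
rewrite /walk_const ler_pMr ?mulr_gt0//; exact: exprn_ege1.
Qed.

Lemma walk_const_gt0 j : 0 < walk_const j.
Proof. by apply: lt_le_trans (walk_const_ge j); rewrite mulr_gt0. Qed.

Lemma walk_le j (A : set V) (s D : R) : measurable A -> 0 < s -> 0 < D ->
  (forall y, A y -> 2 * s <= enorm y) -> diam_le A D ->
  ((iter j W \1_A 0)%:E <= (walk_const j * D `^ gamma)%:E * f s)%E.
Proof.
elim: j A s D => [|j IH] A s D mA s0 D0 As AD.
  rewrite /= indicE memNset; last first.
    by move=> /As; rewrite enorm0 leNgt mulr_gt0.
  by rewrite mule_ge0 ?f_ge0 ?(ltW s0)// lee_fin mulr_ge0 ?powR_ge0// ltW// walk_const_gt0.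
have Dg0 : 0 < D `^ gamma by exact: powR_gt0.
have KD0 := mulr_gt0 (walk_const_gt0 j) Dg0.
have fs0 := f_ge0 (ltW s0).
have [fsoo|fsfin] := eqVneq (f s) +oo%E.
  rewrite fsoo gt0_muley ?leey// lte_fin mulr_gt0//; exact: walk_const_gt0.
have {fsfin} /fineK fsE : f s \is a fin_num by rewrite ge0_fin_numE// ltey.
set F := fine (f s) in fsE.
have F0 : 0 <= F by rewrite -lee_fin fsE.
have b1 : bounded_mfun (\1_A : V -> R) by exact: bounded_mfun_indic.
have g0 x : 0 <= \1_A x :> R by rewrite indicE.
pose u := iter j W (\1_A : V -> R).
have bu : bounded_mfun u by apply: iter_step_op_bounded => //; exact: walk_om_int.
have u0 y : 0 <= u y.
  by apply: (iter_step_op_ge0 walk_k_ge0 walk_om_ge0 walk_om_int walk_mass).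
have ib := rintegrable_big_jump icap r0.
have ibs := rintegrable_big_jump icap s0.
pose beta (y : V) := big_jump r y * big_jump s y.
have ibeta : rintegrable nu beta.
  apply: (rintegrableM (M := 1)) => //; first exact: measurable_big_jump.
  by move=> y; rewrite big_jumpE; case: (_ < _)%R; rewrite ?normr1 ?normr0.
pose al (y : V) := big_jump r y * small_jump s y.
have ial : rintegrable nu al.
  apply: (rintegrableM (M := 1)) => //; first exact: measurable_small_jump.
  by move=> y; rewrite small_jumpE; case: (enorm y <= s)%R; rewrite ?normr1 ?normr0.
have bE y : big_jump r y = al y + beta y.
  rewrite /al /beta -mulrDr small_jumpE big_jumpE [in X in _ * X]big_jumpE.
  by case: (ltP s (enorm y)) => _; rewrite ?add0r ?addr0 mulr1.
(* Condition on the first jump y.  If |y| <= s, the remaining walk has to charge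
   A - y, which is at distance at least 2 (s - |y|/2) from the origin; this is what the
   integral condition on f controls.  If |y| > s, commuting the jump to the end
   leaves the measure of (A - x) off the ball of radius s. *)
have p1 : u 0 <= walk_const j * D `^ gamma * F.
  by have := IH A s D mA s0 D0 As AD; rewrite -fsE -EFinM lee_fin.
have p2 : \int[nu]_y (al y * u y) <= walk_const j * D `^ gamma * M4 * F * Psi nu r^-1.
  have iau : rintegrable nu (fun y => al y * u y).
    by have := rintegrable_weight 0 ial bu; under eq_fun do rewrite add0r.
  pose v y := (walk_const j * D `^ gamma)^-1 * (al y * u y).
  have iv : rintegrable nu v by exact: rintegrableZ.
  suff : ((\int[nu]_y v y)%R%:E <= M4%:E * f s * (Psi nu r^-1)%:E)%E.
    rewrite -fsE -!EFinM lee_fin RintZ// ler_pdivrMl// => /le_trans; apply.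
    by rewrite !mulrA.
  rewrite RintegralE//; apply: le_trans _ (int_f s0).
  rewrite [leRHS]integral_mkcond.
  apply: ge0_le_integral_nonmeasurable => y _.
    by rewrite lee_fin /v !mulr_ge0 ?invr_ge0 ?(ltW KD0)// /al big_jumpE ?small_jumpE.
  rewrite patchE /v /al big_jumpE small_jumpE; case: ifPn => [|yr]; last first.
    rewrite notin_setE /= in yr.
    by rewrite (introF idP yr) mul0r mul0r mulr0.
  rewrite inE /= => yr; rewrite yr mul1r.
  case: (lerP (enorm y) s) => ys; last first.
    rewrite mul0r mulr0 f_ge0//; have := enorm_ge0 y => y0.
    lra.
  rewrite mul1r -(@lee_pmul2l _ (walk_const j * D `^ gamma)%:E)//.
  rewrite -EFinM mulVKf ?gt_eqF//.
  pose B := (fun x => x + y) @^-1` A.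
  have uB : u y = iter j W \1_B 0.
    have -> : \1_B = (fun x => \1_A (x + y)) :> (V -> R).
      apply/funext => x; rewrite !indicE.
      by have -> : (x \in B) = (x + y \in A) by apply/idP/idP; rewrite !inE.
    by rewrite /W iter_step_op_shift add0r.
  have y0 := enorm_ge0 y.
  have s'0 : 0 < s - enorm y / 2 by lra.
  rewrite uB; apply: (IH B (s - enorm y / 2) D) => //.
  - rewrite -[B]setTI; apply: measurable_rVD => //; exact: measurable_cst.
  - by move=> x /As h; have := ler_enormD x y; lra.
  - by move=> a b Aa Ab; have := AD _ _ Aa Ab; rewrite opprD addrACA subrr addr0.
have p3 : \int[nu]_y (beta y * u y) <= M3 * F * D `^ gamma.
  (* A uniform bound on U applied to the indicator of A survives the remaining walk, which preserves
     order and constants. *)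
  pose U := step_op nu 0 beta.
  have -> : \int[nu]_y (beta y * u y) = U u 0.
    by rewrite /U /step_op mul0r add0r; apply: eq_Rintegral => y _; rewrite add0r.
  rewrite /u /U (iter_step_op_commute _ _ _ walk_om_int ibeta b1).
  have bU : bounded_mfun (step_op nu 0 beta (\1_A : V -> R)) by exact: bounded_mfun_step.
  have := iter_step_op_le walk_k_ge0 walk_om_ge0 walk_om_int j bU (bounded_mfun_cst (M3 * F * D `^ gamma)).
  rewrite (iter_step_op_cst walk_om_int walk_mass); apply => x.
  rewrite /step_op mul0r add0r.
  pose B := [set y | A (x + y)] `&` [set y | s < enorm y].
  have mB : measurable B.
    apply: measurableI; last exact: measurable_enorm_gt.
    by rewrite -[[set y | _]]setTI; apply: (measurable_transl x).
  have nuB : (nu B <= M3%:E * f s * (D `^ gamma)%:E)%E.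
    apply: nu_diam_le => //; rewrite ?(ltW s0) ?(ltW D0)//.
    - by move=> y [_ /ltW].
    - move=> a b [Aa _] [Ab _]; have := AD _ _ Aa Ab.
      by rewrite opprD addrACA subrr add0r.
  have ibA : rintegrable nu (fun y => beta y * \1_A (x + y)) by exact: rintegrable_weight.
  rewrite -lee_fin RintegralE//.
  apply: (@le_trans _ _ (\int[nu]_y (\1_B y)%:E)%E).
    apply: ge0_le_integral => //.
    - by move=> y _; rewrite lee_fin /beta !big_jumpE !mulr_ge0// indicE.
    - by apply/measurable_EFinP; exact: rintegrable_measurable ibA.
    - by apply/measurable_EFinP; exact: measurable_indic.
    - move=> y _; rewrite lee_fin /beta !big_jumpE !indicE.
      have [xyA|xyA] := boolP (x + y \in A); last by rewrite mulr0.
      case: (ltP s (enorm y)) => ys; last by rewrite mulr0 mul0r.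
      rewrite (@mem_set _ B); last by split => //; rewrite inE in xyA.
      by case: (_ < _)%R; rewrite ?mul0r ?mul1r.
  rewrite integral_indic// setIT; apply: le_trans nuB _.
  by rewrite -fsE -!EFinM.
rewrite iterS -/u /W /step_op -fsE -EFinM lee_fin.
have -> : \int[nu]_y (om y * u (0 + y)) =
    q * (\int[nu]_y (al y * u y) + \int[nu]_y (beta y * u y)).
  rewrite -RintD; last 2 first.
  - by have := rintegrable_weight 0 ial bu; under eq_fun do rewrite add0r.
  - by have := rintegrable_weight 0 ibeta bu; under eq_fun do rewrite add0r.
  rewrite -RintZ; last first.
    apply: rintegrableD.
      by have := rintegrable_weight 0 ial bu; under eq_fun do rewrite add0r.
    by have := rintegrable_weight 0 ibeta bu; under eq_fun do rewrite add0r.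
  by apply: eq_Rintegral => y _; rewrite add0r /om bE; ring.
have NR : 0 < N%:R :> R by rewrite ltr0n.
set K := walk_const j; set G := D `^ gamma.
have h1 : k * u 0 <= K * G * F by apply: le_trans p1; rewrite ler_piMl// walk_k_le1.
have h2 : q * \int[nu]_y (al y * u y) <= K * G * F * (4 * M4 / N%:R).
  apply: le_trans (ler_wpM2l (ltW q0) p2) _.
  have -> : q * (walk_const j * D `^ gamma * M4 * F * Psi nu r^-1) =
     K * G * F * (M4 / N%:R) * (t * Psi nu r^-1) by rewrite /q /K /G; ring.
  have -> : K * G * F * (4 * M4 / N%:R) = K * G * F * (M4 / N%:R) * 4 by ring.
  apply: ler_wpM2l => //.
  by apply: mulr_ge0; [rewrite mulr_ge0// ltW|rewrite divr_ge0// ltW].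
have h3 : q * \int[nu]_y (beta y * u y) <= K * G * F * N%:R^-1.
  apply: le_trans (ler_wpM2l (ltW q0) p3) _.
  have -> : q * (M3 * F * D `^ gamma) = t * M3 * (G * F * N%:R^-1) by rewrite /q /G; ring.
  have -> : K * G * F * N%:R^-1 = K * (G * F * N%:R^-1) by ring.
  apply: ler_wpM2r; last exact: walk_const_ge.
  by rewrite !mulr_ge0 ?invr_ge0 ?(ltW NR) ?(ltW Dg0).
have -> : walk_const j.+1 * G * F =
   K * G * F + K * G * F * (4 * M4 / N%:R) + K * G * F * N%:R^-1.
  by rewrite /walk_const exprSr /K /walk_const; ring.
lra.
Qed.

Lemma walk_const_le j : (j <= N)%N -> walk_const j <= t * M3 * expR (4 * M4 + 1).
Proof.
move=> jN; have NR : 0 < N%:R :> R by rewrite ltr0n.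
rewrite /walk_const ler_pM2l ?mulr_gt0//.
apply: (@le_trans _ _ ((1 + (4 * M4 + 1) / N%:R) ^+ N)); first exact: ler_weXn2l.
have -> : 4 * M4 + 1 = (4 * M4 + 1) / N%:R * N%:R by rewrite divfK// gt_eqF.
rewrite expRM_natr lerXn2r ?nnegrE ?expR_ge0 ?(le_trans ler01)//; last first.
  by rewrite divfK ?gt_eqF// expR_ge1Dx.
by rewrite divfK ?gt_eqF.
Qed.

End big_jump_walk.

(** * The scale h *)

Section levy_measure.
Context {R : realType} {n : nat}.
Notation V := 'rV[R]_n.
Notation leb := (@lebesgue_rV R n).

Lemma levy_cap_rintegrable (nu : {measure set V -> \bar R}) :
  symmetric_levy_measure nu -> rintegrable nu levy_cap.
Proof.
move=> [_ capoo _]; apply: ge0_rintegrable => //; last exact: levy_cap_ge0.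
apply: measurable_minr => //; apply: measurable_funX.
by apply: measurable_enorm; exact: measurable_id.
Qed.

Lemma levy_sigma_finite (nu : {measure set V -> \bar R}) :
  symmetric_levy_measure nu -> sigma_finite setT nu.
Proof.
move=> lnu; have icap := levy_cap_rintegrable lnu; have [nu0 _ _] := lnu.
have m0 : measurable [set 0 : V].
  rewrite (_ : [set 0] = ~` [set y : V | 0 < enorm y]).
    by apply: measurableC; exact: measurable_enorm_gt.
  apply/seteqP; split => [y /= ->|y /= /negP]; first by rewrite enorm0 ltxx.
  by rewrite -leNgt => y0; apply: enorm_eq0; apply/eqP; rewrite eq_le y0 enorm_ge0.
exists (fun k => [set 0] `|` [set y : V | k.+1%:R^-1 < enorm y]).
  apply/esym; rewrite -subTset => y _.
  have [y0|y0] := eqVneq (enorm y) 0.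
    by exists 0 => //; left; exact: enorm_eq0.
  have {}y0 : 0 < enorm y by rewrite lt_def y0 enorm_ge0.
  have [k _ /(_ k (leqnn _)) /= kP] := near_infty_natSinv_lt (PosNum y0).
  by exists k => //; right.
move=> k; split; first by apply: measurableU => //; exact: measurable_enorm_gt.
apply: (@le_lt_trans _ _ (nu [set 0%R] + nu [set y : V | (k.+1%:R^-1 < enorm y)%R])%E).
  by apply: measureU2 => //; exact: measurable_enorm_gt.
rewrite nu0 add0e.
have k0 : 0 < k.+1%:R^-1 :> R by rewrite invr_gt0.
have := integrable_lty measurableT (rintegrable_big_jump icap k0) => /=.
by rewrite integral_indic ?setIT//; exact: measurable_enorm_gt.
Qed.

(** A Lindelöf argument: every point off the support has a null neighbourhood, which contains a null
    ball around that point's rational approximation, and there are countably many such balls. *)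
Lemma support_eball_null (nu : {measure set V -> \bar R}) (r : R) :
  measure_support nu `<=` eball 0 r -> nu [set y : V | r < enorm y] = 0%E.
Proof.
move=> supp.
pose e (k : nat) : R := k.+1%:R^-1.
have e0 k : 0 < e k by rewrite invr_gt0.
pose B (i : 'rV[rat]_n * nat) : set V := ball (map_mx ratr i.1 : V) (e i.2).
have mB i : measurable (B i) by apply: sub_sigma_algebra; exact: ball_open.
pose F i := if `[< nu (B i) = 0%E >] then B i else set0.
pose G k := oapp F set0 (unpickle k).
have Gnull k : nu.-negligible (G k).
  rewrite /G; case: unpickle => [i|] /=; last exact: negligible_set0.
  rewrite /F; case: asboolP => [Bi|_]; last exact: negligible_set0.
  by apply/negligibleP.
apply/negligibleP; first exact: measurable_enorm_gt.
apply: negligibleS (negligible_bigcup Gnull) => y /= ry.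
have [U [oU Uy nU]] : exists U, [/\ open U, U y & nu U = 0%E].
  apply/not_existsP => h; have : measure_support nu y.
    move=> U oU Uy; rewrite lt0e measure_ge0 andbT; apply/eqP => nU.
    by apply: (h U).
  by move=> /supp; rewrite /eball /= subr0 ltNge (ltW ry).
have /nbhs_ballP[s /= s0 sU] : nbhs y U by move: oU; rewrite openE; apply.
have [k ks] : exists k, e k + e k < s.
  have /ltr_add_invr[k] : 0 < s / 2 by rewrite divr_gt0.
  rewrite add0r => k_s; exists k.
  by rewrite [ltRHS](splitr s) ltrD.
have ratP x : exists q : rat, `|x - ratr q| < e k.
  have /rat_in_itvoo[q] : x - e k < x + e k by rewrite ltrD2l gtrN.
  by rewrite in_itv/= => qx; exists q; rewrite distrC ltr_distl.
have [c cP] := choice ratP.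
pose i : 'rV[rat]_n * nat := (\row_j c (y 0 j), k).
have By : B i y.
  by split=> // a b; rewrite !mxE /ball/= /ball_ distrC ord1; exact: cP.
exists (pickle i) => //; rewrite /G pickleK /= /F.
case: asboolP => //; case.
apply/eqP; rewrite eq_le measure_ge0 andbT -nU le_measure ?inE//.
  exact: sub_sigma_algebra.
move=> w Bw; apply: sU; apply: (le_ball (ltW ks)).
by apply: ball_triangle Bw; exact: ball_sym.
Qed.

Section jump_split.
Variable nu : {sigma_finite_measure set V -> \bar R}.
Hypothesis icap : rintegrable nu levy_cap.

Lemma small_big_jump r (y : V) : small_jump r y + big_jump r y = 1 :> R.
Proof.
by rewrite small_jumpE big_jumpE; case: (ltP r (enorm y)) => _; rewrite ?add0r ?addr0.
Qed.

Lemma rintegrable_big_onem r xi : 0 < r ->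
  rintegrable nu (fun y => big_jump r y * (1 - cos (dotv xi y))).
Proof.
by move=> r0; apply: rintegrable_weight_onem; exact: rintegrable_big_jump.
Qed.

Lemma Phi_split r xi : 0 < r ->
  Phi nu xi = wPhi nu (small_jump r) xi + wPhi nu (big_jump r) xi.
Proof.
move=> r0; rewrite /Phi /wPhi -RintD.
- by apply: eq_Rintegral => y _; rewrite -mulrDl small_big_jump mul1r.
- apply: (rintegrable_onem_cos (measurable_small_jump r)).
    by move=> y; rewrite small_jumpE.
  by apply: rintegrable_small_sqr => //; exact: ltW.
- exact: rintegrable_big_onem.
Qed.

Lemma wPhi_big_ge0 r xi : 0 <= wPhi nu (big_jump r) xi.
Proof. by apply: wPhi_ge0 => y; rewrite big_jumpE. Qed.

Lemma wPhi_big_le r xi : 0 < r -> wPhi nu (big_jump r) xi <= 2 * \int[nu]_y big_jump r y.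
Proof.
move=> r0; apply: wPhi_le_mass; first exact: rintegrable_big_jump.
by move=> y; rewrite big_jumpE.
Qed.

Section bounded_support.
Variable r : R.
Hypotheses (r0 : 0 < r) (nur : nu [set y : V | r < enorm y] = 0%E).

Lemma Phi_bounded_support xi : Phi nu xi = wPhi nu (small_jump r) xi.
Proof.
have b0 : \int[nu]_y big_jump r y = 0.
  rewrite /Rintegral integral_indic ?setIT ?[X in fine X]nur//.
  exact: measurable_enorm_gt.
have := wPhi_big_le xi r0; rewrite b0 mulr0 => h.
have := wPhi_big_ge0 r xi; rewrite (Phi_split xi r0); lra.
Qed.

Lemma measurable_Phi : measurable_fun setT (Phi nu).
Proof.
rewrite (_ : Phi nu = wPhi nu (small_jump r)); last first.
  by apply/funext => xi; exact: Phi_bounded_support.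
apply: measurable_wPhi; first exact: measurable_small_jump.
  by move=> y; rewrite small_jumpE.
by apply: rintegrable_small_sqr => //; exact: ltW.
Qed.

Lemma Rint_sqr_bounded_support :
  \int[nu]_y (enorm y ^+ 2) = \int[nu]_y (small_jump r y * enorm y ^+ 2).
Proof.
have me2 : measurable_fun setT (fun y : V => enorm y ^+ 2).
  by apply: measurable_funX; apply: measurable_enorm; exact: measurable_id.
rewrite /Rintegral; congr fine; apply: ge0_ae_eq_integral => //.
- exact/measurable_EFinP.
- by apply/measurable_EFinP; apply: measurable_funM => //; exact: measurable_small_jump.
- by move=> y _; rewrite lee_fin sqr_ge0.
- by move=> y _; rewrite lee_fin mulr_ge0 ?sqr_ge0// small_jumpE.
exists [set y : V | r < enorm y]; split => //; first exact: measurable_enorm_gt.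
move=> y /= h; rewrite ltNge; apply/negP => yr; apply: h => _.
by rewrite small_jumpE yr mul1r.
Qed.

End bounded_support.
End jump_split.
End levy_measure.

Section scale.
Context {R : realType} {n : nat}.
Notation V := 'rV[R]_n.
Notation leb := (@lebesgue_rV R n).
Variable nu : {sigma_finite_measure set V -> \bar R}.
Hypothesis icap : rintegrable nu levy_cap.
Hypothesis mPhi : measurable_fun setT (Phi nu).
Variables (M0 t : R).
Hypotheses (n0 : (0 < n)%N) (t0 : 0 < t) (M00 : 0 < M0).
Let h := hscale nu t.
Hypothesis Hint : (\int[leb]_xi (expR (- (t * Phi nu xi)) * enorm xi)%:E
      <= (M0 * h ^- n.+1)%:E)%E.

Let mexp : measurable_fun setT (fun xi => expR (- (t * Phi nu xi))).
Proof. by do 2 apply: measurableT_comp => //; exact: measurable_funM. Qed.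

Let mint : measurable_fun setT (fun xi => expR (- (t * Phi nu xi)) * enorm xi).
Proof.
by apply: measurable_funM => //; apply: measurable_enorm; exact: measurable_id.
Qed.

(* hscale t is 0 by convention when the set defining Psi_inv has no supremum; the
   bound Hint would then read int e^(-t Phi) |xi| <= M0 * 0, so that case cannot occur. *)
Let int_gt0 : (0 < \int[leb]_xi (expR (- (t * Phi nu xi)) * enorm xi)%:E)%E.
Proof.
pose a : V := const_mx 1; pose b : V := const_mx 2.
pose D := [set v : V | forall i, a 0 i <= v 0 i <= b 0 i].
have mD : measurable D by exact: measurable_box.
pose L := \int[nu]_y levy_cap y.
have L0 : 0 <= L by apply: Rint_ge0 => y; exact: levy_cap_ge0.
pose K := expR (- (t * ((2 + n%:R * 4) * L))).
have vol : leb D = 1%:E.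
  rewrite lebesgue_rV_box; last by move=> i; rewrite !mxE ler1n.
  by rewrite big1// => i _; rewrite !mxE; ring.
apply: (@lt_le_trans _ _ (\int[leb]_xi (K * \1_D xi)%:E)%E).
  under eq_integral do rewrite EFinM.
  rewrite ge0_integralZl//=; last 2 first.
  - by apply/measurable_EFinP; exact: measurable_indic.
  - by rewrite lee_fin expR_ge0.
  rewrite integral_indic// setIT.
  by rewrite [X in (_ * X)%E]vol mule1 lte_fin expR_gt0.
apply: ge0_le_integral => //.
- by move=> xi _; rewrite lee_fin mulr_ge0 ?expR_ge0// indicE.
- by apply/measurable_EFinP; apply: measurable_funM => //; exact: measurable_indic.
- by apply/measurable_EFinP.
move=> xi _; rewrite lee_fin indicE; case: (boolP (xi \in D)) => [|_]; last first.
  by rewrite mulr0 mulr_ge0 ?expR_ge0 ?enorm_ge0.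
rewrite inE => xiD; rewrite ler_pM ?expR_ge0//.
  rewrite ler_expR lerN2 ler_pM2l//; apply: le_trans (Phi_le icap xi) _.
  rewrite ler_wpM2r// lerD2l sqr_enormE.
  rewrite (_ : n%:R * 4 = \sum_(i < n) (2 : R) ^+ 2); last first.
    by rewrite sumr_const card_ord -mulr_natl; ring.
  apply: ler_sum => i _; have := xiD i; rewrite !mxE => /andP[x1 x2].
  by rewrite lerXn2r ?nnegrE// (le_trans _ x1).
have := xiD (Ordinal n0); rewrite !mxE => /andP[x1 _].
by apply: le_trans (ler_coord_enorm xi (Ordinal n0)); rewrite ger0_norm// (le_trans _ x1).
Qed.

Let S := [set r | 0 < r /\ Psi nu r = t^-1].

Lemma has_sup_Psi_inv : has_sup S.
Proof.
apply: contrapT => /sup_out S0.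
move: Hint; rewrite /h /hscale /Psi_inv -/S S0 invr0 expr0n /= invr0 mulr0.
by rewrite leNgt int_gt0.
Qed.

Lemma hscale_gt0 : 0 < h.
Proof.
rewrite /h /hscale invr_gt0; have [[r Sr] ub] := has_sup_Psi_inv.
by apply: (lt_le_trans Sr.1); exact: (sup_upper_bound has_sup_Psi_inv).
Qed.

(** 1/h is the supremum of the level set of Psi at 1/t and is not shown to belong to it. The set has
    a point r beyond half of that supremum, and the doubling inequality turns Psi(r) = 1/t into the
    factor 4. *)
Lemma Psi_hscale : t * Psi nu h^-1 <= 4.
Proof.
have h0 := hscale_gt0; rewrite /h /hscale invrK.
set s := Psi_inv nu t^-1.
have s0 : 0 < s by move: h0; rewrite /h /hscale invr_gt0.
have [r Sr] : exists2 r, S r & s - s / 2 < r.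
  by apply: sup_adherent; [rewrite divr_gt0|exact: has_sup_Psi_inv].
have [r0 Er] := Sr => sr.
have : Psi nu s <= 4 * t^-1.
  rewrite -Er; apply: le_trans (Psi_mul2 icap (ltW r0)).
  by apply: (ler_Psi icap) => //; [exact: ltW|lra].
by rewrite ler_pdivlMr// mulrC.
Qed.

Lemma mass_big_jump_le : t * \int[nu]_y big_jump h y <= 64 * n%:R ^+ 2.
Proof.
have := Rint_big_jump_le icap hscale_gt0 => H.
apply: (le_trans (ler_wpM2l (ltW t0) H)).
rewrite mulrCA (_ : 64 * n%:R ^+ 2 = 16 * n%:R ^+ 2 * 4); last by ring.
by rewrite ler_wpM2l ?Psi_hscale// mulr_ge0// sqr_ge0.
Qed.

Lemma sqr_small_jump_le :
  t * \int[nu]_y (small_jump h y * enorm y ^+ 2) <= 64 * n%:R ^+ 2 * h ^+ 2.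
Proof.
have := Rint_small_sqr_le icap hscale_gt0 => H.
apply: (le_trans (ler_wpM2l (ltW t0) H)).
have -> : t * (8 * n%:R * h ^+ 2 * Psi nu h^-1) = 8 * n%:R * h ^+ 2 * (t * Psi nu h^-1) by ring.
apply: (@le_trans _ _ (8 * n%:R * h ^+ 2 * 4)).
  by rewrite ler_wpM2l ?Psi_hscale// mulr_ge0 ?sqr_ge0// mulr_ge0.
have n1 : 1 <= n%:R :> R by rewrite ler1n.
have -> : 8 * n%:R * h ^+ 2 * 4 = 32 * n%:R * h ^+ 2 by ring.
by rewrite ler_wpM2r ?sqr_ge0//; nra.
Qed.

(** On the cube of side 2/h the integrand is at most 1, which gives 2^n h^-n; off the cube 1 <= h
    |xi|, and the hypothesis gives h M0 h^(-n-1). *)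
Lemma rintegrable_exp_Phi : rintegrable leb (fun xi => expR (- (t * Phi nu xi))) /\
  \int[leb]_xi expR (- (t * Phi nu xi)) <= (2 ^+ n + M0) * h ^- n.
Proof.
have h0 := hscale_gt0; have hi0 : 0 < h^-1 by rewrite invr_gt0.
pose a : V := const_mx (- h^-1); pose b : V := const_mx h^-1.
pose D := [set v : V | forall i, a 0 i <= v 0 i <= b 0 i].
have mD : measurable D by exact: measurable_box.
have vol : leb D = ((2 * h^-1) ^+ n)%:E.
  rewrite lebesgue_rV_box; last by move=> i; rewrite !mxE; lra.
  rewrite -[X in (_ ^+ X)]card_ord -prodr_const; congr (_%:E).
  by apply: eq_bigr => i _; rewrite !mxE; ring.
have iD : rintegrable leb (\1_D : V -> R).
  apply: ge0_rintegrable; [exact: measurable_indic|by move=> x; rewrite indicE|].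
  by rewrite integral_indic// setIT [X in (X < _)%E]vol ltry.
have ie : rintegrable leb (fun xi => expR (- (t * Phi nu xi)) * enorm xi).
  apply: ge0_rintegrable => //.
    by move=> xi; rewrite mulr_ge0 ?expR_ge0 ?enorm_ge0.
  by apply: le_lt_trans Hint _; rewrite ltry.
have iG := rintegrableD iD (rintegrableZ h ie).
have le xi : expR (- (t * Phi nu xi)) <= \1_D xi + h * (expR (- (t * Phi nu xi)) * enorm xi).
  rewrite indicE; case: (boolP (xi \in D)) => xiD.
    apply: (@le_trans _ _ 1).
      by rewrite -expR0 ler_expR oppr_le0 mulr_ge0 ?(ltW t0)// Phi_ge0.
    by rewrite lerDl !mulr_ge0 ?expR_ge0 ?enorm_ge0 ?(ltW h0).
  rewrite add0r mulrCA ler_peMr ?expR_ge0//.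
  move: xiD; rewrite notin_setE => /existsNP[i].
  rewrite !mxE -ler_norml => /negP; rewrite -ltNge => /ltW hi.
  by rewrite mulrC -ler_pdivrMr// mul1r (le_trans hi)// ler_coord_enorm.
have iE : rintegrable leb (fun xi => expR (- (t * Phi nu xi))).
  by apply: rintegrable_le iG => // xi; rewrite ger0_norm ?expR_ge0.
split => //; apply: le_trans (ler_Rint iE iG le) _.
rewrite RintD//; last exact: rintegrableZ.
rewrite RintZ// mulrDl; apply: lerD.
  rewrite /Rintegral integral_indic// setIT [X in fine X]vol /=.
  by rewrite exprMn exprVn.
have : \int[leb]_xi (expR (- (t * Phi nu xi)) * enorm xi) <= M0 * h ^- n.+1.
  by rewrite -lee_fin RintegralE.
move=> /(ler_wpM2l (ltW h0)) /le_trans; apply.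
by rewrite exprS invfM mulrCA (mulrA h) divff ?mul1r// gt_eqF.
Qed.

End scale.

(** * Density estimates *)

Section decay_profile.
Context {R : realType}.

Definition profile (kap s : R) : R := expR (- (s / 4 * ln (1 + kap * s))).

Lemma profile_noninc kap s s' : 0 <= kap -> 0 <= s -> s <= s' ->
  profile kap s' <= profile kap s.
Proof.
move=> k0 s0 ss'; have s'0 := le_trans s0 ss'.
rewrite ler_expR lerN2; apply: ler_pM.
- by rewrite divr_ge0.
- by rewrite ln_ge0// lerDl mulr_ge0.
- by rewrite ler_pM2r.
- by rewrite ler_ln ?posrE ?ltr_wpDr ?mulr_ge0// lerD2l ler_wpM2l.
Qed.

(** Once log(1 + kap s) >= 8 the exponent is at most -2s; before that s <= e^8/kap, which the
    constant absorbs. The rate 2 leaves room for a factor e^(k+1) in [profile_sum_le]. *)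
Lemma profile_exp_le kap : 0 < kap ->
  exists2 C, 0 < C & forall s, 0 <= s -> profile kap s <= C * expR (- (2 * s)).
Proof.
move=> k0; exists (expR (2 * (expR 8 / kap))); first exact: expR_gt0.
move=> s s0; rewrite -expRD ler_expR.
have l0 : 0 <= ln (1 + kap * s) by rewrite ln_ge0// lerDl mulr_ge0// ltW.
have [big|small] := leP (expR 8) (1 + kap * s).
  have l8 : 8 <= ln (1 + kap * s).
    by rewrite -[X in X <= _](expRK 8) ler_ln ?posrE ?expR_gt0// (lt_le_trans (expR_gt0 8)).
  have : 0 <= 2 * (expR 8 / kap) by rewrite mulr_ge0// divr_ge0 ?expR_ge0// ltW.
  have : s / 4 * 8 <= s / 4 * ln (1 + kap * s) by rewrite ler_wpM2l// divr_ge0.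
  lra.
have sk : s <= expR 8 / kap by rewrite ler_pdivlMr// mulrC; lra.
have : 0 <= s / 4 * ln (1 + kap * s) by rewrite mulr_ge0// divr_ge0.
lra.
Qed.

Lemma exprn_le_fact_expR (x : R) n : 0 <= x -> x ^+ n <= n`!%:R * expR x.
Proof.
move=> x0; case: n => [|n]; first by rewrite expr0 fact0 mul1r -expR0 ler_expR.
have h := expR_ge1Dxn n x0.
rewrite [leRHS]mulrC -ler_pdivrMr ?ltr0n ?fact_gt0//.
by apply: le_trans h; rewrite lerDr.
Qed.

Lemma geometric_le (z : R) K : 0 <= z -> z < 1 -> \sum_(k < K) z ^+ k <= (1 - z)^-1.
Proof.
move=> z0 z1; have z1' : 0 < 1 - z by rewrite subr_gt0.
rewrite -[leRHS]mul1r ler_pdivlMr//.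
suff -> : (\sum_(k < K) z ^+ k) * (1 - z) = 1 - z ^+ K by rewrite gerBl exprn_ge0.
elim: K => [|K IH]; first by rewrite big_ord0 mul0r expr0 subrr.
by rewrite big_ord_recr /= mulrDl IH exprSr; ring.
Qed.

(** Here 2 (k+1) is the diameter bound of the k-th shell in units of h. The power is n, not gamma,
    so that [Sd] depends only on n and kap. Since (k+1)^n <= n! e^(k+1), a geometric series of ratio
    1/e remains. *)
Lemma profile_sum_le kap n : 0 < kap ->
  exists2 Sd, 0 < Sd & forall K,
    \sum_(k < K) profile kap k%:R * (2 * k.+1%:R) ^+ n <= Sd.
Proof.
move=> k0; have [C C0 HC] := profile_exp_le k0.
pose z : R := expR (- 1); pose A := C * 2 ^+ n * n`!%:R * expR 1.
have z1 : z < 1 by rewrite /z expR_lt1 oppr_lt0.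
have z1' : 0 < 1 - z by rewrite subr_gt0.
have A0 : 0 < A by rewrite /A !mulr_gt0 ?expR_gt0 ?exprn_gt0 ?ltr0n ?fact_gt0.
exists (A * (1 - z)^-1); first by rewrite mulr_gt0// invr_gt0.
move=> K; apply: (@le_trans _ _ (A * \sum_(k < K) z ^+ k)); last first.
  by rewrite ler_pM2l// geometric_le// expR_ge0.
rewrite mulr_sumr; apply: ler_sum => k _.
have h1 := HC k%:R (ler0n _ _).
have h2 := exprn_le_fact_expR n (ler0n R k.+1).
apply: (@le_trans _ _ (C * expR (- (2 * k%:R)) * (2 ^+ n * (n`!%:R * expR k.+1%:R)))).
  apply: ler_pM => //; first exact: expR_ge0.
  by rewrite exprMn ler_pM2l ?exprn_gt0.
rewrite /A /z -expRM_natr.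
have -> : C * expR (- (2 * k%:R)) * (2 ^+ n * (n`!%:R * expR k.+1%:R)) =
  C * 2 ^+ n * n`!%:R * (expR (- (2 * k%:R)) * expR k.+1%:R) by ring.
rewrite -[leRHS]mulrA -!expRD ler_wpM2l// ?mulr_ge0 ?exprn_ge0 ?ler0n ?(ltW C0)//.
by rewrite ler_expR -natr1; lra.
Qed.

(* al is an approximate minimiser of the tilted exponent. *)
Lemma legendre_le (B s : R) (al := ln (1 + s / (1 + B)) / 2) : 0 <= B -> 0 <= s ->
  0 <= al /\ - (al * s) + al ^+ 2 / 2 + al ^+ 2 * expR al * B / 2 <=
    - (s / 4 * ln (1 + (1 + B)^-1 * s)).
Proof.
move=> B0 s0; have B1 : 0 < 1 + B by rewrite ltr_wpDr.
have sB : 0 <= s / (1 + B) by rewrite divr_ge0// ltW.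
have al0 : 0 <= al by rewrite /al divr_ge0// ln_ge0// lerDl.
split => //; rewrite (mulrC (1 + B)^-1 s).
have -> : ln (1 + s / (1 + B)) = 2 * al by rewrite /al; lra.
have e2 : expR al ^+ 2 = 1 + s / (1 + B).
  by rewrite -expRM_natr /al divfK// lnK// posrE ltr_wpDr.
have e1 := expR_ge1Dx al.
(* From al e^al <= e^(2 al) - 1 = s/(1 + B). Hence the two quadratic terms together cost at most
   half of the gain al s. *)
have : (1 + B) * (al * expR al) <= s.
  have : al * expR al <= s / (1 + B).
    have -> : s / (1 + B) = expR al ^+ 2 - 1 by rewrite e2; ring.
    nra.
  by rewrite ler_pdivlMr// mulrC.
set E := expR al in e1 *; move=> h.
have E1 : 1 <= E by lra.
have h2 : (1 + B) * (al * E) * al <= s * al by rewrite ler_wpM2r.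
have h3 : al ^+ 2 <= al ^+ 2 * E by rewrite ler_peMr// sqr_ge0.
have -> : - (s / 4 * (2 * al)) = - (al * s) + s * al / 2 by field.
have -> : al ^+ 2 * E * B / 2 = ((1 + B) * (al * E) * al - al ^+ 2 * E) / 2 by field.
lra.
Qed.

End decay_profile.

(** * Summing the profile over shells *)

Section walk_profile.
Context {R : realType} {n : nat}.
Notation V := 'rV[R]_n.
Variable nu : {sigma_finite_measure set V -> \bar R}.
Hypothesis icap : rintegrable nu levy_cap.
Variables (f : R -> \bar R) (gamma M3 M4 : R).
Hypotheses (gamma0 : 0 <= gamma <= n%:R) (M30 : 0 < M3) (M40 : 0 < M4).
Hypothesis f_ge0 : forall s, 0 <= s -> (0 <= f s)%E.
Hypothesis f_noninc : forall s s', 0 <= s -> s <= s' -> (f s' <= f s)%E.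
Hypothesis nu_le : forall A : set V, measurable A ->
  (nu A <= M3%:E * f (delta A) * (diam A `^ gamma))%E.
Variable h : R.
Hypothesis h0 : 0 < h.
Hypothesis int_f : forall s, 0 < s ->
  (\int[nu]_(y in [set y | (h < enorm y)%R])
        f (Num.max s (enorm y) - enorm y / 2)%R
      <= M4%:E * f s * (Psi nu h^-1)%:E)%E.
Variables (t : R) (t0 : 0 < t) (tPsi : t * Psi nu h^-1 <= 4).
Variables (N : nat) (N0 : (0 < N)%N).
Let Q := \int[nu]_y big_jump h y.
Hypothesis tQN : t * Q <= N%:R.
Let W := step_op nu (1 - t / N%:R * Q) (fun y => t / N%:R * big_jump h y).
Variables (kap Sd : R) (kap0 : 0 <= kap).
Hypothesis SdP : forall K,
  \sum_(k < K) profile kap k%:R * (2 * k.+1%:R) ^+ n <= Sd.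

(** Shells around -x, kept within |y + x| <= |x|/2 so that they stay at distance at least 2 (|x|/4)
    from the origin, where the walk starts; hence the argument |x|/4 of [f]. *)
Let shell (x : V) k :=
  [set y : V | enorm (y + x) <= enorm x / 2 /\ k%:R * h <= enorm (y + x) < k.+1%:R * h].

Let measurable_shell x k : measurable (shell x k).
Proof.
have mn : measurable_fun setT (fun y : V => enorm (y + x)).
  apply: measurable_enorm; apply: measurable_rVD => //; exact: measurable_cst.
rewrite (_ : shell x k = ((fun y => enorm (y + x)) @^-1` `]-oo, enorm x / 2]) `&`
   ((fun y => enorm (y + x)) @^-1` `[k%:R * h, k.+1%:R * h[)); last first.
  by apply/seteqP; split => y; rewrite /shell /= !in_itv.
apply: measurableI; rewrite -[X in measurable X]setTI; exact: mn.
Qed.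

Let shell_diam x k : diam_le (shell x k) (2 * k.+1%:R * h).
Proof.
move=> a b [_ /andP[_ ha]] [_ /andP[_ hb]].
have -> : b - a = (b + x) + - (a + x) by rewrite opprD addrACA subrr addr0.
by apply: le_trans (ler_enormD _ _) _; rewrite enormN; lra.
Qed.

Let shell_far x k y : shell x k y -> 2 * (enorm x / 4) <= enorm y.
Proof.
move=> [hy _]; have : enorm x <= enorm (y + x) + enorm y.
  have {1}-> : x = (y + x) + - y by rewrite addrAC subrr add0r.
  by apply: le_trans (ler_enormD _ _) _; rewrite enormN.
lra.
Qed.

Let shell_pow k : (2 * k.+1%:R * h) `^ gamma <= (2 * k.+1%:R) ^+ n * h `^ gamma.
Proof.
have k1 : 1 <= 2 * k.+1%:R :> R.
  by rewrite -natrM ler1n.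
have [g0 gn] := andP gamma0.
have k2 := le_trans ler01 k1.
rewrite (powRM _ k2 (ltW h0)); apply: ler_wpM2r; first exact: powR_ge0.
by rewrite -(powR_mulrn _ k2); apply: ler_powR.
Qed.

(** Away from -x the profile is at most its value at |x|/(2h); near -x it is at most its value at
    the inner radius of the shell containing y. [K] counts the shells that meet the ball |y + x| <=
    |x|/2. *)
Let profile_shells x y (K := (Num.truncn (enorm x / (2 * h))).+1) :
  profile kap (enorm (y + x) / h) <=
  profile kap (enorm x / (2 * h)) + \sum_(k < K) profile kap k%:R * \1_(shell x k) y.
Proof.
have s0 := enorm_ge0 (y + x); have x0 := enorm_ge0 x.
have p0 s : 0 <= profile kap s by exact: expR_ge0.
have S0 : 0 <= \sum_(k < K) profile kap k%:R * \1_(shell x k) y.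
  by apply: sumr_ge0 => k _; rewrite mulr_ge0// indicE.
case: (lerP (enorm (y + x)) (enorm x / 2)) => [near|far]; last first.
  apply: (@le_trans _ _ (profile kap (enorm x / (2 * h)))); last by rewrite lerDl.
  apply: profile_noninc => //; first by rewrite divr_ge0// mulr_ge0// ltW.
  by rewrite invfM mulrA ler_pM2r ?invr_gt0// ltW.
have u0 : 0 <= enorm (y + x) / h by rewrite divr_ge0// ltW.
have /andP[k1 k2] := Num.Theory.truncn_itv u0.
set k := Num.truncn (enorm (y + x) / h) in k1 k2.
have kK : (k < K)%N.
  rewrite ltnS; apply: Num.Theory.le_truncn.
  by rewrite invfM mulrA ler_pM2r ?invr_gt0.
rewrite (bigD1 (Ordinal kK)) //= indicE mem_set ?mulr1; last first.
  by split => //; rewrite -ler_pdivlMr// k1 -ltr_pdivrMr.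
rewrite addrCA; apply: (@le_trans _ _ (profile kap k%:R)).
  exact: profile_noninc.
rewrite lerDl addr_ge0//; apply: sumr_ge0 => j _; by rewrite mulr_ge0// indicE.
Qed.

Lemma walk_profile_le (u : V -> R) (C F : R) x : 0 <= C -> 0 < enorm x ->
  f (enorm x / 4) = F%:E -> bounded_mfun u ->
  (forall w, u w <= C * profile kap (enorm w / h)) ->
  iter N W u x <= C * (profile kap (enorm x / (2 * h)) +
    Sd * (h `^ gamma * (t * M3 * expR (4 * M4 + 1)) * F)).
Proof.
move=> C0 x0 fF bu uC.
have x4 : 0 < enorm x / 4 by rewrite divr_gt0.
have F0 : 0 <= F by have := f_ge0 (ltW x4); rewrite fF lee_fin.
have W0 := walk_k_ge0 N0 tQN.
have W1 (y : V) := walk_om_ge0 h t0 N0 y.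
have W2 := walk_om_int icap h0 t N.
have W3 := walk_mass icap h0 t N.
pose K := (Num.truncn (enorm x / (2 * h))).+1.
set L := t * M3 * expR (4 * M4 + 1).
have L0 : 0 <= L by rewrite mulr_ge0 ?expR_ge0// mulr_ge0// ltW.
have bS := bounded_mfun_simple (profile kap (enorm x / (2 * h)))
  (fun k => profile kap k%:R) K (measurable_shell x).
(* [walk_le] concerns the walk started at the origin, so the starting point is moved into the
   function. *)
have -> : iter N W u x = iter N W (fun y => u (y + x)) 0.
  by rewrite /W iter_step_op_shift add0r.
apply: (@le_trans _ _ (iter N W (fun y => C * (profile kap (enorm x / (2 * h)) +
    \sum_(k < K) profile kap k%:R * \1_(shell x k) y)) 0)).
  apply: (iter_step_op_le W0 W1 W2 N).
  - exact: bounded_mfun_shift.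
  - exact: bounded_mfunZ.
  - by move=> y; apply: le_trans (uC _) _; rewrite ler_wpM2l// profile_shells.
rewrite /W iter_step_opZ// ler_wpM2l//.
rewrite (iter_step_op_simple W2 W3 N _ (fun k => profile kap k%:R) K 0 (measurable_shell x)) lerD2l.
have Hw k : iter N W \1_(shell x k) 0 <= (2 * k.+1%:R) ^+ n * (h `^ gamma * L * F).
  have D0 : 0 < 2 * k.+1%:R * h by rewrite !mulr_gt0.
  have := walk_le icap (proj1 (andP gamma0)) M30 M40 f_ge0 f_noninc nu_le h0 int_f t0 tPsi
    N0 tQN N (measurable_shell x k) x4 D0 (@shell_far x k) (@shell_diam x k).
  rewrite fF -EFinM lee_fin => /le_trans; apply.
  rewrite [leRHS]mulrA ler_wpM2r// [leRHS]mulrA mulrC.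
  apply: ler_pM; rewrite ?powR_ge0//; last by apply: walk_const_le.
  by apply: ltW; apply: walk_const_gt0.
apply: (@le_trans _ _ (\sum_(k < K) (profile kap k%:R * (2 * k.+1%:R) ^+ n) *
    (h `^ gamma * L * F))).
  by apply: ler_sum => k _; rewrite -[leRHS]mulrA; apply: ler_wpM2l; [exact: expR_ge0|exact: Hw].
rewrite -mulr_suml; apply: ler_wpM2r; last exact: SdP.
by apply: mulr_ge0 => //; apply: mulr_ge0 => //; exact: powR_ge0.
Qed.

End walk_profile.

(** * Pointwise bounds on the density *)

Section estimates.
Context {R : realType} {n : nat}.
Notation V := 'rV[R]_n.
Notation leb := (@lebesgue_rV R n).
Variable nu : {sigma_finite_measure set V -> \bar R}.
Hypotheses (icap : rintegrable nu levy_cap) (nuN : symmetric_measure nu).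
Variable r0 : R.
Hypotheses (r00 : 0 < r0) (nur : nu [set y : V | r0 < enorm y] = 0%E).
Variables (M0 t : R).
Hypotheses (n0 : (0 < n)%N) (t0 : 0 < t) (M00 : 0 < M0).
Let h := hscale nu t.
Hypothesis Hint : (\int[leb]_xi (expR (- (t * Phi nu xi)) * enorm xi)%:E
      <= (M0 * h ^- n.+1)%:E)%E.
Variables (P : probability V R) (p : V -> R).
Hypotheses (pP : continuous_density P p)
  (phiP : forall xi, fourier_transform_at P xi (expR (- (t * Phi nu xi)))).

Let mPhi : measurable_fun setT (Phi nu) := measurable_Phi icap r00 nur.
Let h0 : 0 < h := hscale_gt0 icap mPhi n0 t0 Hint.
Let m0 := \int[nu]_y (enorm y ^+ 2).
Let I0 := (2 ^+ n + M0) * h ^- n.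

Let I0_gt0 : 0 < I0.
Proof. by rewrite mulr_gt0 ?invr_gt0 ?exprn_gt0// addr_gt0// exprn_gt0. Qed.

Let eI0_gt0 : 0 < expR 1 * I0.
Proof. by rewrite mulr_gt0 ?expR_gt0. Qed.

Let m0_ge0 : 0 <= m0. Proof. by apply: Rint_ge0 => y; rewrite sqr_ge0. Qed.

Let iexp := (rintegrable_exp_Phi icap mPhi n0 t0 Hint).1.
Let exp_le := (rintegrable_exp_Phi icap mPhi n0 t0 Hint).2.

Lemma Rint_gauss_exp_le c : 0 < c ->
  \int[leb]_xi (gauss c xi * expR (- (t * Phi nu xi))) <= I0.
Proof.
move=> c0; apply: le_trans exp_le; apply: ler_Rint => //.
  by apply: (gd_integrable c0); apply: gd_gauss_exp => // xi; exact: Phi_ge0.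
move=> xi; rewrite ler_piMl ?expR_ge0// -expR0 ler_expR oppr_le0.
by rewrite mulr_ge0 ?(ltW c0)// dotv_ge0.
Qed.

(** For eps <= 1/(1 + |lam|) the smoothing costs e^(eps^2 |lam|^2 / 2) <= e, the origin of the
    factor [expR 1]; the summand 1 admits lam = 0. *)
Lemma density_exp_le (lam x : V) :
  p x <= expR 1 * I0 *
    expR (- dotv lam x + t * (enorm lam ^+ 2 * expR (enorm lam * r0) * m0 / 2)).
Proof.
have l0 := enorm_ge0 lam; have l1 : 0 < 1 + enorm lam by rewrite ltr_wpDr.
apply: (density_le pP phiP (e0 := (1 + enorm lam)^-1)); first by rewrite invr_gt0.
move=> eps eps0 epsl; set c := eps ^+ 2 / 2.
have c0 : 0 < c by rewrite divr_gt0// exprn_gt0.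
have s0 (y : V) : 0 <= small_jump r0 y :> R by rewrite small_jumpE.
have sN (y : V) : small_jump r0 (- y) = small_jump r0 y :> R by rewrite !small_jumpE enormN.
have srho (y : V) : r0 < enorm y -> small_jump r0 y = 0 :> R by rewrite small_jumpE leNgt => ->.
have := trig_int_exp_le nuN c0 t0 (measurable_small_jump r0) s0 sN srho
  (rintegrable_small_sqr icap (ltW r00)) lam x.
have PhiE : wPhi nu (small_jump r0) = Phi nu.
  by apply/funext => xi; rewrite (Phi_bounded_support icap r00 nur).
rewrite PhiE -(Rint_sqr_bounded_support nur) -/m0 => /le_trans; apply.
have c1 : c * dotv lam lam <= 1.
  rewrite -sqr_enorm /c mulrAC -exprMn ler_pdivrMr//.
  apply: (@le_trans _ _ 1); last by rewrite mul1r ler1n.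
  rewrite expr_le1// ?mulr_ge0 ?(ltW eps0)//.
  apply: (@le_trans _ _ (eps * (1 + enorm lam))); first by rewrite ler_pM2l// lerDr.
  by rewrite -ler_pdivlMr// mul1r.
rewrite -[leRHS]mulrA [leRHS]mulrCA [leRHS]mulrC -expRD.
apply: ler_pM; rewrite ?expR_ge0//.
- by apply: Rint_ge0 => xi; rewrite mulr_ge0 ?expR_ge0// ltW// gauss_gt0.
- by rewrite ler_expR; lra.
- exact: Rint_gauss_exp_le.
Qed.

Lemma density_le_peak x : p x <= expR 1 * I0.
Proof.
have := density_exp_le 0 x.
by rewrite enorm0 expr0n /= !mul0r mulr0 addr0 dotvC dotv0r oppr0 expR0 mulr1.
Qed.

Lemma density_exp_dir (a : R) (x : V) : 0 <= a ->
  p x <= expR 1 * I0 *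
    expR (- (a * enorm x) + t * (a ^+ 2 * expR (a * r0) * m0 / 2)).
Proof.
move=> a0; have [x0|x0] := eqVneq (enorm x) 0.
  rewrite x0 mulr0 oppr0 add0r; apply: le_trans (density_le_peak x) _.
  rewrite -[leLHS]mulr1 ler_pM2l ?eI0_gt0// -expR0 ler_expR.
  by rewrite mulr_ge0 ?(ltW t0)// divr_ge0// mulr_ge0 ?m0_ge0// mulr_ge0 ?expR_ge0// sqr_ge0.
have {}x0 : 0 < enorm x by rewrite lt_def x0 enorm_ge0.
have := density_exp_le ((a / enorm x) *: x) x.
rewrite enormZ ger0_norm ?divr_ge0 ?(ltW x0)// divfK ?gt_eqF//.
by rewrite dotvZl -sqr_enorm expr2 mulrA divfK ?gt_eqF.
Qed.

(** Tilt by a = |x|/(2 e m0 t). The range says exactly a r0 <= 1, so e^(a r0) <= e; with X =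
    |x|^2/(4 e m0 t) the exponent is at most -2X + X/2. *)
Lemma density_le_gaussian x : enorm x <= 2 * expR 1 * m0 / r0 * t ->
  p x <= expR 1 * I0 * expR (- (enorm x ^+ 2 / (4 * expR 1 * m0 * t))).
Proof.
(* For m0 = 0 the quotient is 0 by the convention on division by 0, and the claim is the peak
   bound. *)
move=> xC; have [m00|m0n] := eqVneq m0 0.
  rewrite m00 mulr0 mul0r invr0 mulr0 oppr0 expR0 mulr1; exact: density_le_peak.
have mp : 0 < m0 by rewrite lt_def m0n.
have e0 : 0 < expR 1 :> R by exact: expR_gt0.
pose a := enorm x / (2 * expR 1 * m0 * t).
have d0 : 0 < 2 * expR 1 * m0 * t by rewrite !mulr_gt0.
have a0 : 0 <= a by rewrite divr_ge0 ?enorm_ge0// ltW.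
apply: le_trans (density_exp_dir x a0) _.
rewrite ler_pM2l ?eI0_gt0// ler_expR.
have ar : a * r0 <= 1.
  rewrite /a mulrAC ler_pdivrMr// mul1r -ler_pdivlMr//.
  by rewrite (le_trans xC)// mulrAC.
have E : expR (a * r0) <= expR 1 by rewrite ler_expR.
have xa : enorm x = a * (2 * expR 1 * m0 * t) by rewrite /a divfK// gt_eqF.
have -> : enorm x ^+ 2 / (4 * expR 1 * m0 * t) = a ^+ 2 * (expR 1 * m0 * t).
  by rewrite xa; field; rewrite !gt_eqF.
rewrite [in leLHS]xa.
have h1 : t * (a ^+ 2 * expR (a * r0) * m0 / 2) <= t * (a ^+ 2 * expR 1 * m0 / 2).
  by rewrite ler_pM2l// ler_pM2r ?invr_gt0// ler_pM2r// ler_wpM2l// sqr_ge0.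
apply: (@le_trans _ _ (- (a * (a * (2 * expR 1 * m0 * t))) + t * (a ^+ 2 * expR 1 * m0 / 2))).
  by rewrite lerD2l.
have : 0 <= a ^+ 2 * (expR 1 * m0 * t) by rewrite mulr_ge0 ?sqr_ge0// ltW// !mulr_gt0.
have -> : - (a * (a * (2 * expR 1 * m0 * t))) + t * (a ^+ 2 * expR 1 * m0 / 2) =
  - (3 / 2 * (a ^+ 2 * (expR 1 * m0 * t))) by field.
lra.
Qed.

(** With L = r0 |x|/(2 m0 t) >= e, tilt by log(L)/(2 r0), so that e^(a r0) = sqrt L. In units of Y =
    |x| log(L)/(16 r0) the linear term is -8Y, the quadratic one at most 2Y by log L <= 2 sqrt L,
    and the claim is -4Y. *)
Lemma density_le_poisson x : 2 * expR 1 * m0 / r0 * t <= enorm x ->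
  p x <= expR 1 * I0 *
    expR (- (enorm x / (4 * r0) * ln (r0 * enorm x / (2 * m0 * t)))).
Proof.
(* For m0 = 0 the argument of [ln] becomes 0 by convention, and [ln] is 0 there, so the peak bound
   suffices again. *)
move=> xC; have [m00|m0n] := eqVneq m0 0.
  rewrite m00 mulr0 mul0r invr0 mulr0 ln0// mulr0 oppr0 expR0 mulr1; exact: density_le_peak.
have mp : 0 < m0 by rewrite lt_def m0n.
have e0 : 0 < expR 1 :> R by exact: expR_gt0.
set L := r0 * enorm x / (2 * m0 * t).
have Le : expR 1 <= L.
  rewrite /L ler_pdivlMr ?mulr_gt0// -ler_pdivrMl//.
  by apply: le_trans xC; rewrite le_eqVlt; apply/orP; left; apply/eqP; ring.
have L0 : 0 < L by apply: lt_le_trans Le.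
pose l := ln L; have l1 : 1 <= l.
  by rewrite -[X in X <= _](expRK 1) ler_ln ?posrE.
have ar0 : 0 <= l / (2 * r0) by rewrite divr_ge0 ?mulr_ge0 ?(ltW r00)// (le_trans ler01).
apply: le_trans (density_exp_dir x ar0) _.
rewrite ler_pM2l ?eI0_gt0// ler_expR -/l.
have -> : l / (2 * r0) * r0 = l / 2 by field; rewrite gt_eqF.
set E := expR (l / 2).
have E2 : E ^+ 2 = L by rewrite -expRM_natr divfK// lnK.
have El : l <= 2 * E by have := expR_ge1Dx (l / 2); rewrite -/E; lra.
have E0 : 0 < E by exact: expR_gt0.
have x0 : 0 < enorm x.
  rewrite lt_def enorm_ge0 andbT; apply: contraTneq L0 => x0.
  by rewrite /L x0 mulr0 mul0r ltxx.
have tm : t * m0 = r0 * enorm x / (2 * E ^+ 2).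
  by rewrite E2 /L; field; rewrite !gt_eqF.
have -> : t * ((l / (2 * r0)) ^+ 2 * E * m0 / 2) = enorm x / (16 * r0) * l * (l / E).
  have -> : t * ((l / (2 * r0)) ^+ 2 * E * m0 / 2) =
    (t * m0) * ((l / (2 * r0)) ^+ 2 * E / 2) by ring.
  by rewrite tm; field; rewrite !gt_eqF.
have lE : l / E <= 2 by rewrite ler_pdivrMr.
have xr : 0 <= enorm x / (16 * r0) * l.
  by rewrite mulr_ge0 ?divr_ge0 ?mulr_ge0 ?(ltW r00) ?(ltW x0)// (le_trans ler01).
have := ler_wpM2l xr lE.
have -> : - (l / (2 * r0) * enorm x) = - (8 * (enorm x / (16 * r0) * l)) by field; rewrite gt_eqF.
have -> : - (enorm x / (4 * r0) * l) = - (4 * (enorm x / (16 * r0) * l)) by field; rewrite gt_eqF.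
lra.
Qed.

Section jump_bound.
Let B : R := 64 * n%:R ^+ 2.
Let kap : R := (1 + B)^-1.
Let Phis := wPhi nu (small_jump h).
Let Phib := wPhi nu (big_jump h).
Let Q := \int[nu]_y big_jump h y.

Let B0 : 0 <= B. Proof. by rewrite mulr_ge0// sqr_ge0. Qed.
Let tQ : t * Q <= B. Proof. exact: (mass_big_jump_le icap mPhi n0 t0 Hint). Qed.
Let Q0 : 0 <= Q. Proof. by apply: Rint_ge0 => y; rewrite big_jumpE. Qed.

Let ss0 (y : V) : 0 <= small_jump h y :> R. Proof. by rewrite small_jumpE. Qed.
Let ssN (y : V) : small_jump h (- y) = small_jump h y :> R.
Proof. by rewrite !small_jumpE enormN. Qed.
Let sbN (y : V) : big_jump h (- y) = big_jump h y :> R.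
Proof. by rewrite !big_jumpE enormN. Qed.
Let ssrho (y : V) : h < enorm y -> small_jump h y = 0 :> R.
Proof. by rewrite small_jumpE leNgt => ->. Qed.
Let ib : rintegrable nu (big_jump h) := rintegrable_big_jump icap h0.
Let is2 := rintegrable_small_sqr icap (ltW h0).

Let Phis_ge0 xi : 0 <= Phis xi.
Proof. by apply: Rint_ge0 => y; rewrite mulr_ge0// one_sub_cos_ge0. Qed.

Let Phib_ge0 xi : 0 <= Phib xi. Proof. exact: wPhi_big_ge0. Qed.

Let mPhis : measurable_fun setT Phis.
Proof. exact: (measurable_wPhi (measurable_small_jump h) ss0 is2). Qed.

Let mPhib : measurable_fun setT Phib.
Proof. exact: measurable_wPhi_fin. Qed.

(** Dropping the large jumps from the exponent costs at most e^(2 t nu(|y| > h)) <= e^(2B). *)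
Lemma Rint_gauss_exp_small_le c : 0 < c ->
  \int[leb]_xi (gauss c xi * expR (- (t * Phis xi))) <= expR (2 * B) * I0.
Proof.
move=> c0; apply: (@le_trans _ _ (\int[leb]_xi (expR (2 * B) *
    (gauss c xi * expR (- (t * Phi nu xi)))))); last first.
  rewrite RintZ; first by rewrite ler_pM2l ?expR_gt0// Rint_gauss_exp_le.
  by apply: (gd_integrable c0); apply: gd_gauss_exp => // xi; exact: Phi_ge0.
apply: ler_Rint.
- by apply: (gd_integrable c0); exact: gd_gauss_exp.
- apply: rintegrableZ; apply: (gd_integrable c0).
  by apply: gd_gauss_exp => // xi; exact: Phi_ge0.
move=> xi; rewrite mulrCA ler_pM2l ?gauss_gt0// -expRD ler_expR.
rewrite (Phi_split icap xi h0) -/(Phis xi) -/(Phib xi).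
have := wPhi_big_le icap xi h0; rewrite -/(Phib xi) -/Q => hb.
have : t * Phib xi <= t * (2 * Q) by rewrite ler_pM2l.
have := tQ; lra.
Qed.

Let Ts c (w : V) := trig_int (fun xi => gauss c xi * expR (- (t * Phis xi))) (fun=> 0) w.

(** Tilt by a vector of length al/h along w. Since eps <= h the smoothing term is at most al^2/2,
    and t times the second moment is at most B h^2, so the exponent becomes the one treated in
    [legendre_le]. *)
Lemma small_jump_density_le eps (w : V) : 0 < eps -> eps <= h ->
  Ts (eps ^+ 2 / 2) w <= expR (2 * B) * I0 * profile kap (enorm w / h).
Proof.
move=> e0 eh; set c := eps ^+ 2 / 2.
have c0 : 0 < c by rewrite divr_gt0// exprn_gt0.
pose s := enorm w / h.
have s0 : 0 <= s by rewrite divr_ge0 ?enorm_ge0// ltW.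
have [] := legendre_le B0 s0; set al := ln _ / 2 => al0 leg.
pose m := \int[nu]_y (small_jump h y * enorm y ^+ 2).
have m_ge0 : 0 <= m by apply: Rint_ge0 => y; rewrite mulr_ge0// sqr_ge0.
have tm : t * m <= B * h ^+ 2 := sqr_small_jump_le icap mPhi n0 t0 Hint.
have Texp lam := trig_int_exp_le nuN c0 t0 (measurable_small_jump h) ss0 ssN ssrho is2 lam w.
suff [lam [lamw laml]] : exists lam : V, dotv lam w = al * s /\ h * enorm lam <= al.
  apply: le_trans (Texp lam) _; rewrite mulrC.
  apply: ler_pM; rewrite ?expR_ge0//.
  - by apply: Rint_ge0 => xi; rewrite mulr_ge0 ?expR_ge0// ltW// gauss_gt0.
  - exact: Rint_gauss_exp_small_le.
  rewrite /profile ler_expR; apply: le_trans leg.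
  rewrite lamw -/m -!addrA lerD2l.
  have hl0 : 0 <= h * enorm lam by rewrite mulr_ge0 ?enorm_ge0// ltW.
  have hl2 : (h * enorm lam) ^+ 2 <= al ^+ 2 by rewrite ler_sqr ?nnegrE.
  have l2 := sqr_ge0 (enorm lam).
  apply: lerD.
    rewrite -sqr_enorm /c mulrAC ler_pM2r ?invr_gt0//.
    apply: le_trans hl2; rewrite exprMn ler_wpM2r// ler_sqr ?nnegrE// ltW//.
  have -> : t * (enorm lam ^+ 2 * expR (enorm lam * h) * m / 2) =
    t * m * (enorm lam ^+ 2 * expR (enorm lam * h) / 2) by ring.
  apply: (@le_trans _ _ (B * h ^+ 2 * (enorm lam ^+ 2 * expR (enorm lam * h) / 2))).
    by rewrite ler_wpM2r// divr_ge0// mulr_ge0 ?expR_ge0.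
  have -> : B * h ^+ 2 * (enorm lam ^+ 2 * expR (enorm lam * h) / 2) =
    (h * enorm lam) ^+ 2 * expR (enorm lam * h) * B / 2 by ring.
  rewrite ler_pM2r ?invr_gt0// ler_wpM2r//.
  apply: ler_pM; rewrite ?sqr_ge0 ?expR_ge0//.
  by rewrite ler_expR mulrC.
have [w0|w0] := eqVneq (enorm w) 0.
  exists 0; rewrite enorm0 mulr0 /s w0 mul0r mulr0; split => //.
  by rewrite dotvC dotv0r.
have {}w0 : 0 < enorm w by rewrite lt_def w0 enorm_ge0.
exists ((al / (h * enorm w)) *: w); split.
  rewrite dotvZl -sqr_enorm /s; field; by rewrite !gt_eqF.
rewrite enormZ ger0_norm; last by rewrite divr_ge0// mulr_ge0// ltW.
by rewrite le_eqVlt; apply/orP; left; apply/eqP; field; rewrite !gt_eqF.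
Qed.

Lemma iter_walk_small_jump_density N c (x : V) : 0 < c ->
  iter N (step_op nu (1 - t / N%:R * Q) (fun y => t / N%:R * big_jump h y)) (Ts c) x =
  trig_int (fun xi => gauss c xi * expR (- (t * Phis xi)) *
    (1 - t * Phib xi / N%:R) ^+ N) (fun=> 0) x.
Proof.
move=> c0; set q := t / N%:R.
have iom : rintegrable nu (fun y => q * big_jump h y) by exact: rintegrableZ.
have C0 xi : step_cos nu (1 - q * Q) (fun y => q * big_jump h y) xi = 1 - t * Phib xi / N%:R.
  rewrite /step_cos; under eq_Rintegral do rewrite -mulrA.
  rewrite RintZ; last exact: rintegrable_weight_cos.
  by rewrite /Phib wPhiE// -/Q /q; ring.
have S0 xi : step_sin nu (fun y => q * big_jump h y) xi = 0.
  have i1 := rintegrable_weight_sin iom xi.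
  have := Rint_opp nuN i1; rewrite /step_sin.
  under eq_Rintegral do rewrite sbN dotvNr sinN mulrN.
  by rewrite RintN// => ?; lra.
rewrite /Ts (iter_step_op_trig_sym c0 _ iom)//; last exact: gd_gauss_exp.
by congr (trig_int _ _ x); apply/funext => xi; rewrite C0.
Qed.

(** The walk multiplies the small-jump coefficient by (1 - t Phib/N)^N, which tends to e^(-t Phib)
    and restores the full symbol. A bound on the walk that is uniform in N thus bounds the smoothed
    density. *)
Lemma cvg_walk_small_jump_density c (x : V)
    (N := fun j : nat => (j.+1 + Num.bound (t * Q))%N) : 0 < c ->
  iter (N j) (step_op nu (1 - t / (N j)%:R * Q) (fun y => t / (N j)%:R * big_jump h y))
    (Ts c) x @[j --> \oo] -->
  trig_int (fun xi => gauss c xi * expR (- (t * Phi nu xi))) (fun=> 0) x.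
Proof.
move=> c0; have jN j : (j < N j)%N by rewrite /N addSn ltnS leq_addr.
under eq_fun do rewrite iter_walk_small_jump_density//.
pose a_ j xi := gauss c xi * expR (- (t * Phis xi)) * (1 - t * Phib xi / (N j)%:R) ^+ N j.
apply: (cvg_trig_int c0 (a_ := a_)).
- move=> j; apply: measurable_funM; first exact: measurable_gauss_exp.
  apply: measurable_funX; apply: measurable_funB => //.
  by apply: measurable_funM => //; exact: measurable_funM.
- exact: measurable_gauss_exp.
- move=> j xi; have Nj0 : 0 < (N j)%:R :> R by rewrite ltr0n /N addSn.
  rewrite normrM; apply: le_trans (gauss_exp_le c t0 (Phis_ge0 xi)).
  apply: ler_piMr => //; rewrite normrX exprn_ile1// ler_norml.
  have v0 : 0 <= t * Phib xi / (N j)%:R by rewrite divr_ge0// mulr_ge0// ltW.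
  have v2 : t * Phib xi / (N j)%:R <= 2.
    rewrite ler_pdivrMr//; have := wPhi_big_le icap xi h0; rewrite -/(Phib xi) -/Q => hb.
    apply: (@le_trans _ _ (t * (2 * Q))); first by rewrite ler_pM2l.
    rewrite mulrCA ler_pM2l// (le_trans (ltW (archi_boundP (mulr_ge0 (ltW t0) Q0))))//.
    by rewrite ler_nat /N leq_addl.
  by apply/andP; split; lra.
- move=> xi; rewrite /a_ (Phi_split icap xi h0) -/(Phis xi) -/(Phib xi).
  rewrite mulrDr opprD expRD mulrA; apply: cvgM; first exact: cvg_cst.
  apply: (euler_limit (u := fun=> t * Phib xi)) => //.
  + by move=> _; rewrite mulr_ge0// ltW.
  + exact: cvg_cst.
Qed.

Lemma jump_density_le (f : R -> \bar R) (gamma M3 M4 Sd F : R) (x : V) :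
  0 <= gamma <= n%:R -> 0 < M3 -> 0 < M4 ->
  (forall s, 0 <= s -> (0 <= f s)%E) ->
  (forall s s', 0 <= s -> s <= s' -> (f s' <= f s)%E) ->
  (forall A : set V, measurable A ->
    (nu A <= M3%:E * f (delta A) * (diam A `^ gamma))%E) ->
  (forall s, 0 < s ->
    (\int[nu]_(y in [set y | (h < enorm y)%R])
        f (Num.max s (enorm y) - enorm y / 2)%R
      <= M4%:E * f s * (Psi nu h^-1)%:E)%E) ->
  (forall K, \sum_(k < K) profile kap k%:R * (2 * k.+1%:R) ^+ n <= Sd) ->
  0 < enorm x -> f (enorm x / 4) = F%:E ->
  p x <= expR (2 * B) * I0 * (profile kap (enorm x / (2 * h)) +
    Sd * (h `^ gamma * (t * M3 * expR (4 * M4 + 1)) * F)).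
Proof.
move=> gamma0 M30 M40 f_ge0 f_noninc nu_le int_f SdP x0 fF.
have kap0 : 0 <= kap by rewrite invr_ge0 addr_ge0.
apply: (density_le pP phiP h0) => eps e0 eh.
have c0 : 0 < eps ^+ 2 / 2 by rewrite divr_gt0// exprn_gt0.
set K := (X in _ <= X).
have cv := @cvg_walk_small_jump_density _ x c0.
apply: (ler_cvg_to cv (cvg_cst K)).
apply: nearW => j; have gT := @gd_gauss_exp _ _ (eps ^+ 2 / 2) _ t0 _ mPhis Phis_ge0.
have gz : gauss_dominated (eps ^+ 2 / 2) (fun _ : V => 0 : R).
  by split => //; exists 0 => xi; rewrite normr0 mul0r.
apply: (walk_profile_le icap gamma0 M30 M40 f_ge0 f_noninc nu_le h0 int_f t0
  (Psi_hscale icap mPhi n0 t0 Hint) _ _ kap0 SdP) => //.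
- rewrite (le_trans (ltW (archi_boundP (mulr_ge0 (ltW t0) Q0))))//.
  by rewrite ler_nat leq_addl.
- by rewrite mulr_ge0 ?expR_ge0// ltW.
- by split; [exact: (measurable_trig_int c0)|exact: (trig_int_bounded c0)].
- by move=> w; exact: small_jump_density_le.
Qed.

End jump_bound.
End estimates.

Theorem theorem4p3 (R : realType) (d : nat) (d_gt0 : (0 < d)%N)
    (M0 : R) (M0_gt0 : 0 < M0) :
  exists theta c2 c3 : R, [/\ 0 < theta, 0 < c2 & 0 < c3] /\
  forall M3 M4 : R, 0 < M3 -> 0 < M4 ->
  exists c1 : R, 0 < c1 /\
  forall (nu : {measure set 'rV[R]_d -> \bar R})
    (P : R -> probability 'rV[R]_d R) (p : R -> 'rV[R]_d -> R)
    (r0 gamma : R) (f : R -> \bar R),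
  let h := hscale nu in
  let m0 : R := \int[nu]_y (enorm y ^+ 2) in
  let Cstar : R := 2 * expR 1 * m0 / r0 in
  symmetric_levy_measure nu ->
  nu setT = +oo%E ->
  convolution_semigroup P ->
  (forall (t : R) (xi : 'rV[R]_d), 0 <= t ->
    fourier_transform_at (P t) xi (expR (- (t * Phi nu xi)))) ->
  (forall t : R, 0 < t -> continuous_density (P t) (p t)) ->
  (forall t : R, 0 < t ->
    (\int[lebesgue_rV d]_xi (expR (- (t * Phi nu xi)) * enorm xi)%:E
      <= (M0 * h t ^- d.+1)%:E)%E) ->
  0 < r0 ->
  measure_support nu `<=` eball 0 r0 ->
  0 <= gamma <= d%:R ->
  (forall s : R, 0 <= s -> (0 <= f s)%E) ->
  (forall s s' : R, 0 <= s -> s <= s' -> (f s' <= f s)%E) ->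
  (forall A : set 'rV[R]_d, measurable A ->
    (nu A <= M3%:E * f (delta A) * (diam A `^ gamma))%E) ->
  (forall s r : R, 0 < s -> 0 < r ->
    (\int[nu]_(y in [set y | (r < enorm y)%R])
        f (Num.max s (enorm y) - enorm y / 2)%R
      <= M4%:E * f s * (Psi nu r^-1)%:E)%E) ->
  forall (t : R) (x : 'rV[R]_d), 0 < t ->
  [/\ enorm x <= theta * h t -> p t x <= c1 * h t ^- d,
      theta * h t <= enorm x ->
        ((p t x)%:E <= c1%:E *
          ((t * h t `^ (gamma - d%:R))%:E * f (enorm x / 4)%R +
           (h t ^- d * expR (- (c2 * (enorm x / h t)
                                * ln (1 + c3 * enorm x / h t))))%:E))%E,
      enorm x <= Cstar * t ->
        p t x <= c1 * (h t ^- d *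
          expR (- (enorm x ^+ 2 / (4 * expR 1 * m0 * t))))
    & Cstar * t <= enorm x ->
        p t x <= c1 * (h t ^- d *
          expR (- (enorm x / (4 * r0)
                   * ln (r0 * enorm x / (2 * m0 * t)))))].
Proof.
pose B : R := 64 * d%:R ^+ 2; pose kap := (1 + B)^-1.
have B0 : 0 <= B by rewrite mulr_ge0// sqr_ge0.
have kap0 : 0 < kap by rewrite invr_gt0 ltr_wpDr.
have [Sd Sd0 SdP] := profile_sum_le d kap0.
(* The values 1/8 and kap/2 come from evaluating the profile at |x|/(2h). The peak bound holds for
   every x and the jump bound for every nonzero x, so theta = 1 is a free choice. *)
exists 1, 8^-1, (kap / 2); split; first by split; rewrite ?invr_gt0// divr_gt0.
move=> M3 M4 M30 M40.
pose E0 := 2 ^+ d + M0; have E00 : 0 < E0 by rewrite addr_gt0// exprn_gt0.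
pose G := M3 * expR (4 * M4 + 1).
have G0 : 0 < G by rewrite mulr_gt0// expR_gt0.
pose a1 := expR 1 * E0; pose a2 := expR (2 * B) * E0.
have a10 : 0 < a1 by rewrite mulr_gt0// expR_gt0.
have a20 : 0 < a2 by rewrite mulr_gt0// expR_gt0.
have SG0 : 0 < Sd * G by rewrite mulr_gt0.
(* [a1] serves the first, third and fourth bounds; in the second, [a2] goes with the small-jump
   profile and a2 Sd G with the term containing [f]. *)
pose c1 := a1 + a2 * (1 + Sd * G).
have c10 : 0 < c1 by rewrite addr_gt0// mulr_gt0// addr_gt0.
exists c1; split => // nu P p r0 gamma f h m0 Cstar lnu _ _ phiP pP Hint r00 supp
  gamma0 f_ge0 f_noninc nu_le int_f t x t0.
have nur := support_eball_null supp.
have icap := levy_cap_rintegrable lnu.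
have [nu' nuE] := sigma_finite_measure_pack (levy_sigma_finite lnu).
subst nu; have [_ _ nuN] := lnu.
have phit xi := phiP t xi (ltW t0).
have h0 : 0 < h t := hscale_gt0 icap (measurable_Phi icap r00 nur) d_gt0 t0 (Hint t t0).
have hd0 : 0 < h t ^- d by rewrite invr_gt0 exprn_gt0.
have c1X X : 0 <= X -> expR 1 * ((2 ^+ d + M0) * h t ^- d) * X <= c1 * (h t ^- d * X).
  move=> X0; have -> : expR 1 * ((2 ^+ d + M0) * h t ^- d) * X = a1 * (h t ^- d * X).
    by rewrite /a1 /E0; ring.
  apply: ler_wpM2r; first by rewrite mulr_ge0// ltW.
  by rewrite /c1 lerDl mulr_ge0 ?(ltW a20)// addr_ge0// ltW.
split.
- move=> _; have := density_le_peak icap nuN r00 nur d_gt0 t0 (Hint t t0) (pP t t0) phit x.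
  by move=> /le_trans; apply; have := c1X 1 ler01; rewrite !mulr1.
- rewrite mul1r => hx; have x0 : 0 < enorm x by exact: lt_le_trans hx.
  have x4 : 0 <= enorm x / 4 by rewrite divr_ge0// ltW.
  have hg0 : 0 < t * h t `^ (gamma - d%:R) by rewrite mulr_gt0// powR_gt0.
  (* [jump_density_le] takes a finite value of [f]; where [f] is infinite, so is the right-hand
     side. *)
  have [foo|fin] := eqVneq (f (enorm x / 4)) +oo%E.
    rewrite foo gt0_muley ?lte_fin// addye// gt0_muley ?leey ?lte_fin//.
  have {fin} /fineK fE : f (enorm x / 4) \is a fin_num.
    by rewrite ge0_fin_numE ?f_ge0// ltey.
  rewrite -fE; set F := fine _ in fE *.
  have F0 : 0 <= F by rewrite -lee_fin fE f_ge0.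
  have := jump_density_le icap nuN r00 nur d_gt0 t0 M0_gt0 (Hint t t0) (pP t t0) phit
    gamma0 M30 M40 f_ge0 f_noninc nu_le (fun s s0 => int_f s (h t) s0 h0) SdP x0 (esym fE).
  rewrite -[(_ * F%:E)%E]EFinM -EFinD -EFinM lee_fin => /le_trans; apply.
  set pr := expR (- _); have -> : profile (1 + 64 * d%:R ^+ 2)^-1 (enorm x / (2 * h t)) = pr.
    rewrite /profile /pr -/B -/kap.
    have -> : enorm x / (2 * h t) / 4 = 8^-1 * (enorm x / h t) by field; rewrite gt_eqF.
    by have -> : kap * (enorm x / (2 * h t)) = kap / 2 * enorm x / h t by field; rewrite gt_eqF.
  have -> : h t `^ (gamma - d%:R) = h t `^ gamma * h t ^- d.
    rewrite powRB; last by rewrite (gt_eqF h0) implybT.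
    by rewrite powR_mulrn// ltW.
  set hg := h t `^ gamma; have hg_ge0 : 0 <= hg by exact: powR_ge0.
  set H := h t ^- d.
  have pr0 : 0 <= pr by exact: expR_ge0.
  rewrite -/B -/E0 -/a2.
  have -> : expR (2 * B) * (E0 * H) * (pr + Sd * (hg * (t * M3 * expR (4 * M4 + 1)) * F)) =
    a2 * (H * pr) + a2 * (Sd * G) * (t * (hg * H) * F) by rewrite /a2 /G; ring.
  rewrite [X in _ <= X]mulrDr addrC; apply: lerD; apply: ler_wpM2r.
  + by rewrite !mulr_ge0// ltW.
  + by rewrite /c1 mulrDr mulr1 addrA lerDr addr_ge0// ltW.
  + by rewrite mulr_ge0// ltW.
  + by rewrite /c1 mulrDr mulr1 addrCA lerDl addr_ge0 ?mulr_ge0// ltW// mulr_gt0.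
- move=> hx; have := density_le_gaussian icap nuN r00 nur d_gt0 t0 M0_gt0 (Hint t t0) (pP t t0) phit hx.
  by move=> /le_trans; apply; apply: c1X; exact: expR_ge0.
- move=> hx; have := density_le_poisson icap nuN r00 nur d_gt0 t0 M0_gt0 (Hint t t0) (pP t t0) phit hx.
  by move=> /le_trans; apply; apply: c1X; exact: expR_ge0.
Qed.
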